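(* Let $n$ be an odd positive integer and let $M^n=\mathbb{R}^n/\Gamma\in\mathcal{F}_{CHD}$ be an $n$-dimensional flat manifold of the family described in the context, with its two spin structures $\alpha_+$ and $\alpha_-$. Then the difference of the eta invariants of the corresponding Dirac operators is an even integer: $$\eta_{M^n,\alpha_+}(0)-\eta_{M^n,\alpha_-}(0)\in2\mathbb{Z}.$$
   Context: The family $\mathcal{F}_{CHD}$. Let $k\ge 0$ be an integer and $n=2k+1$. Let $a_1,\dots,a_n$ be a basis of $\mathbb{R}^n$ and let $A:\mathbb{R}^n\to\mathbb{R}^n$ be the linear map with $A(a_j)=a_{j+1}$ for $j<n-1$, $A(a_{n-1})=-a_1-\dots-a_{n-1}$, $A(a_n)=a_n$. Let $g(x)=A(x)+\frac1n a_n$ and let $\Gamma=\langle a_1,\dots,a_{n-1},g\rangle$ (the $a_j$ acting as translations). Equip $\mathbb{R}^n$ with an $A$-invariant scalar product for which there is an orthonormal basis $e_1,\dots,e_n$ with $e_1,\dots,e_{n-1}\in\mathrm{Span}[a_1,\dots,a_{n-1}]$, $e_n=a_n$ (in particular $a_n$ has norm 1), and, for $1\le j\le k$, $A(e_{2j-1})=\cos(2\pi j/n)e_{2j-1}+\sin(2\pi j/n)e_{2j}$ and $A(e_{2j})=-\sin(2\pi j/n)e_{2j-1}+\cos(2\pi j/n)e_{2j}$. An $n$-dimensional manifold $M\in\mathcal{F}_{CHD}$ is the closed flat manifold $M=\mathbb{R}^n/\Gamma$ with the induced metric. Spin structures. The Clifford algebra has $e_i^2=-1$ and $e_ie_j=-e_je_i$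 for $i\ne j$; $\lambda:Spin(n)\to SO(n)$ is $\lambda(y)(x)=yxy^*$, where $(e_{j_1}\cdots e_{j_s})^*=e_{j_s}\cdots e_{j_1}$. Let $\beta=\pi/n$, $r_j=\cos(j\beta)+e_{2j-1}e_{2j}\sin(j\beta)$, $\alpha=r_1\cdots r_k$. Then $\lambda(\alpha)=A$. Put $\alpha_+=(-1)^{k(k+1)/2}\alpha$ and $\alpha_-=-\alpha_+$; these satisfy $\alpha_+^n=1$, $\alpha_-^n=-1$. The spin structure denoted $\alpha_\pm$ is given by the homomorphism $\widehat h:\Gamma\to Spin(n)$ with $\widehat h(a_j)=1$ for $j\le n-1$ and $\widehat h(g)=\alpha_\pm$, which lifts the holonomy homomorphism (linear part). Spinors. Let $g_1=\begin{pmatrix} i&0\\0&-i\end{pmatrix}$, $g_2=\begin{pmatrix}0&i\\ i&0\end{pmatrix}$, $T=\begin{pmatrix}0&-i\\ i&0\end{pmatrix}$, and let $\Sigma_{2k}=(\mathbb{C}^2)^{\otimes k}$. The Clifford action on $\Sigma_{2k}$ is: for $j\le n-1$, $e_j$ acts as $I\otimes\cdots\otimes I\otimes g_{\alpha(j)}\otimes T\otimes\cdots\otimes T$ with $[\frac{j-1}{2}]$ factors $T$, where $\alpha(j)=1$ for $j$ odd and $\alpha(j)=2$ for $j$ even; $e_n$ acts as $i\,T\otimes\cdots\otimes T$. Spinors on $M$ are the smooth maps $\phi:\mathbb{R}^n\to\Sigma_{2k}$ invariant under the $\Gamma$-action $(\gamma\phi)(x)=\widehat h(\gamma)\phi(\gamma^{-1}x)$,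 and the Dirac operator is $D\phi=\sum_{j=1}^n e_j\frac{\partial\phi}{\partial x_j}$, with $x_1,\dots,x_n$ the coordinates determined by $e_1,\dots,e_n$. Eta invariant. $\eta_M(z)$ is the meromorphic extension to $\mathbb{C}$ of $\sum_{\lambda\ne0}\mathrm{sgn}(\lambda)|\lambda|^{-z}$ ($\mathrm{Re}\,z$ large), the sum being over nonzero eigenvalues of $D$ counted with multiplicity; it is regular at $0$, and the eta invariant is $\eta_M(0)$. The subscript $\alpha_\pm$ indicates the spin structure. *)

(* Defs.v *)
From HB Require Import structures.
From mathcomp Require Import all_boot all_order all_algebra.
From mathcomp Require Import complex mxtens.
From mathcomp Require Import all_classical all_reals all_analysis.

Set Implicit Arguments.
Unset Strict Implicit.
Unset Printing Implicit Defensive.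

Import Order.TTheory GRing.Theory Num.Theory.
Import numFieldNormedType.Exports.

Local Open Scope classical_set_scope.
Local Open Scope card_scope.
Local Open Scope complex_scope.
Local Open Scope ring_scope.

(* Indices are shifted by one: [chd_a M]`_j is a_(j+1) and [chd_e M]`_j is
   e_(j+1), for 0 <= j < n = 2k+1; in particular a_n is [chd_a M]`_(2k). The invariant
   scalar product is the one with Gram matrix [chd_dot M]. *)

Record chd (R : realType) (k : nat) := Chd {
  chd_a : k.*2.+1.-tuple 'cV[R]_(k.*2.+1);
  chd_A : 'M[R]_(k.*2.+1);
  chd_dot : 'M[R]_(k.*2.+1);
  chd_e : k.*2.+1.-tuple 'cV[R]_(k.*2.+1);
  chd_a_basis : basis_of fullv chd_a;
  chd_A_shift : forall j : nat, (j.+1 < k.*2)%N ->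
    chd_A *m chd_a`_j = chd_a`_j.+1;
  chd_A_last : forall j : nat, j.+1 = k.*2 ->
    chd_A *m chd_a`_j = - \sum_(0 <= l < k.*2) chd_a`_l;
  chd_A_fix : chd_A *m chd_a`_(k.*2) = chd_a`_(k.*2);
  chd_dot_sym : chd_dot^T = chd_dot;
  chd_dot_pos : forall x : 'cV[R]_(k.*2.+1), x != 0 ->
    0 < (x^T *m chd_dot *m x) 0 0;
  chd_dot_inv : chd_A^T *m chd_dot *m chd_A = chd_dot;
  chd_e_basis : basis_of fullv chd_e;
  chd_e_orthonormal : forall i j : 'I_(k.*2.+1),
    ((tnth chd_e i)^T *m chd_dot *m tnth chd_e j) 0 0 = (i == j)%:R;
  chd_e_span : forall j : nat, (j < k.*2)%N ->
    chd_e`_j \in <<take k.*2 chd_a>>%VS;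
  chd_e_last : chd_e`_(k.*2) = chd_a`_(k.*2);
  chd_A_rot1 : forall j : nat, (j < k)%N ->
    chd_A *m chd_e`_(j.*2) =
      cos (2 * pi * j.+1%:R / k.*2.+1%:R) *: chd_e`_(j.*2)
      + sin (2 * pi * j.+1%:R / k.*2.+1%:R) *: chd_e`_(j.*2.+1);
  chd_A_rot2 : forall j : nat, (j < k)%N ->
    chd_A *m chd_e`_(j.*2.+1) =
      - sin (2 * pi * j.+1%:R / k.*2.+1%:R) *: chd_e`_(j.*2)
      + cos (2 * pi * j.+1%:R / k.*2.+1%:R) *: chd_e`_(j.*2.+1)
}.

Section Clifford.
Variable R : realType.

Fixpoint tens_rec (k : nat) (F : nat -> 'M[R[i]]_2) : 'M[R[i]]_(2 ^ k.+1) :=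
  if k is k'.+1 then F 0%N *t tens_rec k' (fun p => F p.+1) else F 0%N.

(* F 0 (x) F 1 (x) ... (x) F (k - 1), acting on (C^2)^(tensor k) = C^(2^k) *)
Definition tens (k : nat) (F : nat -> 'M[R[i]]_2) : 'M[R[i]]_(2 ^ k) :=
  if k is k'.+1 return 'M[R[i]]_(2 ^ k) then tens_rec k' F else 1%:M.

Definition cliff_g1 : 'M[R[i]]_2 :=
  \matrix_(r, c) (if r == c then if r == 0 then 'i%C else - 'i%C else 0).
Definition cliff_g2 : 'M[R[i]]_2 :=
  \matrix_(r, c) (if r == c then 0 else 'i%C).
Definition cliff_T : 'M[R[i]]_2 :=
  \matrix_(r, c) (if r == c then 0 else if r == 0 then - 'i%C else 'i%C).

(* The action of e_(j+1): for j < 2k, j./2 factors T to the right of g. The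
   1-based index j+1 is odd, so that g = g_1, when j is even. *)
Definition cliff (k j : nat) : 'M[R[i]]_(2 ^ k) :=
  if (j < k.*2)%N then
    tens k (fun p =>
      if ((p + j./2).+1 < k)%N then 1%:M
      else if ((p + j./2).+1 == k)%N then (if odd j then cliff_g2 else cliff_g1)
      else cliff_T)
  else 'i%C *: tens k (fun=> cliff_T).

(* The spin representation is faithful on Spin(n), so elements of Spin(n) are
   represented by the endomorphisms of Sigma_(2k) by which they act. *)

Definition spin_r (k j : nat) : 'M[R[i]]_(2 ^ k) :=
  (cos (j.+1%:R * (pi / k.*2.+1%:R)))%:C%:M
  + (sin (j.+1%:R * (pi / k.*2.+1%:R)))%:C *: (cliff k j.*2 *m cliff k j.*2.+1).

Definition spin_alpha (k : nat) : 'M[R[i]]_(2 ^ k) :=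
  \big[mulmx/1%:M]_(0 <= j < k) spin_r k j.

Inductive spin_sign := SpinPlus | SpinMinus.

Definition spin_alpha_pm (k : nat) (s : spin_sign) : 'M[R[i]]_(2 ^ k) :=
  let alpha_plus := (-1) ^+ ((k * k.+1)./2) *: spin_alpha k in
  if s is SpinPlus then alpha_plus else - alpha_plus.

(* (B, v) stands for the affine map x |-> B x + v *)
Definition affine (n : nat) : Type := ('M[R]_n * 'cV[R]_n)%type.
Definition aff_app n (f : affine n) (x : 'cV[R]_n) : 'cV[R]_n := f.1 *m x + f.2.
Definition aff_id n : affine n := (1%:M, 0).
Definition aff_comp n (f g : affine n) : affine n :=
  (f.1 *m g.1, f.1 *m g.2 + f.2).
Definition aff_inv n (f : affine n) : affine n :=
  (invmx f.1, - (invmx f.1 *m f.2)).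

(* The graph of the homomorphism hhat : Gamma -> Spin(n): the subgroup of
   Aff(R^n) x GL(Sigma_(2k)) generated by the (a_j, 1), j <= n-1, and by
   (g, alpha_s). Its first projection is Gamma. *)
Inductive spin_hom (k : nat) (M : chd R k) (s : spin_sign) :
    affine k.*2.+1 -> 'M[R[i]]_(2 ^ k) -> Prop :=
| spin_hom_id : spin_hom M s (aff_id _) 1%:M
| spin_hom_a (j : nat) : (j < k.*2)%N ->
    spin_hom M s (1%:M, (chd_a M)`_j) 1%:M
| spin_hom_g :
    spin_hom M s (chd_A M, k.*2.+1%:R^-1 *: (chd_a M)`_(k.*2))
                 (spin_alpha_pm k s)
| spin_hom_comp f g S T : spin_hom M s f S -> spin_hom M s g T ->
    spin_hom M s (aff_comp f g) (S *m T)
| spin_hom_inv f S : spin_hom M s f S -> spin_hom M s (aff_inv f) (invmx S).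

Fixpoint Ck n (m : nat) (f : 'cV[R]_n -> R) : Prop :=
  if m is m'.+1 then
    (forall x v, derivable f x v) /\ (forall v, Ck m' (fun x => 'D_v f x))
  else continuous f.

Definition smooth n (f : 'cV[R]_n -> R) : Prop := forall m, Ck m f.

Definition spinor_fun (k : nat) : Type := 'cV[R]_(k.*2.+1) -> 'cV[R[i]]_(2 ^ k).

Definition is_spinor k (M : chd R k) (s : spin_sign) (phi : spinor_fun k) : Prop :=
  [/\ forall i, smooth (fun x => complex.Re (phi x i 0)),
      forall i, smooth (fun x => complex.Im (phi x i 0)) &
      forall f S, spin_hom M s f S ->
        forall x, S *m phi (aff_app (aff_inv f) x) = phi x].

Definition spinor_deriv k (v : 'cV[R]_(k.*2.+1)) (phi : spinor_fun k) :
    spinor_fun k :=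
  fun x => \col_i ('D_v (fun y => complex.Re (phi y i 0)) x
                   +i* 'D_v (fun y => complex.Im (phi y i 0)) x).

(* As x_1, ..., x_n are the coordinates in the basis e_1, ..., e_n, the
   derivative with respect to x_j is the directional derivative along e_j. *)
Definition dirac k (M : chd R k) (phi : spinor_fun k) : spinor_fun k :=
  fun x => \sum_(j < k.*2.+1) cliff k j *m spinor_deriv (tnth (chd_e M) j) phi x.

Definition eigenspinors k (M : chd R k) (s : spin_sign) (mu : R) :
    set (spinor_fun k) :=
  [set phi | is_spinor M s phi /\ forall x, dirac M phi x = mu%:C *: phi x].

Definition has_dim k (E : set (spinor_fun k)) (m : nat) : Prop :=
  exists b : 'I_m -> spinor_fun k,
    (forall c : 'I_m -> R[i], E (fun x => \sum_i c i *: b i x)) /\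
    (forall phi, E phi ->
       exists! c : {ffun 'I_m -> R[i]}, phi = fun x => \sum_i c i *: b i x).

(* lam lists the nonzero eigenvalues, each as often as its multiplicity. The
   Dirac operator is symmetric, so only real eigenvalues occur. *)
Definition nonzero_spectrum k (M : chd R k) (s : spin_sign) (lam : nat -> R) : Prop :=
  (forall i, lam i != 0) /\
  forall mu, mu != 0 -> exists2 m : nat,
    has_dim (eigenspinors M s mu) m & [set i | lam i = mu] #= `I_m.

Definition cexp (z : R[i]) : R[i] :=
  (expR (complex.Re z))%:C * (cos (complex.Im z) +i* sin (complex.Im z)).

Definition eta_term (lam : R) (z : R[i]) : R[i] :=
  (Num.sg lam)%:C * cexp (- z * (ln `|lam|)%:C).

(* R[i] is endowed with its usual topology under the alias R[i]^o. *)
Definition analytic_at (F : R[i] -> R[i]) (p : R[i]) : Prop :=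
  exists c : nat -> R[i], \forall z \near (p : R[i]^o),
    series (fun i => c i * (z - p) ^+ i) @ \oo --> (F z : R[i]^o).

Definition meromorphic_at (F : R[i] -> R[i]) (p : R[i]) : Prop :=
  exists m : nat, exists2 G : R[i] -> R[i],
    analytic_at G p & \forall z \near (p : R[i]^o), z != p -> (z - p) ^+ m * F z = G z.

(* F is the meromorphic extension to C of sum_(lambda <> 0)
   sgn(lambda) |lambda|^(-z), the sum being absolutely convergent for
   Re z large; its values at the poles are irrelevant. *)
Definition is_eta_function k (M : chd R k) (s : spin_sign) (F : R[i] -> R[i]) : Prop :=
  (forall p, meromorphic_at F p) /\
  exists2 lam, nonzero_spectrum M s lam &
  exists c : R, forall z : R[i], c < complex.Re z ->
    cvg (series (fun i => `|lam i| `^ (- complex.Re z)) @ \oo) /\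
    series (fun i => eta_term (lam i) z) @ \oo --> (F z : R[i]^o).

Definition is_eta_invariant k (M : chd R k) (s : spin_sign) (v : R[i]) : Prop :=
  exists F, [/\ is_eta_function M s F, analytic_at F 0 & v = F 0].

End Clifford.

(* Main.v *)
(* On M the operator B = sum_(j<=k) (e_(2j-1) d_(2j) - e_(2j) d_(2j-1)) acts on
   spinors, anticommutes with D, and B^2 = - sum_(i<n) d_i^2. By the maximum
   principle B^2 phi = 0 forces phi to depend on x_n only, so B exchanges the
   eigenspaces for mu and -mu up to those explicit eigenspinors:
   the spectral asymmetry at mu is that of the kernels K_s(mu) of the constant
   matrices exp(- mu e_n / n) - alpha_s. They vanish unless mu = pi y with y an
   integer, and mu -> mu + n pi exchanges the two spin structures. Hence
   d(y) = (K_+(pi y) - K_+(- pi y)) - (K_-(pi y) - K_-(- pi y)) is odd and satisfies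
   d(y + n) = - d(y), and for large real t
     eta_+(t) - eta_-(t) = sum_(y=1)^n d(y) sum_(q>=0) [(pi (2qn+y))^-t - (pi (2qn+n+y))^-t].
   The inner sums are real analytic for t > 0 and tend to 1/2 as t -> 0+ (their
   terms are convex), so the difference of the eta invariants is
   1/2 sum_(y=1)^n d(y) = sum_(y=1)^k d(y). Each d(y) is even: it is 0 when k is even
   (complex conjugation maps K_s(mu) to K_s(- mu)), and when k is odd the
   matrices are real and commute with the real complex structure e_n, so that their
   kernels have even dimension. *)
Require Import Defs.
From mathcomp Require Import all_boot all_order all_algebra.
From mathcomp Require Import complex mxtens.
From mathcomp Require Import all_classical all_reals all_analysis.
From mathcomp Require Import ring lra zify.

Set Implicit Arguments.
Unset Strict Implicit.
Unset Printing Implicit Defensive.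

Import Order.TTheory GRing.Theory Num.Theory.
Import numFieldNormedType.Exports.

Local Open Scope classical_set_scope.
Local Open Scope card_scope.
Local Open Scope complex_scope.
Local Open Scope ring_scope.


(** * Directional derivatives and smooth functions *)

Section DirectionalDerivatives.
Variables (R : realType) (n : nat).
Implicit Types (f g : 'cV[R]_n -> R) (x y u v : 'cV[R]_n).

(** The eigenspaces for mu and -mu are compared through the matrices X and Y of B between them, of
    finite size because the assumed spectrum has finite multiplicities. That B phi = 0 follows from
    B^2 phi = 0 makes X and X Y have the same kernel, and likewise Y and Y X, whence equal ranks.
    The spectrum is listed in an unknown order, so the eta series is regrouped by eigenvalue at
    large real t, where it converges absolutely. The passage to t = 0 stays on the positive real
    axis. As a meromorphic extension may take any value at its poles, the identity theorem is used
    in a weak form: the identity holds at points arbitrarily close to 0. This determines the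
    difference at 0, since the eta functions are continuous there and the inner sums have the limit
    1/2. The sum over a period is divisible by 4, not just by 2, because d(n - y) = d(y) and d(n) =
    0: it is twice a sum of k even integers. *)

Lemma is_derive_line f x v t : derivable f (t *: v + x) v ->
  is_derive t (1 : R) (fun s => f (s *: v + x)) ('D_v f (t *: v + x)).
Proof.
move=> df.
have E : (fun h : R => h^-1 *: (((fun s => f (s *: v + x)) \o shift t) (h *: (1 : R))
            - f (t *: v + x)))
       = (fun h : R => h^-1 *: ((f \o shift (t *: v + x)) (h *: v) - f (t *: v + x))).
  apply/funext => h /=; congr (_ *: (f _ - _)).
  by rewrite /shift /= scalerDl [h *: 1]mulr1 addrA.
split; first by rewrite /derivable E.
by rewrite /derive E.
Qed.

Lemma is_derive_dirZ f x v (a : R) : derivable f x v ->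
  derivable f x (a *: v) /\ 'D_(a *: v) f x = a * 'D_v f x.
Proof.
move=> df.
have d1 : is_derive (a * 0) (1 : R) (fun s => f (s *: v + x)) ('D_v f x).
  have := @is_derive_line f x v (a * 0); rewrite mulr0 scale0r add0r; exact.
have d2 : is_derive (0 : R) (1 : R) (fun s : R => a * s) a.
  by apply: is_derive_eq; rewrite [LHS]mulr1.
have d3 := @is_derive1_comp _ (fun s => f (s *: v + x)) (fun s : R => a * s) _ _ _ d1 d2.
have E : (fun s => f (s *: v + x)) \o (fun s : R => a * s)
       = (fun s => f (s *: (a *: v) + x)).
  by apply/funext => s /=; rewrite scalerA mulrC.
rewrite E in d3; case: d3 => d3 e3.
have E2 : (fun h : R => h^-1 *: (((fun s => f (s *: (a *: v) + x)) \o shift 0) (h *: (1 : R))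
            - f (0 *: (a *: v) + x)))
       = (fun h : R => h^-1 *: ((f \o shift x) (h *: (a *: v)) - f x)).
  apply/funext => h /=; congr (_ *: (f _ - f _)).
    by rewrite /shift /= addr0 [h *: 1]mulr1.
  by rewrite scale0r add0r.
split; first by move: d3; rewrite /derivable E2.
by move: e3; rewrite /derive E2 => ->; rewrite mulrC.
Qed.

Lemma dir_MVT f x v : (forall y, derivable f y v) ->
  exists2 c : R, 0 < c < 1 & f (v + x) - f x = 'D_v f (c *: v + x).
Proof.
move=> df.
have d t : is_derive t (1 : R) (fun s => f (s *: v + x)) ('D_v f (t *: v + x)).
  exact: is_derive_line.
have [|c] := @MVT R (fun s => f (s *: v + x)) (fun t => 'D_v f (t *: v + x)) 0 1 ltr01 (fun t _ => d t).
  by apply: derivable_within_continuous => t _; exact: (@ex_derive _ _ _ _ _ _ _ (d t)).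
by rewrite in_itv /= scale1r scale0r add0r subr0 mulr1 => c01 ->; exists c.
Qed.

(** The mean value theorem yields intermediate points of which only the bounds |a h| <= |h| and |b
    h| <= |h| are known; continuity at x absorbs them. *)
Lemma cvg_perturb f (a b : R -> R) x u v : {for x, continuous f} ->
  (forall h, `|a h| <= `|h|) -> (forall h, `|b h| <= `|h|) ->
  f (a h *: u + (b h *: v + x)) @[h --> 0^'] --> f x.
Proof.
move=> cf ha hb.
have sm (c : R -> R) : (forall h, `|c h| <= `|h|) -> c h @[h --> 0^'] --> (0 : R).
  move=> hc; apply/cvgr0Pnorm_lt => e e0.
  near=> h; apply: le_lt_trans (hc h) _.
  near: h; apply: dnbhs0_lt; exact: e0.
have ab : a h *: u + (b h *: v + x) @[h --> 0^'] --> 0 *: u + (0 *: v + x).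
  apply: cvgD; first by apply: cvgZr_tmp; exact: sm.
  apply: cvgD; last exact: cvg_cst.
  by apply: cvgZr_tmp; exact: sm.
move: ab; rewrite !scale0r !add0r => ab.
exact: (cvg_comp _ _ ab cf).
Unshelve. all: by end_near. Qed.

Lemma cvg_dir_derive f x v : derivable f x v ->
  h^-1 * (f (h *: v + x) - f x) @[h --> 0^'] --> 'D_v f x.
Proof. by move=> df; exact: df. Qed.

(** Derivatives here are taken direction by direction, so additivity in the direction has to be
    earned. The increment along h (u + v) is split at x + h u, and its second half is h times a
    value of ['D_v f] near x by the mean value theorem. *)
Lemma derive_dirD f x u v : (forall y, derivable f y u) ->
  (forall y, derivable f y v) -> derivable f x (u + v) ->
  {for x, continuous ('D_v f)} ->
  'D_(u + v) f x = 'D_u f x + 'D_v f x.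
Proof.
move=> du dv duv cdv.
have /choice[c hc] (h : R) : exists c : R, `|c| <= `|h| /\
    f (h *: v + (h *: u + x)) - f (h *: u + x) = h * 'D_v f (c *: v + (h *: u + x)).
  have [|c c01 ->] := @dir_MVT f (h *: u + x) (h *: v).
    by move=> y; have [] := @is_derive_dirZ f y v h (dv y).
  exists (c * h); split; last first.
    by rewrite (@is_derive_dirZ f _ v h (dv _)).2 scalerA.
  by move: c01 => /andP[c0 c1]; rewrite normrM (ger0_norm (ltW c0)) ler_piMl// ltW.
have l1 := cvg_dir_derive duv.
have l2 : h^-1 * (f (h *: (u + v) + x) - f x) @[h --> 0^'] --> 'D_u f x + 'D_v f x.
  have l := @cvg_perturb ('D_v f) c id x v u cdv (fun h => (hc h).1) (fun h => lexx _).
  apply: (cvg_trans _ (cvgD (cvg_dir_derive (du x)) l)).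
  apply: near_eq_cvg; near=> h.
  have h0 : h != 0 by near: h; exact: nbhs_dnbhs_neq.
  rewrite /=; have := (hc h).2.
  set A := f (h *: v + _) => E.
  have -> : f (h *: (u + v) + x) = A.
    by rewrite /A scalerDr (addrC (h *: u)) addrA.
  rewrite [LHS]/GRing.add/=.
  have -> : 'D_v f (c h *: v + (h *: u + x)) = h^-1 * (A - f (h *: u + x)).
    by rewrite E mulrA mulVf// mul1r.
  by rewrite -mulrDr; congr (_ * _); rewrite [LHS]addrC addrA subrK.
exact: (cvg_unique _ l1 l2).
Unshelve. all: by end_near. Qed.

(** The mean value theorem is applied along v to y |-> f (h u + y) - f y, then along u to ['D_v f].
    The result serves both for the symmetry of second derivatives and for the second derivative test
    at a maximum. *)
Lemma second_difference f x u v h : (forall y, derivable f y v) ->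
  (forall y, derivable ('D_v f) y u) ->
  exists a b : R, [/\ `|a| <= `|h|, `|b| <= `|h| &
    f (h *: u + (h *: v + x)) - f (h *: v + x) - (f (h *: u + x) - f x)
      = h * h * 'D_u ('D_v f) (a *: u + (b *: v + x))].
Proof.
move=> dv duv.
pose g y := f (h *: u + y) - f y.
have dsh w y : derivable (fun y => f (w + y)) y v /\
    'D_v (fun y => f (w + y)) y = 'D_v f (w + y).
  have E : (fun h : R => h^-1 *: (((fun y => f (w + y)) \o shift y) (h *: v) - f (w + y)))
      = (fun h : R => h^-1 *: ((f \o shift (w + y)) (h *: v) - f (w + y))).
    by apply/funext => s /=; rewrite /shift /= addrCA.
  by rewrite /derivable /derive E; split => //; exact: dv.
have dg y : is_derive y v g ('D_v f (h *: u + y) - 'D_v f y).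
  have [d1 e1] := dsh (h *: u) y.
  apply: is_deriveB; [by rewrite -e1; exact: derivableP | exact: derivableP].
have dg1 y : derivable g y v by exact: (@ex_derive _ _ _ _ _ _ _ (dg y)).
have [|c /andP[c0 c1]] := @dir_MVT g x (h *: v).
  by move=> y; have [] := @is_derive_dirZ g y v h (dg1 y).
rewrite (@is_derive_dirZ g _ v h (dg1 _)).2 (@derive_val _ _ _ _ _ _ _ (dg _)).
have [|c' /andP[c'0 c'1]] := @dir_MVT ('D_v f) (c *: (h *: v) + x) (h *: u).
  by move=> y; have [] := @is_derive_dirZ ('D_v f) y u h (duv y).
rewrite (@is_derive_dirZ ('D_v f) _ u h (duv _)).2 => -> E.
exists (c' * h), (c * h); split.
- by rewrite normrM (ger0_norm (ltW c'0)) ler_piMl// ltW.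
- by rewrite normrM (ger0_norm (ltW c0)) ler_piMl// ltW.
by rewrite -mulrA -!scalerA -E /g.
Qed.

(** The second difference is symmetric in u and v, and divided by h^2 it tends to either mixed
    derivative. *)
Lemma derive_swap f x u v :
  (forall y, derivable f y u) -> (forall y, derivable f y v) ->
  (forall y, derivable ('D_v f) y u) -> (forall y, derivable ('D_u f) y v) ->
  {for x, continuous ('D_u ('D_v f))} -> {for x, continuous ('D_v ('D_u f))} ->
  'D_u ('D_v f) x = 'D_v ('D_u f) x.
Proof.
have key u' v' : (forall y, derivable f y v') ->
    (forall y, derivable ('D_v' f) y u') -> {for x, continuous ('D_u' ('D_v' f))} ->
    (h * h)^-1 * (f (h *: u' + (h *: v' + x)) - f (h *: v' + x) - (f (h *: u' + x) - f x))
      @[h --> 0^'] --> 'D_u' ('D_v' f) x.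
  move=> dv duv cuv.
  have /choice[a ha] (h : R) := @second_difference f x u' v' h dv duv.
  have /choice[b hb] (h : R) : exists b : R, [/\ `|a h| <= `|h|, `|b| <= `|h| &
    f (h *: u' + (h *: v' + x)) - f (h *: v' + x) - (f (h *: u' + x) - f x)
      = h * h * 'D_u' ('D_v' f) (a h *: u' + (b *: v' + x))] by exact: ha.
  apply: cvg_trans; last first.
    apply: (@cvg_perturb ('D_u' ('D_v' f)) a b x u' v' cuv) => h; by case: (hb h).
  apply: near_eq_cvg; near=> h.
  have h0 : h != 0 by near: h; exact: nbhs_dnbhs_neq.
  have [_ _ ->] := hb h.
  by rewrite mulrA mulVf ?mul1r// mulf_neq0.
move=> du dv duv dvu c1 c2.
have l1 := key u v dv duv c1.
have l2 := key v u du dvu c2.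
have E : (fun h => (h * h)^-1 *
      (f (h *: v + (h *: u + x)) - f (h *: u + x) - (f (h *: v + x) - f x)))
  = (fun h => (h * h)^-1 *
      (f (h *: u + (h *: v + x)) - f (h *: v + x) - (f (h *: u + x) - f x))).
  apply/funext => h; congr (_ * _); rewrite (addrCA (h *: v)).
  rewrite -[RHS]addrA -[LHS]addrA; congr (_ + _).
  by rewrite !opprD !opprK !addrA (addrC (- f (h *: u + x))).
rewrite E in l2.
exact: (cvg_unique _ l1 l2).
Unshelve. all: by end_near. Qed.

End DirectionalDerivatives.

(** * Smooth functions: closure properties and calculus rules *)

Section SmoothFunctions.
Variables (R : realType) (n : nat).
Implicit Types (f g : 'cV[R]_n -> R) (x y u v : 'cV[R]_n).

Lemma is_derive_of_line f x v (d : R) :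
  is_derive (0 : R) (1 : R) (fun s => f (s *: v + x)) d -> is_derive x v f d.
Proof.
have E : (fun h : R => h^-1 *: (((fun s => f (s *: v + x)) \o shift 0) (h *: (1 : R))
            - f (0 *: v + x)))
       = (fun h : R => h^-1 *: ((f \o shift x) (h *: v) - f x)).
  apply/funext => h /=; congr (_ *: (f _ - f _)).
    by rewrite /shift /= addr0 [h *: 1]mulr1.
  by rewrite scale0r add0r.
case; rewrite /derivable /derive E => d1 d2; split => //.
Qed.

Lemma smooth_continuous f : smooth f -> continuous f.
Proof. by move=> /(_ 0). Qed.

Lemma smooth_derivable f x v : smooth f -> derivable f x v.
Proof. by move=> /(_ 1) [/(_ x v)]. Qed.

Lemma smooth_derive f v : smooth f -> smooth ('D_v f).
Proof. by move=> sf m; have [_ /(_ v)] := sf m.+1. Qed.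

Lemma smooth_is_derive f x v : smooth f -> is_derive x v f ('D_v f x).
Proof. by move=> sf; apply: derivableP; exact: smooth_derivable. Qed.

Lemma smooth_derive_dirD f x u v : smooth f ->
  'D_(u + v) f x = 'D_u f x + 'D_v f x.
Proof.
move=> sf; apply: derive_dirD => [y|y||]; try exact: smooth_derivable.
exact: (@smooth_continuous ('D_v f) (@smooth_derive f v sf) x).
Qed.

Lemma smooth_derive_dirZ f x v (a : R) : smooth f -> 'D_(a *: v) f x = a * 'D_v f x.
Proof. by move=> sf; have [] := @is_derive_dirZ _ _ f x v a (smooth_derivable sf). Qed.

Lemma smooth_derive_dir_sum f x (I : Type) (r : seq I) (c : I -> R) (v : I -> 'cV[R]_n) :
  smooth f -> 'D_(\sum_(i <- r) c i *: v i) f x = \sum_(i <- r) c i * 'D_(v i) f x.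
Proof.
move=> sf; elim: r => [|i r IH]; first by rewrite !big_nil derive0.
by rewrite !big_cons smooth_derive_dirD// smooth_derive_dirZ// IH.
Qed.

Lemma smooth_derive_swap f x u v : smooth f -> 'D_u ('D_v f) x = 'D_v ('D_u f) x.
Proof.
move=> sf; apply: derive_swap => [y|y|y|y||]; try exact: smooth_derivable.
- exact: (@smooth_derivable _ y u (@smooth_derive f v sf)).
- exact: (@smooth_derivable _ y v (@smooth_derive f u sf)).
- exact: (@smooth_continuous _ (@smooth_derive _ u (@smooth_derive f v sf)) x).
- exact: (@smooth_continuous _ (@smooth_derive _ v (@smooth_derive f u sf)) x).
Qed.

Lemma smooth_cst (c : R) : smooth (fun _ : 'cV[R]_n => c).
Proof.
have H m : forall c : R, Ck m (fun _ : 'cV[R]_n => c).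
  elim: m => [|m IH] a; first exact: cst_continuous.
  split=> [x v|v]; first exact: derivable_cst.
  rewrite (_ : (fun x => 'D_v _ x) = (fun _ => 0)); first exact: IH.
  by apply/funext => x; exact: derive_cst.
by move=> m; exact: H.
Qed.

Lemma smooth_deriveD f g x v : smooth f -> smooth g ->
  'D_v (fun x => f x + g x) x = 'D_v f x + 'D_v g x.
Proof. by move=> sf sg; apply: deriveD; exact: smooth_derivable. Qed.

Lemma smooth_deriveM f g x v : smooth f -> smooth g ->
  'D_v (fun x => f x * g x) x = f x * 'D_v g x + g x * 'D_v f x.
Proof. by move=> sf sg; apply: deriveM; exact: smooth_derivable. Qed.

Lemma CkD m f g : smooth f -> smooth g -> Ck m (fun x => f x + g x).
Proof.
elim: m f g => [|m IH] f g sf sg.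
  have cf := smooth_continuous sf; have cg := smooth_continuous sg.
  by move=> x; exact: (cvgD (cf x) (cg x)).
split=> [x v|v]; first by apply: derivableD; exact: smooth_derivable.
rewrite (_ : (fun x => 'D_v _ x) = (fun x => 'D_v f x + 'D_v g x)).
  by apply: IH; exact: smooth_derive.
by apply/funext => x; rewrite smooth_deriveD.
Qed.

Lemma smoothD f g : smooth f -> smooth g -> smooth (fun x => f x + g x).
Proof. by move=> sf sg m; exact: CkD. Qed.

(** The derivative of a product is a sum of two products, so the induction on the order of
    differentiability runs over finite sums of products of smooth functions, a class stable under
    derivation. *)
Lemma smoothM f g : smooth f -> smooth g -> smooth (fun x => f x * g x).
Proof.
move=> sf sg m.
suff H : forall (I : Type) (r : seq I) (F G : I -> 'cV[R]_n -> R),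
    (forall i, smooth (F i) /\ smooth (G i)) -> Ck m (fun x => \sum_(i <- r) F i x * G i x).
  have := H unit [:: tt] (fun=> f) (fun=> g) (fun=> conj sf sg).
  by under eq_fun do rewrite big_seq1.
elim: m => [|m IH] I r F G sFG.
  rewrite -[Ck 0 _]/(continuous _); elim: r => [|i r IHr].
    by under eq_fun do rewrite big_nil; exact: cst_continuous.
  under eq_fun do rewrite big_cons.
  have [/smooth_continuous cF /smooth_continuous cG] := sFG i.
  by move=> x; exact: (cvgD (cvgM (cF x) (cG x)) (IHr x)).
have d (x : 'cV[R]_n) v : is_derive x v (fun x => \sum_(i <- r) F i x * G i x)
    (\sum_(i <- r) (F i x * 'D_v (G i) x + G i x * 'D_v (F i) x)).
  elim: r => [|i r IHr].
    under eq_fun do rewrite big_nil.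
    rewrite big_nil; exact: is_derive_cst.
  under eq_fun do rewrite big_cons.
  rewrite big_cons; apply: is_deriveD; apply: is_deriveM; apply: smooth_is_derive;
    by have [] := sFG i.
split=> [x v|v]; first exact: (@ex_derive _ _ _ _ _ _ _ (d x v)).
(* The Leibniz rule doubles the index set: one copy for each factor that is differentiated. *)
pose F' (j : I + I) := match j with inl i => F i | inr i => G i end.
pose G' (j : I + I) := match j with inl i => 'D_v (G i) | inr i => 'D_v (F i) end.
rewrite (_ : (fun x => 'D_v _ x) = (fun x => \sum_(j <- map inl r ++ map inr r) F' j x * G' j x)).
  by apply: IH => -[i|i]; have [? ?] := sFG i; split => //=; exact: smooth_derive.
apply/funext => x; rewrite (@derive_val _ _ _ _ _ _ _ (d x v)).
by rewrite big_cat !big_map /= big_split.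
Qed.

Lemma smoothZ f (c : R) : smooth f -> smooth (fun x => c * f x).
Proof. by move=> sf; apply: smoothM => //; exact: smooth_cst. Qed.

Lemma smooth_sum (I : Type) (r : seq I) (F : I -> 'cV[R]_n -> R) :
  (forall i, smooth (F i)) -> smooth (fun x => \sum_(i <- r) F i x).
Proof.
move=> sF; elim: r => [|i r IH].
  under eq_fun do rewrite big_nil.
  exact: (@smooth_cst 0).
under eq_fun do rewrite big_cons.
exact: (smoothD (sF i) IH).
Qed.

Lemma smooth_derive_sum (I : Type) (r : seq I) (F : I -> 'cV[R]_n -> R) x v :
  (forall i, smooth (F i)) ->
  'D_v (fun x => \sum_(i <- r) F i x) x = \sum_(i <- r) 'D_v (F i) x.
Proof.
move=> sF; elim: r => [|i r IH].
  by under eq_fun do rewrite big_nil; rewrite big_nil derive_cst.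
under eq_fun do rewrite big_cons.
by rewrite big_cons smooth_deriveD ?IH//; exact: smooth_sum.
Qed.

Lemma smooth_deriveZ f (c : R) x v : smooth f ->
  'D_v (fun x => c * f x) x = c * 'D_v f x.
Proof.
move=> sf; rewrite smooth_deriveM//; last exact: smooth_cst.
by rewrite derive_cst mulr0 addr0.
Qed.

Lemma derive_affine f (A : 'M[R]_n) (b x v : 'cV[R]_n) :
  'D_v (fun y => f (A *m y + b)) x = 'D_(A *m v) f (A *m x + b).
Proof.
have E : (fun h : R => h^-1 *: (((fun y => f (A *m y + b)) \o shift x) (h *: v) - f (A *m x + b)))
    = (fun h : R => h^-1 *: ((f \o shift (A *m x + b)) (h *: (A *m v)) - f (A *m x + b))).
  by apply/funext => h /=; rewrite /shift /= mulmxDr -scalemxAr addrA.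
by rewrite /derive E.
Qed.

Variable L : 'rV[R]_n.
Let l x := (L *m x) 0 0.

Lemma linear_form_continuous : continuous (fun x => (L *m x) 0 0).
Proof.
rewrite (_ : (fun x => _) = (fun x : 'cV[R]_n => \sum_j L 0 j * x j 0)); last first.
  by apply/funext => x; rewrite mxE.
elim: (index_enum _) => [|i r IHr].
  by under eq_fun do rewrite big_nil; exact: cst_continuous.
under eq_fun do rewrite big_cons.
move=> x; apply: (@cvgD _ _ _ _ _ _ _ _ _ _ (IHr x)).
exact: (cvgM (cvg_cst _) (@coord_continuous _ _ _ i 0 x)).
Qed.

Lemma is_derive_trig_linear x v :
  is_derive x v (fun x => cos (l x)) (- l v * sin (l x)) /\
  is_derive x v (fun x => sin (l x)) (l v * cos (l x)).
Proof.
have E (s : R) : l (s *: v + x) = s * l v + l x.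
  by rewrite /l mulmxDr -scalemxAr !mxE.
have d : is_derive (0 : R) (1 : R) (fun s : R => s * l v + l x) (l v).
  by apply: is_derive_eq; rewrite scaler0 add0r addr0 [LHS]mulr1.
split; apply: is_derive_of_line; under eq_fun do rewrite E.
  have := @is_derive1_comp _ cos (fun s : R => s * l v + l x) 0 _ _ (is_derive_cos _) d.
  by rewrite mul0r add0r => h; apply: (is_derive_eq h); rewrite !mulNr mulrC.
have := @is_derive1_comp _ sin (fun s : R => s * l v + l x) 0 _ _ (is_derive_sin _) d.
by rewrite mul0r add0r => h; apply: (is_derive_eq h); rewrite mulrC.
Qed.

Lemma derive_cos_linear x v : 'D_v (fun x => cos (l x)) x = - l v * sin (l x).
Proof. exact: (@derive_val _ _ _ _ _ _ _ (is_derive_trig_linear x v).1). Qed.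

Lemma derive_sin_linear x v : 'D_v (fun x => sin (l x)) x = l v * cos (l x).
Proof. exact: (@derive_val _ _ _ _ _ _ _ (is_derive_trig_linear x v).2). Qed.

(** The combinations a cos l + b sin l are stable under every directional derivative, so the
    induction keeps a and b general. *)
Lemma smooth_trig_linear : smooth (fun x => cos (l x)) /\ smooth (fun x => sin (l x)).
Proof.
suff H m (a b : R) : Ck m (fun x => a * cos (l x) + b * sin (l x)).
  split=> m; [have := H m 1 0|have := H m 0 1];
    by under eq_fun do rewrite mul1r mul0r ?addr0 ?add0r.
elim: m a b => [|m IH] a b /=.
  suff : continuous (fun x => a * cos (l x) + b * sin (l x)) by [].
  move=> x.
  have cl := @linear_form_continuous x.
  have c1 : cos (l y) @[y --> x] --> cos (l x).
    exact: (cvg_comp _ _ cl (@continuous_cos R (l x))).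
  have c2 : sin (l y) @[y --> x] --> sin (l x).
    exact: (cvg_comp _ _ cl (@continuous_sin R (l x))).
  have e1 : a * cos (l y) @[y --> x] --> a * cos (l x).
    exact: (cvgM (cvg_cst a) c1).
  have e2 : b * sin (l y) @[y --> x] --> b * sin (l x).
    exact: (cvgM (cvg_cst b) c2).
  exact: (cvgD e1 e2).
have d (x : 'cV[R]_n) v : is_derive x v (fun x => a * cos (l x) + b * sin (l x))
    (b * l v * cos (l x) + - (a * l v) * sin (l x)).
  have [dc ds] := is_derive_trig_linear x v.
  have := is_deriveD (is_deriveM (is_derive_cst a x v) dc) (is_deriveM (is_derive_cst b x v) ds).
  move=> h; apply: (is_derive_eq h).
  rewrite !scaler0 !addr0 addrC; congr (_ + _); first by rewrite -mulrA.
  by rewrite [LHS]mulrA mulrN.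
split=> [x v|v]; first exact: (@ex_derive _ _ _ _ _ _ _ (d x v)).
rewrite (_ : (fun x => 'D_v _ x) = (fun x => b * l v * cos (l x) + - (a * l v) * sin (l x))).
  exact: IH.
by apply/funext => x; rewrite (@derive_val _ _ _ _ _ _ _ (d x v)).
Qed.

End SmoothFunctions.

(** * The maximum principle on a lattice *)

Section MaximumPrinciple.
Variables (R : realType) (n : nat).
Implicit Types (f w : 'cV[R]_n -> R) (x y u v : 'cV[R]_n).

(** Subtracting integer parts moves the coefficients into the compact cube [0, 1]^p without changing
    the value of w. *)
Lemma periodic_max p (a : 'I_p -> 'cV[R]_n) w x : continuous w ->
  (forall i y, w (y + a i) = w y) ->
  exists t : 'rV[R]_p, forall s : 'rV[R]_p,
    w (x + \sum_i s 0 i *: a i) <= w (x + \sum_i t 0 i *: a i).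
Proof.
move=> cw pw.
pose T (t : 'rV[R]_p) := x + \sum_i t 0 i *: a i.
have cS (r : seq 'I_p) : continuous (fun t : 'rV[R]_p => \sum_(i <- r) t 0 i *: a i).
  elim: r => [|i r IHr].
    by under eq_fun do rewrite big_nil; exact: cst_continuous.
  under eq_fun do rewrite big_cons.
  move=> t; have ct := @coord_continuous _ _ _ 0 i t.
  exact: (cvgD (cvgZ ct (cvg_cst (a i))) (IHr t)).
have cT : continuous T by move=> t; exact: (cvgD (cvg_cst x) (cS _ t)).
have cwT : continuous (w \o T) by move=> t; apply: continuous_comp; [exact: cT|exact: cw].
pose B := [set t : 'rV[R]_p | forall i, [set` `[0 : R, 1]] (t 0 i)].
have cB : compact B by apply: (@rV_compact _ _ (fun _ => [set` `[0 : R, 1]])) => i; exact: segment_compact.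
have B0 : B !=set0 by exists 0 => i /=; rewrite mxE in_itv /= lexx ler01.
have [t _ tmax] := EVT_max_rV B0 cB (continuous_subspaceT cwT).
exists t => s.
have pn (c : nat) i y : w (y + c%:R *: a i) = w y.
  elim: c => [|c IH]; first by rewrite scale0r addr0.
  by rewrite -natr1 scalerDl scale1r addrA pw.
have pz (c : int) i y : w (y + c%:~R *: a i) = w y.
  case: c => c; first exact: pn.
  by rewrite NegzE mulrNz scaleNr -{2}(subrK (c.+1%:R *: a i) y) pn.
have ps (c : 'I_p -> int) y : w (y + \sum_i (c i)%:~R *: a i) = w y.
  elim: (index_enum _) => [|i r IHr]; first by rewrite big_nil addr0.
  by rewrite big_cons (addrC ((c i)%:~R *: a i)) addrA pz.
pose s' : 'rV[R]_p := \row_i (s 0 i - (Num.floor (s 0 i))%:~R).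
have -> : w (x + \sum_i s 0 i *: a i) = (w \o T) s'.
  rewrite /= /T -[RHS](ps (fun i => Num.floor (s 0 i))) -addrA -big_split.
  congr (w (_ + _)); apply: eq_bigr => i _ /=.
  by rewrite mxE -scalerDl subrK.
apply: tmax; rewrite inE => i /=; rewrite mxE in_itv /= subr_ge0 Num.Theory.floor_le /=.
by rewrite lerBlDr addrC -[1]/(1%:~R) -intrD ltW// Num.Theory.floorD1_gt.
Qed.

Lemma derive2_max_le0 f x v : smooth f -> (forall s : R, f (s *: v + x) <= f x) ->
  'D_v ('D_v f) x <= 0.
Proof.
move=> sf fmax.
(* Based at x - h v with both directions equal to v, the second difference is f (x + h v) - 2 f x +
   f (x - h v), which is nonpositive at a maximum. *)
have /choice[a ha] (h : R) := @second_difference R n f (x - h *: v) v v h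
  (fun y => @smooth_derivable R n f y v sf)
  (fun y => @smooth_derivable R n _ y v (@smooth_derive R n f v sf)).
have /choice[b hb] : forall h : R, exists b : R, [/\ `|a h| <= `|h|, `|b| <= `|h| &
  f (h *: v + (h *: v + (x - h *: v))) - f (h *: v + (x - h *: v)) -
    (f (h *: v + (x - h *: v)) - f (x - h *: v))
      = h * h * 'D_v ('D_v f) (a h *: v + (b *: v + (x - h *: v)))].
  exact: ha.
(* As |b h - h| may reach 2 |h|, the direction 2 v is used with half the coefficient, to meet the
   bound required by [cvg_perturb]. *)
have E (h : R) : b h *: v + (x - h *: v) = ((b h - h) / 2) *: (2 *: v) + x.
  by rewrite scalerA divfK ?pnatr_eq0// scalerBl addrCA [RHS]addrC.
have l : 'D_v ('D_v f) (a h *: v + (((b h - h) / 2) *: (2 *: v) + x)) @[h --> 0^']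
    --> 'D_v ('D_v f) x.
  apply: (@cvg_perturb R n ('D_v ('D_v f)) a (fun h => (b h - h) / 2) x v (2 *: v)).
  - exact: (@smooth_continuous _ _ ('D_v ('D_v f)) (@smooth_derive _ _ _ v (@smooth_derive _ _ f v sf)) x).
  - by move=> h; have [] := hb h.
  move=> h; have [_ bh _] := hb h.
  rewrite normrM normfV (ger0_norm (_ : 0 <= 2 :> R))// ler_pdivrMr//.
  by apply: le_trans (ler_normB _ _) _; rewrite mulr_natr mulr2n lerD2r.
apply: (cvgr_to_le l); near=> h.
have h0 : h != 0 by near: h; exact: nbhs_dnbhs_neq.
have [_ _] := hb h; rewrite E.
have -> : h *: v + (x - h *: v) = x by rewrite addrC subrK.
have := fmax h; have := fmax (- h); rewrite scaleNr (addrC (- _)).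
set d := 'D_v _ _; move=> h1 h2 e.
have hh : 0 < h * h by rewrite -expr2 exprn_even_gt0.
rewrite -(pmulr_rle0 _ hh) -e; move: h1 h2.
by set A := f _; set B := f _; set C := f _; clear; lra.
Unshelve. all: by end_near. Qed.

Lemma derive2_sqr f x v : smooth f ->
  'D_v ('D_v (fun x => f x * f x)) x = 2 * ('D_v f x * 'D_v f x) + 2 * (f x * 'D_v ('D_v f) x).
Proof.
move=> sf; have sdf := @smooth_derive _ _ f v sf.
have -> : 'D_v (fun x => f x * f x) = fun x => f x * 'D_v f x + f x * 'D_v f x.
  by apply/funext => y; rewrite smooth_deriveM.
have sM := smoothM sf sdf.
rewrite smooth_deriveD// smooth_deriveM//.
by rewrite -mulr2n mulrnDl !mulr_natl addrC.
Qed.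

(** In the application, u is the gradient of a harmonic f, g its matrix of second derivatives, h i j
    the second derivative along j of the i-th first derivative, r the list of pure second
    derivatives of f, and c the value of f. The last assumption says that the Laplacian of |grad
    f|^2 + eps f^2 is nonpositive; harmonicity of f and of its derivatives leaves only squares on
    its left side. *)
Lemma energy_algebra (m : nat) (g h : 'I_m -> 'I_m -> R) (u r : 'I_m -> R) (eps c : R) :
  0 < eps -> (forall i, \sum_j h i j = 0) -> \sum_j r j = 0 ->
  \sum_j (\sum_i (2 * (g i j * g i j) + 2 * (u i * h i j))
          + eps * (2 * (u j * u j) + 2 * (c * r j))) <= 0 ->
  \sum_i u i * u i <= 0.
Proof.
move=> eps0 h0 r0; rewrite big_split /= exchange_big /=.
rewrite (eq_bigr (fun i => 2 * \sum_j g i j * g i j)); last first.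
  by move=> i _; rewrite big_split /= -!mulr_sumr h0 !mulr0 addr0.
rewrite -mulr_sumr -mulr_sumr big_split /= -!mulr_sumr r0 !mulr0 addr0 => le0.
have S0 : 0 <= \sum_i \sum_j g i j * g i j.
  by apply: sumr_ge0 => i _; apply: sumr_ge0 => j _; rewrite -expr2 sqr_ge0.
have : eps * (2 * \sum_i u i * u i) <= 0.
  by apply: le_trans le0; rewrite lerDr mulr_ge0.
by rewrite pmulr_rle0// pmulr_rle0.
Qed.

Variables (m p : nat) (e : 'I_m -> 'cV[R]_n) (a : 'I_p -> 'cV[R]_n).
Variable c : 'I_m -> 'I_p -> R.
Hypothesis e_span : forall i, e i = \sum_j c i j *: a j.

(** Bernstein's method. For w = |grad f|^2 + eps f^2 the Laplacian is 2 |Hess f|^2 + 2 eps |grad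
    f|^2. At a maximum y of w over x0 + Span(a) it is nonpositive, so the gradient vanishes at y.
    Hence |grad f|^2 at x0 is at most w y = eps f(y)^2 <= eps K, with K the maximum of f^2 on the
    same set, and eps is arbitrary. *)
Lemma harmonic_grad0 f : smooth f ->
  (forall i y, f (y + a i) = f y) ->
  (forall x, \sum_i 'D_(e i) ('D_(e i) f) x = 0) ->
  forall i x, 'D_(e i) f x = 0.
Proof.
move=> sf pf hf i0 x0.
have sD i : smooth ('D_(e i) f) by exact: smooth_derive.
have sDD i j : smooth ('D_(e j) ('D_(e i) f)) by exact: smooth_derive.
have pD i j y : 'D_(e i) f (y + a j) = 'D_(e i) f y.
  have E : (fun z => f (1%:M *m z + a j)) = f.
    by apply/funext => z; rewrite mul1mx pf.
  by have := @derive_affine R n f 1%:M (a j) y (e i); rewrite E !mul1mx => <-.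
have hD i x : \sum_j 'D_(e j) ('D_(e j) ('D_(e i) f)) x = 0.
  have E j : 'D_(e j) ('D_(e j) ('D_(e i) f)) x = 'D_(e i) ('D_(e j) ('D_(e j) f)) x.
    have E1 : 'D_(e j) ('D_(e i) f) = 'D_(e i) ('D_(e j) f).
      by apply/funext => y; exact: (@smooth_derive_swap R n f y (e j) (e i)).
    apply: (etrans (congr1 (fun g => derive g x (e j)) E1)).
    exact: (@smooth_derive_swap R n ('D_(e j) f) x (e j) (e i) (sD j)).
  rewrite (eq_bigr _ (fun j _ => E j)) -smooth_derive_sum => [|j]; last exact: sDD.
  by under eq_fun do rewrite hf; rewrite derive_cst.
pose q x := \sum_i 'D_(e i) f x * 'D_(e i) f x.
pose w eps x := q x + eps * (f x * f x).
have sq : smooth q by apply: smooth_sum => i; exact: smoothM.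
have sff : smooth (fun x => f x * f x) by exact: smoothM.
have sw eps : smooth (w eps) by apply: smoothD => //; exact: smoothZ.
have pw eps i y : w eps (y + a i) = w eps y.
  by rewrite /w /q pf; under eq_bigr do rewrite !pD.
have [tK hK] := @periodic_max p a (fun x => f x * f x) x0 (smooth_continuous sff)
  (fun i y => congr1 (fun z => z * z) (pf i y)).
pose y0 := x0 + \sum_i tK 0 i *: a i; pose K := f y0 * f y0.
have K0 : 0 <= K by rewrite /K -expr2 sqr_ge0.
have key eps : 0 < eps -> q x0 <= eps * K.
  move=> eps0.
  have [t ht] := @periodic_max p a (w eps) x0 (smooth_continuous (sw eps)) (pw eps).
  pose y := x0 + \sum_i t 0 i *: a i.
  rewrite -/y in ht.
  have d2 j : 'D_(e j) ('D_(e j) (w eps)) y <= 0.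
    apply: derive2_max_le0 => // s; rewrite /y addrCA.
    (* The line through y along e_j stays in x0 + Span(a), where y is a maximum. *)
    have -> : s *: e j + \sum_i t 0 i *: a i = \sum_i (s *: (\row_i c j i) + t) 0 i *: a i.
      rewrite e_span scaler_sumr -big_split; apply: eq_bigr => i _ /=.
      by rewrite !mxE scalerDl scalerA.
    exact: ht.
  have E j : 'D_(e j) ('D_(e j) (w eps)) y =
    \sum_i (2 * ('D_(e j) ('D_(e i) f) y * 'D_(e j) ('D_(e i) f) y)
           + 2 * ('D_(e i) f y * 'D_(e j) ('D_(e j) ('D_(e i) f)) y))
    + eps * (2 * ('D_(e j) f y * 'D_(e j) f y) + 2 * (f y * 'D_(e j) ('D_(e j) f) y)).
    have -> : 'D_(e j) (w eps) = fun x =>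
        \sum_i 'D_(e j) (fun x => 'D_(e i) f x * 'D_(e i) f x) x
        + eps * 'D_(e j) (fun x => f x * f x) x.
      apply/funext => x; rewrite /w smooth_deriveD//; last exact: smoothZ.
      rewrite smooth_deriveZ// /q smooth_derive_sum => [//|i]; exact: smoothM.
    have s1 i : smooth ('D_(e j) (fun x => 'D_(e i) f x * 'D_(e i) f x)).
      by apply: smooth_derive; exact: smoothM.
    have s2 : smooth ('D_(e j) (fun x => f x * f x)) by exact: smooth_derive.
    rewrite smooth_deriveD; [|exact: smooth_sum|exact: smoothZ].
    rewrite smooth_deriveZ// smooth_derive_sum// derive2_sqr//.
    by congr (_ + _); apply: eq_bigr => i _; rewrite derive2_sqr.
  have qy0 : q y <= 0.
    apply: (@energy_algebra m (fun i j => 'D_(e j) ('D_(e i) f) y)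
      (fun i j => 'D_(e j) ('D_(e j) ('D_(e i) f)) y) (fun i => 'D_(e i) f y)
      (fun j => 'D_(e j) ('D_(e j) f) y) eps (f y) eps0 (fun i => hD i y) (hf y)).
    rewrite -(eq_bigr _ (fun j _ => E j)); exact: sumr_le0.
  have : w eps x0 <= w eps y.
    have := ht 0; rewrite (_ : \sum_i _ = 0) ?addr0//.
    by apply: big1 => i _; rewrite mxE scale0r.
  have f0 : 0 <= eps * (f x0 * f x0) by apply: mulr_ge0; [exact: ltW|rewrite -expr2 sqr_ge0].
  have fy : eps * (f y * f y) <= eps * K by rewrite ler_pM2l//; exact: (hK t).
  move=> h; apply: (@le_trans _ _ (w eps x0)); first by rewrite /w lerDl.
  by apply: (le_trans h); rewrite /w -[eps * K]add0r; exact: lerD.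
have q0 : q x0 <= 0.
  apply/ler_addgt0Pr => eps eps0; rewrite add0r.
  have K1 : 0 < K + 1 by exact: ltr_wpDl.
  apply: (le_trans (key (eps / (K + 1)) (divr_gt0 eps0 K1))).
  by rewrite mulrAC ler_pdivrMr// ler_pM2l// lerDl.
have : 'D_(e i0) f x0 * 'D_(e i0) f x0 <= 0.
  apply: le_trans q0; rewrite /q (bigD1 i0)//= lerDl sumr_ge0// => i _.
  by rewrite -expr2 sqr_ge0.
by rewrite -expr2 real_exprn_even_le0 ?num_real//= => /eqP.
Qed.

End MaximumPrinciple.

(** * Clifford algebra *)

Section TensorProducts.
Variable R : realType.
Local Notation C := R[i].
Implicit Types F G : nat -> 'M[C]_2.

Lemma tens_recM k F G : tens_rec k F *m tens_rec k G = tens_rec k (fun p => F p *m G p).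
Proof. by elim: k F G => [|k IH] F G //=; rewrite tensmx_mul IH. Qed.

Lemma tensM k F G : tens k F *m tens k G = tens k (fun p => F p *m G p).
Proof. by case: k => [|k]; [rewrite /= mulmx1|exact: tens_recM]. Qed.

Lemma eq_tens_rec k F G : (forall p, (p <= k)%N -> F p = G p) -> tens_rec k F = tens_rec k G.
Proof.
elim: k F G => [|k IH] F G FG /=; first exact: FG.
by rewrite FG// (IH _ (fun p => G p.+1))// => p pk; exact: FG.
Qed.

Lemma eq_tens k F G : (forall p, (p < k)%N -> F p = G p) -> tens k F = tens k G.
Proof. by case: k => [//|k]; exact: eq_tens_rec. Qed.

Lemma tensmx_scale m n p q (a b : C) (A : 'M[C]_(m, n)) (B : 'M[C]_(p, q)) :
  (a *: A) *t (b *: B) = (a * b) *: (A *t B).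
Proof. by apply/matrixP => i j; rewrite !mxE mulrACA. Qed.

Lemma tens_rec_scale k (c : nat -> C) F :
  tens_rec k (fun p => c p *: F p) = (\prod_(p < k.+1) c p) *: tens_rec k F.
Proof.
elim: k c F => [|k IH] c F /=; first by rewrite big_ord1.
rewrite (IH (fun p => c p.+1)) [in RHS]big_ord_recl; exact: tensmx_scale.
Qed.

Lemma tens_scale k (c : nat -> C) F :
  tens k (fun p => c p *: F p) = (\prod_(p < k) c p) *: tens k F.
Proof. by case: k => [|k]; [rewrite /= big_ord0 scale1r|exact: tens_rec_scale]. Qed.

Lemma tensmx1 m n : (1%:M : 'M[C]_m) *t (1%:M : 'M[C]_n) = 1%:M.
Proof.
apply/matrixP => i j.
case: (mxtens_indexP i) => i1 i2; case: (mxtens_indexP j) => j1 j2.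
by rewrite tensmxE !mxE (can_eq (@mxtens_indexK _ _)) xpair_eqE -natrM mulnb.
Qed.

Lemma tens_rec1 k : tens_rec k (fun=> 1%:M) = 1%:M :> 'M[C]_(2 ^ k.+1).
Proof. by elim: k => [//|k IH] /=; rewrite IH; exact: tensmx1. Qed.

Lemma tens1 k : tens k (fun=> 1%:M) = 1%:M :> 'M[C]_(2 ^ k).
Proof. by case: k => [//|k]; exact: tens_rec1. Qed.

Lemma tens_conj k F : map_mx conjc (tens k F) = tens k (fun p => map_mx conjc (F p)).
Proof.
case: k => [|k]; first by rewrite /= map_mx1.
by rewrite /=; elim: k F => [//|k IH] F /=; rewrite map_mxT IH.
Qed.

Lemma tens_comm k (s : nat -> C) F G :
  (forall p, (p < k)%N -> F p *m G p = s p *: (G p *m F p)) ->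
  tens k F *m tens k G = (\prod_(p < k) s p) *: (tens k G *m tens k F).
Proof. by move=> FG; rewrite !tensM -tens_scale; exact: eq_tens. Qed.

Lemma prod_if_eq k q (a : C) : (q < k)%N ->
  \prod_(p < k) (if nat_of_ord p == q then a else 1) = a.
Proof.
move=> qk; rewrite (bigD1 (Ordinal qk))//= eqxx big1 ?mulr1// => i.
by rewrite -(inj_eq val_inj) /= => /negbTE ->.
Qed.

End TensorProducts.

(** * Clifford relations and complex conjugation, slot by slot *)

Section CliffordRelations.
Variable R : realType.
Local Notation C := R[i].
Local Notation g1 := (cliff_g1 R).
Local Notation g2 := (cliff_g2 R).
Local Notation T := (cliff_T R).

Lemma complexi_sqr : 'i%C * 'i%C = -1 :> C.
Proof. by rewrite -expr2 sqr_i. Qed.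

Lemma eq_mx2 (A B : 'M[C]_2) : A 0 0 = B 0 0 -> A 0 1 = B 0 1 ->
  A 1 0 = B 1 0 -> A 1 1 = B 1 1 -> A = B.
Proof.
move=> e00 e01 e10 e11; apply/matrixP => i j.
have H (l : 'I_2) : l = 0 \/ l = 1.
  by case: l => -[|[|//]] lt; [left|right]; apply/val_inj.
by case: (H i) => ->; case: (H j) => ->.
Qed.

Local Ltac mx2 := apply: eq_mx2; rewrite !(mxE, big_ord_recl, big_ord0) /=;
  rewrite ?(mulr0, mul0r, addr0, add0r, mulrN, mulNr, complexi_sqr, opprK, mulr1, mul1r, oppr0, mulN1r, conjc0).

Lemma cliff_g1_sqr : g1 *m g1 = -1%:M.
Proof. by mx2. Qed.
Lemma cliff_g2_sqr : g2 *m g2 = -1%:M.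
Proof. by mx2. Qed.
Lemma cliff_T_sqr : T *m T = 1%:M.
Proof. by mx2. Qed.
Lemma cliff_g1g2 : g1 *m g2 = -1 *: (g2 *m g1).
Proof. by mx2. Qed.
Lemma cliff_g1T : g1 *m T = -1 *: (T *m g1).
Proof. by mx2. Qed.
Lemma cliff_g2T : g2 *m T = -1 *: (T *m g2).
Proof. by mx2. Qed.
Lemma conj_complexi : ('i%C : C)^*%C = - 'i%C.
Proof. by apply/eqP; rewrite eq_complex /= oppr0 !eqxx. Qed.

Lemma conj_cliff_g1 : map_mx conjc g1 = -1 *: g1.
Proof. by mx2; apply/eqP; rewrite eq_complex /= ?(oppr0, opprK, eqxx). Qed.
Lemma conj_cliff_g2 : map_mx conjc g2 = -1 *: g2.
Proof. by mx2; apply/eqP; rewrite eq_complex /= ?(oppr0, opprK, eqxx). Qed.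
Lemma conj_cliff_T : map_mx conjc T = -1 *: T.
Proof. by mx2; apply/eqP; rewrite eq_complex /= ?(oppr0, opprK, eqxx). Qed.

(** The scalar i of e_n is kept apart, in [cliff_factorE], so that every e_j is a scalar times a
    pure tensor and the relations reduce to 2 x 2 matrices. *)
Definition cliff_factor (k j p : nat) : 'M[C]_2 :=
  if (j < k.*2)%N then
    if ((p + j./2).+1 < k)%N then 1%:M
    else if ((p + j./2).+1 == k)%N then (if odd j then g2 else g1) else T
  else T.

Lemma cliff_factorE k j :
  cliff R k j = (if (j < k.*2)%N then 1 else 'i%C) *: tens k (cliff_factor k j).
Proof.
rewrite /cliff; case: ifP => jk; last first.
  by congr (_ *: _); apply: eq_tens => p _; rewrite /cliff_factor jk.
by rewrite scale1r; apply: eq_tens => p _; rewrite /cliff_factor jk.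
Qed.

Lemma cliff_sqr k j : cliff R k j *m cliff R k j = - 1%:M.
Proof.
rewrite cliff_factorE -scalemxAl -scalemxAr scalerA tensM.
case: ifP => jk; last first.
  rewrite complexi_sqr scaleN1r; congr (- _); rewrite -tens1; apply: eq_tens => p _.
  by rewrite /cliff_factor jk cliff_T_sqr.
(* This is the only slot that carries g_1 or g_2, of square -1; the other slots carry 1 or T, of
   square 1. *)
pose q := (k - (j./2).+1)%N.
have qk : (q < k)%N by rewrite /q; lia.
pose c p : C := if p == q then -1 else 1.
have e : \prod_(p < k) c p = -1 by exact: prod_if_eq.
rewrite mulr1 scale1r -scaleN1r -e -tens1 -(tens_scale k c) {e}/c.
apply: eq_tens => p pk; rewrite /cliff_factor jk.
case: ifP => [lt|nlt].
  by rewrite mulmx1 (_ : (p == q) = false) ?scale1r//; apply/eqP; rewrite /q; lia.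
case: ifP => [/eqP e|/eqP ne].
  rewrite (_ : p == q); last by apply/eqP; rewrite /q; lia.
  by case: ifP => _; rewrite ?cliff_g1_sqr ?cliff_g2_sqr scaleN1r.
rewrite (_ : (p == q) = false) ?scale1r ?cliff_T_sqr//.
by apply/eqP; rewrite /q; lia.
Qed.

(** Only the slot q of e_j that holds g_1 or g_2 contributes a sign. To its left e_j has identities,
    to its right both elements have T, and in slot q the other element has T, or g_2 against g_1
    when the two indices belong to the same pair. *)
Lemma cliff_anticomm_lt k j l : (j < l)%N -> (j < k.*2)%N ->
  cliff R k j *m cliff R k l = - (cliff R k l *m cliff R k j).
Proof.
move=> jl jk.
have H : tens k (cliff_factor k j) *m tens k (cliff_factor k l) =
       -1 *: (tens k (cliff_factor k l) *m tens k (cliff_factor k j)).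
  pose q := (k - (j./2).+1)%N.
  have qk : (q < k)%N by rewrite /q; lia.
  rewrite -[X in X *: _](prod_if_eq (-1) qk).
  apply: (@tens_comm _ _ (fun p => if p == q then -1 else 1)) => p pk.
  rewrite /cliff_factor jk.
  case: ifP => [lt|nlt].
    rewrite (_ : (p == q) = false); last by apply/eqP; rewrite /q; lia.
    by rewrite mulmx1 mul1mx scale1r.
  case: ifP => [/eqP e|/eqP ne]; last first.
    rewrite (_ : (p == q) = false); last by apply/eqP; rewrite /q; lia.
    case: (boolP (l < k.*2)%N) => lk; last by rewrite scale1r.
    rewrite (_ : ((p + l./2).+1 < k)%N = false); last by lia.
    rewrite (_ : ((p + l./2).+1 == k)%N = false); last by apply/eqP; lia.
    by rewrite scale1r.
  rewrite (_ : p == q); last by apply/eqP; rewrite /q; lia.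
  have HT : (if odd j then g2 else g1) *m T = -1 *: (T *m (if odd j then g2 else g1)).
    by case: ifP => _; rewrite ?cliff_g1T ?cliff_g2T.
  case: (boolP (l < k.*2)%N) => lk //.
  rewrite (_ : ((p + l./2).+1 < k)%N = false); last by lia.
  case: ((p + l./2).+1 =P k) => [e2|_]; last exact: HT.
  have hh : j./2 = l./2 by apply: (@addnI p); apply: succn_inj; rewrite e e2.
  have := odd_double_half j; have := odd_double_half l; rewrite hh.
  (* Equal halves and j < l leave only j even and l odd, that is, g_1 against g_2. *)
  case: (odd j); case: (odd l) => /= ej el; try lia.
  exact: cliff_g1g2.
rewrite !cliff_factorE jk !scale1r -scalemxAl -scalemxAr H.
by rewrite -scalerN scaleN1r.
Qed.

Lemma cliff_anticomm k j l : (j <= k.*2)%N -> (l <= k.*2)%N -> j != l ->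
  cliff R k j *m cliff R k l = - (cliff R k l *m cliff R k j).
Proof.
move=> jk lk; rewrite neq_ltn => /orP[jl|lj].
  by apply: cliff_anticomm_lt => //; exact: leq_trans jl lk.
by rewrite (@cliff_anticomm_lt k l j)// ?opprK//; exact: leq_trans lj jk.
Qed.

Lemma tens_conj_sign k (c : nat -> C) (F : nat -> 'M[C]_2) :
  (forall p, (p < k)%N -> map_mx conjc (F p) = c p *: F p) ->
  map_mx conjc (tens k F) = (\prod_(p < k) c p) *: tens k F.
Proof. by move=> H; rewrite tens_conj -tens_scale; exact: eq_tens. Qed.

(* The sign depends only on [j./2], so that products e_(2j+1) e_(2j+2) are real. *)
Lemma conj_cliff k j : (j < k.*2)%N ->
  map_mx conjc (cliff R k j) = (-1) ^+ (j./2).+1 *: cliff R k j.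
Proof.
move=> jk; rewrite cliff_factorE jk scale1r.
rewrite (@tens_conj_sign k (fun p => if (k <= (p + j./2).+1)%N then -1 else 1)).
  congr (_ *: _); pose q := (k - (j./2).+1)%N.
  have jk2 : (j./2 < k)%N by lia.
  rewrite -(big_mkord xpredT (fun p => if (k <= (p + j./2).+1)%N then -1 else 1)).
  rewrite (@big_cat_nat _ _ _ q)//=; last exact: leq_subr.
  rewrite big_nat big1 ?mul1r; last first.
    by move=> p /andP[_ pq]; case: ifP => // h; move: pq h; rewrite /q; lia.
  rewrite -[in RHS](subKn jk2) -/q -prodr_const_nat big_nat [RHS]big_nat.
  by apply: eq_bigr => p /andP[qp pk]; case: ifP => // h; move: qp h; rewrite /q; lia.
move=> p pk; rewrite /cliff_factor jk.
case: ifP => [lt|nlt].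
  by rewrite leqNgt lt map_mx1 scale1r.
rewrite leqNgt nlt /=; case: ifP => _; last exact: conj_cliff_T.
by case: ifP => _; [exact: conj_cliff_g2|exact: conj_cliff_g1].
Qed.

Lemma conj_cliff_last k : map_mx conjc (cliff R k k.*2) = (-1) ^+ k.+1 *: cliff R k k.*2.
Proof.
rewrite cliff_factorE ltnn map_mxZ [X in X *: _]conj_complexi.
rewrite (@tens_conj_sign k (fun=> -1)) => [|p pk]; last by rewrite /cliff_factor ltnn conj_cliff_T.
by rewrite prodr_const card_ord !scalerA exprS mulN1r !mulNr mulrC.
Qed.

End CliffordRelations.

(** * Exponentials of matrices of square -1 *)

Section Rotors.
Variables (R : realType) (m : nat).
Local Notation C := R[i].
Implicit Types B X : 'M[C]_m.

(** This is exp(t B) as soon as B squares to -1. *)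
Definition rotor B (t : R) : 'M[C]_m := (cos t)%:C%:M + (sin t)%:C *: B.

Lemma mulmx_rotor B (a b c d : C) : B *m B = - 1%:M ->
  (a%:M + b *: B) *m (c%:M + d *: B) = (a * c - b * d)%:M + (b * c + a * d) *: B.
Proof.
move=> BB; rewrite -(scalemx1 _ a) -(scalemx1 _ c) -(scalemx1 _ (a * c - b * d)).
rewrite mulmxDl !mulmxDr -!scalemxAl -!scalemxAr !mul1mx mulmx1 BB.
by apply/matrixP => i j; rewrite !mxE; ring.
Qed.

Lemma rotorD B s t : B *m B = - 1%:M -> rotor B s *m rotor B t = rotor B (s + t).
Proof.
move=> BB; rewrite /rotor (mulmx_rotor _ _ _ _ BB) cosD sinD.
by congr (_%:M + _ *: _); rewrite ?rmorphB ?rmorphD !rmorphM.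
Qed.

Lemma rotor0 B : rotor B 0 = 1%:M.
Proof. by rewrite /rotor cos0 sin0 rmorph0 scale0r addr0. Qed.

Lemma exprSmx X n : X ^+ n.+1 = X *m X ^+ n.
Proof. exact: exprS. Qed.

Lemma exprMmx_comm X Y n : X *m Y = Y *m X -> (X *m Y) ^+ n = X ^+ n *m Y ^+ n.
Proof. exact: exprMn_comm. Qed.

Lemma exprZmx (a : C) X n : (a *: X) ^+ n = a ^+ n *: X ^+ n.
Proof.
elim: n => [|n IH]; first by rewrite !expr0 scale1r.
by rewrite exprSmx IH exprSmx exprS -scalemxAl -scalemxAr scalerA.
Qed.

Lemma rotorX B t n : B *m B = - 1%:M -> rotor B t ^+ n = rotor B (n%:R * t).
Proof.
move=> BB; elim: n => [|n IH]; first by rewrite expr0 mul0r rotor0.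
by rewrite exprSmx IH (rotorD _ _ BB) -{1}[t]mul1r -mulrDl nat1r.
Qed.

Lemma rotor_comm B X t : B *m X = X *m B -> rotor B t *m X = X *m rotor B t.
Proof.
by move=> BX; rewrite /rotor mulmxDl mulmxDr mul_scalar_mx mul_mx_scalar -scalemxAl -scalemxAr BX.
Qed.

Lemma rotor_anticomm B X t : B *m X = - (X *m B) -> rotor B t *m X = X *m rotor B (- t).
Proof.
move=> BX; rewrite /rotor mulmxDl mulmxDr mul_scalar_mx mul_mx_scalar -scalemxAl -scalemxAr BX.
by rewrite cosN sinN rmorphN scalerN scaleNr.
Qed.

Lemma rotorN B t : rotor (- B) t = rotor B (- t).
Proof. by rewrite /rotor cosN sinN rmorphN scalerN scaleNr. Qed.

Lemma rotor_conj B t : map_mx conjc (rotor B t) = rotor (map_mx conjc B) t.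
Proof.
rewrite /rotor map_mxD map_mxZ map_scalar_mx.
by congr (_%:M + _ *: _); exact: conjc_real.
Qed.

End Rotors.

(** * The lift alpha: conjugation action on vectors, reality, and n-th power *)

Section SpinAlpha.
Variables (R : realType) (k : nat).
Local Notation C := R[i].
Local Notation e := (cliff R k).

Definition biv (j : nat) : 'M[C]_(2 ^ k) := e j.*2 *m e j.*2.+1.

Lemma spin_rE j : spin_r R k j = rotor (biv j) (j.+1%:R * (pi / k.*2.+1%:R)).
Proof. by []. Qed.

Lemma biv_left1 j : (j < k)%N -> biv j *m e j.*2 = e j.*2.+1.
Proof.
move=> jk; rewrite /biv -mulmxA (@cliff_anticomm _ k j.*2.+1 j.*2); [|lia..].
by rewrite mulmxN mulmxA cliff_sqr mulNmx mul1mx opprK.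
Qed.

Lemma biv_right1 j : e j.*2 *m biv j = - e j.*2.+1.
Proof. by rewrite /biv mulmxA cliff_sqr mulNmx mul1mx. Qed.

Lemma biv_left2 j : biv j *m e j.*2.+1 = - e j.*2.
Proof. by rewrite /biv -mulmxA cliff_sqr mulmxN mulmx1. Qed.

Lemma biv_right2 j : (j < k)%N -> e j.*2.+1 *m biv j = e j.*2.
Proof.
move=> jk; rewrite /biv mulmxA (@cliff_anticomm _ k j.*2.+1 j.*2); [|lia..].
by rewrite mulNmx -mulmxA cliff_sqr mulmxN mulmx1 opprK.
Qed.

Lemma biv_sqr j : (j < k)%N -> biv j *m biv j = - 1%:M.
Proof. by move=> jk; rewrite {2}/biv mulmxA biv_left1// cliff_sqr. Qed.

Lemma biv_comm j l : (j < k)%N -> (l <= k.*2)%N -> l != j.*2 -> l != j.*2.+1 ->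
  biv j *m e l = e l *m biv j.
Proof.
move=> jk lk l1 l2; rewrite /biv -mulmxA (@cliff_anticomm _ k j.*2.+1 l); [|lia..].
rewrite mulmxN [in LHS]mulmxA (@cliff_anticomm _ k j.*2 l); [|lia..].
by rewrite mulNmx opprK [RHS]mulmxA.
Qed.

Lemma conj_biv j : (j < k)%N -> map_mx conjc (biv j) = biv j.
Proof.
move=> jk; rewrite /biv map_mxM !conj_cliff; [|lia..].
rewrite -scalemxAl -scalemxAr scalerA.
by rewrite doubleK -[j.*2.+1]/(true + j.*2)%N half_bit_double -exprD addnn -mul2n exprM sqrrN expr1n expr1n scale1r.
Qed.

Definition chd_angle (j : nat) : R := 2 * pi * j.+1%:R / k.*2.+1%:R.

(** The bivector anticommutes with the vectors of its plane, so moving the rotor r of angle t past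
    such a vector inverts it, and r^-1 is the rotor of angle -2 t times r. This is the usual
    doubling of the angle in the spin covering. *)
Lemma spin_r_vec1 j : (j < k)%N -> spin_r R k j *m e j.*2 =
  ((cos (chd_angle j))%:C *: e j.*2 + (sin (chd_angle j))%:C *: e j.*2.+1) *m spin_r R k j.
Proof.
move=> jk; rewrite spin_rE; set t := _ * _.
have -> : chd_angle j = t + t by rewrite /chd_angle /t; move: (k.*2.+1%:R^-1) => N; ring.
rewrite rotor_anticomm; last by rewrite biv_left1// biv_right1 opprK.
have -> : - t = - (t + t) + t by rewrite opprD subrK.
rewrite -rotorD ?biv_sqr// mulmxA; congr (_ *m _).
by rewrite /rotor cosN sinN rmorphN scaleNr mulmxDr mul_mx_scalar mulmxN -scalemxAr biv_right1 scalerN opprK.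
Qed.

Lemma spin_r_vec2 j : (j < k)%N -> spin_r R k j *m e j.*2.+1 =
  ((- sin (chd_angle j))%:C *: e j.*2 + (cos (chd_angle j))%:C *: e j.*2.+1) *m spin_r R k j.
Proof.
move=> jk; rewrite spin_rE; set t := _ * _.
have -> : chd_angle j = t + t by rewrite /chd_angle /t; move: (k.*2.+1%:R^-1) => N; ring.
rewrite rotor_anticomm; last by rewrite biv_left2 biv_right2.
have -> : - t = - (t + t) + t by rewrite opprD subrK.
rewrite -rotorD ?biv_sqr// mulmxA; congr (_ *m _).
by rewrite /rotor cosN sinN !rmorphN scaleNr mulmxDr mul_mx_scalar mulmxN -scalemxAr biv_right2// scaleNr addrC.
Qed.

Lemma spin_r_comm j l : (j < k)%N -> (l <= k.*2)%N -> l != j.*2 -> l != j.*2.+1 ->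
  spin_r R k j *m e l = e l *m spin_r R k j.
Proof. by move=> *; rewrite spin_rE; apply: rotor_comm; exact: biv_comm. Qed.

Lemma mulrmx (X Y : 'M[C]_(2 ^ k)) : X * Y = X *m Y.
Proof. by []. Qed.

Lemma spin_alphaE : spin_alpha R k = \prod_(0 <= j < k) spin_r R k j.
Proof. by []. Qed.

Lemma prod_mulmx_comm (a b : nat) (F : nat -> 'M[C]_(2 ^ k)) X :
  (forall j, (a <= j < b)%N -> F j *m X = X *m F j) ->
  (\prod_(a <= j < b) F j) *m X = X *m \prod_(a <= j < b) F j.
Proof.
move=> H; rewrite big_nat_cond.
elim/big_ind: _ => [|A B hA hB|j /andP[jab _]]; first by rewrite mul1mx mulmx1.
  by rewrite mulrmx -mulmxA hB mulmxA hA mulmxA.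
exact: H.
Qed.

(** Only the j-th rotor acts on the plane of [e l]. The rotors to its right commute with [e l],
    those to its left with the rotated vector Y. *)
Lemma spin_alpha_vec j l (Y : 'M[C]_(2 ^ k)) : (j < k)%N -> (l == j.*2) || (l == j.*2.+1) ->
  spin_r R k j *m e l = Y *m spin_r R k j ->
  (forall i, (i < k)%N -> i != j -> spin_r R k i *m Y = Y *m spin_r R k i) ->
  spin_alpha R k *m e l = Y *m spin_alpha R k.
Proof.
move=> jk jl rY cY.
rewrite spin_alphaE (@big_cat_nat _ _ _ j)//=; last exact: ltnW.
rewrite (@big_ltn _ _ _ j)// !mulrmx.
set P := \prod_(0 <= i < j) _; set Q := \prod_(j.+1 <= i < k) _.
have PY : P *m Y = Y *m P.
  by apply: prod_mulmx_comm => i /andP[_ ij]; apply: cY; [exact: ltn_trans jk|rewrite ltn_eqF].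
have Qe : Q *m e l = e l *m Q.
  apply: prod_mulmx_comm => i /andP[ji ik]; apply: spin_r_comm => //; lia.
by rewrite -!mulmxA Qe (mulmxA (spin_r _ _ _)) rY -!mulmxA (mulmxA P) PY -!mulmxA.
Qed.

Lemma spin_alpha_vec1 j : (j < k)%N -> spin_alpha R k *m e j.*2 =
  ((cos (chd_angle j))%:C *: e j.*2 + (sin (chd_angle j))%:C *: e j.*2.+1) *m spin_alpha R k.
Proof.
move=> jk; apply: (spin_alpha_vec jk) => //; [by rewrite eqxx|exact: spin_r_vec1|].
move=> i ik ij; have e1 : spin_r R k i *m e j.*2 = e j.*2 *m spin_r R k i.
  by apply: spin_r_comm; lia.
have e2 : spin_r R k i *m e j.*2.+1 = e j.*2.+1 *m spin_r R k i.
  by apply: spin_r_comm; lia.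
move: (spin_r R k i) e1 e2 => r e1 e2.
by rewrite mulmxDr mulmxDl -!scalemxAr -!scalemxAl e1 e2.
Qed.

Lemma spin_alpha_vec2 j : (j < k)%N -> spin_alpha R k *m e j.*2.+1 =
  ((- sin (chd_angle j))%:C *: e j.*2 + (cos (chd_angle j))%:C *: e j.*2.+1) *m spin_alpha R k.
Proof.
move=> jk; apply: (spin_alpha_vec jk) => //; [by rewrite eqxx orbT|exact: spin_r_vec2|].
move=> i ik ij; have e1 : spin_r R k i *m e j.*2 = e j.*2 *m spin_r R k i.
  by apply: spin_r_comm; lia.
have e2 : spin_r R k i *m e j.*2.+1 = e j.*2.+1 *m spin_r R k i.
  by apply: spin_r_comm; lia.
move: (spin_r R k i) e1 e2 => r e1 e2.
by rewrite mulmxDr mulmxDl -!scalemxAr -!scalemxAl e1 e2.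
Qed.

Lemma spin_alpha_last : spin_alpha R k *m e k.*2 = e k.*2 *m spin_alpha R k.
Proof. by apply: prod_mulmx_comm => j jk; apply: spin_r_comm; lia. Qed.

Lemma conj_spin_alpha : map_mx conjc (spin_alpha R k) = spin_alpha R k.
Proof.
rewrite spin_alphaE big_nat_cond.
elim/big_ind: _ => [|A B hA hB|j /andP[jk _]]; first exact: map_mx1.
  by rewrite mulrmx map_mxM hA hB.
by rewrite spin_rE rotor_conj conj_biv.
Qed.

Lemma cos_natpi (j : nat) : cos (j%:R * pi) = (-1) ^+ j :> R.
Proof.
elim: j => [|j IH]; first by rewrite mul0r cos0.
by rewrite -[j.+1]addn1 natrD mulrDl mul1r cosDpi IH exprD mulrN1.
Qed.

Lemma sin_natpi (j : nat) : sin (j%:R * pi) = 0 :> R.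
Proof.
elim: j => [|j IH]; first by rewrite mul0r sin0.
by rewrite -[j.+1]addn1 natrD mulrDl mul1r sinDpi IH oppr0.
Qed.

Lemma spin_rX j : (j < k)%N -> spin_r R k j ^+ k.*2.+1 = ((-1) ^+ j.+1)%:M.
Proof.
move=> jk; rewrite spin_rE rotorX ?biv_sqr// mulrCA.
have -> : j.+1%:R * (k.*2.+1%:R * (pi / k.*2.+1%:R)) = j.+1%:R * pi :> R.
  by rewrite [_ * (pi / _)]mulrCA divff ?pnatr_eq0// mulr1.
by rewrite /rotor cos_natpi sin_natpi rmorph0 scale0r addr0 rmorphXn rmorphN rmorph1.
Qed.

Lemma spin_r_commr i j : (i < k)%N -> (j < k)%N ->
  spin_r R k i *m spin_r R k j = spin_r R k j *m spin_r R k i.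
Proof.
move=> ik jk; case: (eqVneq i j) => [->//|ij].
rewrite [in LHS](spin_rE j) [in RHS](spin_rE j); apply/esym/rotor_comm.
rewrite /biv -mulmxA -spin_r_comm; [|lia..].
by rewrite mulmxA -spin_r_comm ?mulmxA//; lia.
Qed.

Lemma half_mul_succ n : ((n.+1 * n.+2)./2 = (n * n.+1)./2 + n.+1)%N.
Proof.
have -> : (n.+1 * n.+2 = n * n.+1 + n.+1.*2)%N by lia.
by rewrite halfD odd_double andbF doubleK.
Qed.

(** The n-th power of r_j is the rotor of angle j pi, that is (-1)^j, and the exponents add up to k
    (k + 1) / 2. This is where the sign in the definition of alpha_+ comes from. *)
Lemma spin_alphaX : spin_alpha R k ^+ k.*2.+1 = ((-1) ^+ ((k * k.+1)./2))%:M.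
Proof.
suff H l : (l <= k)%N -> (\prod_(0 <= j < l) spin_r R k j) ^+ k.*2.+1
    = ((-1) ^+ ((l * l.+1)./2))%:M by exact: H.
elim: l => [|l IH] lk; first by rewrite big_geq// mul0n expr0 expr1n.
rewrite half_mul_succ; set q := (_./2 + _)%N.
rewrite big_nat_recr//= mulrmx exprMmx_comm.
  by rewrite IH ?spin_rX ?(ltnW lk)// -scalar_mxM -exprD.
apply: prod_mulmx_comm => j /andP[_ jl]; apply: spin_r_commr => //.
exact: ltn_trans lk.
Qed.

Definition spin_val (s : spin_sign) : R := if s is SpinPlus then 1 else -1.
Definition spin_coef s : R := spin_val s * (-1) ^+ ((k * k.+1)./2).

Lemma spin_alpha_pmE s : spin_alpha_pm R k s = (spin_coef s)%:C *: spin_alpha R k.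
Proof.
rewrite /spin_coef rmorphM rmorphXn rmorphN rmorph1.
by case: s; rewrite /spin_alpha_pm ?rmorphN ?rmorph1 ?mul1r ?mulN1r ?scaleNr.
Qed.

Local Notation al := (spin_alpha_pm R k).

Lemma spin_alpha_pm_vec1 s j : (j < k)%N -> al s *m e j.*2 =
  ((cos (chd_angle j))%:C *: e j.*2 + (sin (chd_angle j))%:C *: e j.*2.+1) *m al s.
Proof. by move=> jk; rewrite spin_alpha_pmE -scalemxAl -scalemxAr spin_alpha_vec1. Qed.

Lemma spin_alpha_pm_vec2 s j : (j < k)%N -> al s *m e j.*2.+1 =
  ((- sin (chd_angle j))%:C *: e j.*2 + (cos (chd_angle j))%:C *: e j.*2.+1) *m al s.
Proof. by move=> jk; rewrite spin_alpha_pmE -scalemxAl -scalemxAr spin_alpha_vec2. Qed.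

Lemma spin_alpha_pm_last s : al s *m e k.*2 = e k.*2 *m al s.
Proof. by rewrite spin_alpha_pmE -scalemxAl -scalemxAr spin_alpha_last. Qed.

Lemma conj_spin_alpha_pm s : map_mx conjc (al s) = al s.
Proof. by rewrite spin_alpha_pmE map_mxZ conj_spin_alpha [X in X *: _]conjc_real. Qed.

Lemma spin_alpha_pmX s : al s ^+ k.*2.+1 = (spin_val s)%:C%:M.
Proof.
have oddn (x : R) : x ^+ 2 = 1 -> x ^+ k.*2.+1 = x.
  by move=> x2; rewrite exprS -mul2n exprM x2 expr1n mulr1.
have sq (q : nat) : ((-1) ^+ q) ^+ 2 = 1 :> R by rewrite -exprM mulnC exprM sqrrN expr1n expr1n.
have v2 : spin_val s ^+ 2 = 1 by case: (s); rewrite ?sqrrN expr1n.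
rewrite spin_alpha_pmE exprZmx spin_alphaX -[X in _ *: X]scalemx1 scalerA scalemx1.
rewrite -rmorphXn /spin_coef; set q := ((_ * _)./2).
rewrite exprMn !oddn//; congr (_%:M); rewrite rmorphM rmorphXn rmorphN rmorph1 -mulrA -expr2 -exprM mulnC exprM.
by rewrite sqrrN expr1n expr1n mulr1.
Qed.

Lemma spin_alpha_pm_unit s : al s \in unitmx.
Proof.
have := spin_alpha_pmX s; rewrite exprSmx => h.
have u : (spin_val s)%:C%:M \in @unitmx C (2 ^ k).
  rewrite unitmxE det_scalar unitrX// unitfE.
  by case: (s); rewrite /= ?rmorphN rmorph1 ?oppr_eq0 oner_eq0.
by move: u; rewrite -h unitmx_mul => /andP[].
Qed.

End SpinAlpha.

(** * The kernels of the matrices exp(- mu e_n / n) - alpha *)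

(** Since E commutes with M it preserves the row space of M, and its restriction X satisfies X^2 =
    -1. Thus (-1)^(rank M) = det(X)^2 is nonnegative, which forces an even rank over an ordered
    field. *)
Lemma rank_even_of_complex_structure (F : realFieldType) n (M E : 'M[F]_n) :
  E *m E = - 1%:M -> M *m E = E *m M -> ~~ odd (\rank M).
Proof.
move=> EE ME; set B := row_base M.
have BE : (B *m E <= B)%MS.
  have h : (B *m E <= M *m E)%MS by apply: submxMr; rewrite eq_row_base.
  by apply: submx_trans h _; rewrite ME eq_row_base submxMl.
have /submxP[X hX] := BE.
have XX : X *m X = - 1%:M.
  apply: (row_free_inj (row_base_free M)).
  by rewrite -mulmxA -hX mulmxA -hX -mulmxA EE mulmxN mulmx1 mulNmx mul1mx.
have : 0 <= \det X * \det X by rewrite -expr2 sqr_ge0.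
rewrite -det_mulmx XX -scaleN1r detZ det1 mulr1.
by apply: contraTN => o; rewrite -signr_odd o expr1 -ltNge oppr_lt0 ltr01.
Qed.

Section KernelDimension.
Variables (R : realType) (k : nat).
Local Notation C := R[i].
Local Notation e := (cliff R k).
Local Notation al := (spin_alpha_pm R k).
Local Notation n := (k.*2.+1).

(* An eigenspinor for [mu] which only depends on x_n is of the form
   exp(- mu x_n e_n) w, and it is invariant under g if and only if w is in the
   kernel of this matrix. *)
Definition eigen_mx s (mu : R) : 'M[C]_(2 ^ k) := rotor (e k.*2) (- (mu / n%:R)) - al s.

Definition eigen_mx_dim s mu : nat := (2 ^ k - \rank (eigen_mx s mu))%N.

(** The rotor X and alpha commute, so X - alpha divides X^n - alpha^n = exp(- mu e_n) - v with v = 1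
    or -1. That element of R + R e_n has norm (cos mu - v)^2 + (sin mu)^2, which is positive. *)
Lemma eigen_mx_unit s mu : sin mu != 0 -> eigen_mx s mu \in unitmx.
Proof.
move=> smu; set X := rotor (e k.*2) (- (mu / n%:R)).
have XA : X *m al s = al s *m X by rewrite rotor_comm// spin_alpha_pm_last.
have Xn : X ^+ n = rotor (e k.*2) (- mu).
  have := rotorX (- (mu / n%:R)) n (cliff_sqr R k k.*2); rewrite -/X => ->.
  by have -> : n%:R * - (mu / n%:R) = - mu :> R by rewrite mulrN mulrCA divff ?pnatr_eq0// mulr1.
have := @subrXX_comm _ X (al s) n XA.
rewrite Xn spin_alpha_pmX mulrmx; set S := \sum_(i < n) _ => hS.
pose v := spin_val R s; have [a ea] : exists a, a = cos mu - v by exists (cos mu - v).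
(* Multiplication by the conjugate in R + R e_n gives the norm. *)
have P : (rotor (e k.*2) (- mu) - v%:C%:M) *m (a%:C%:M + (sin mu)%:C *: e k.*2)
    = (a * a + sin mu * sin mu)%:C%:M.
  have -> : rotor (e k.*2) (- mu) - v%:C%:M = a%:C%:M + (- sin mu)%:C *: e k.*2.
    rewrite /rotor cosN sinN addrAC; congr (_ + _).
    by rewrite ea; apply/matrixP => i j; rewrite !mxE rmorphB mulrnBl.
  rewrite (mulmx_rotor _ _ _ _ (cliff_sqr R k k.*2)) [X in _ + X *: _](_ : _ = 0).
    by rewrite scale0r addr0; congr (_%:M); rewrite rmorphD !rmorphM rmorphN mulNr opprK.
  by rewrite rmorphN mulNr mulrC addNr.
have u : (a * a + sin mu * sin mu)%:C%:M \in @unitmx C (2 ^ k).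
  rewrite unitmxE det_scalar unitrX// unitfE.
  rewrite (inj_eq (@complexI R)) -!expr2 paddr_eq0 ?sqr_ge0// !sqrf_eq0 negb_and smu orbT //.
by move: u; rewrite -P hS -mulmxA unitmx_mul => /andP[].
Qed.

Lemma eigen_mx_dim0 s mu : sin mu != 0 -> eigen_mx_dim s mu = 0%N.
Proof. by move=> /(@eigen_mx_unit s); rewrite /eigen_mx_dim -row_free_unit => /eqP ->; rewrite subnn. Qed.

Definition spin_flip s := if s is SpinPlus then SpinMinus else SpinPlus.

Lemma spin_alpha_pm_flip s : al (spin_flip s) = - al s.
Proof. by case: s => /=; rewrite ?opprK. Qed.

(** The angle mu / n increases by pi, which changes the sign of the rotor; the other spin structure
    has the opposite alpha, so the matrix itself only changes sign. *)
Lemma eigen_mx_dim_shift s mu :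
  eigen_mx_dim s (mu + n%:R * pi) = eigen_mx_dim (spin_flip s) mu.
Proof.
rewrite /eigen_mx_dim -[in RHS]mxrank_opp; congr (_ - \rank _)%N.
rewrite /eigen_mx spin_alpha_pm_flip opprB addrC; congr (_ + _).
rewrite mulrDl mulrAC divff ?pnatr_eq0// mul1r.
rewrite /rotor !cosN !sinN cosDpi sinDpi.
by apply/matrixP => i j; rewrite !mxE !rmorphN; ring.
Qed.

Lemma rank_conj (m : nat) (X : 'M[C]_m) : \rank (map_mx conjc X) = \rank X.
Proof. exact: mxrank_map. Qed.

Lemma eigen_mx_dimN s mu : ~~ odd k -> eigen_mx_dim s (- mu) = eigen_mx_dim s mu.
Proof.
move=> ek; rewrite /eigen_mx_dim -[in RHS]rank_conj; congr (_ - \rank _)%N.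
rewrite /eigen_mx map_mxB conj_spin_alpha_pm; congr (_ - _).
rewrite rotor_conj conj_cliff_last -[(-1) ^+ k.+1]signr_odd /= ek expr1 scaleN1r rotorN.
by rewrite mulNr.
Qed.

Lemma real_mx (m : nat) (X : 'M[C]_m) : map_mx conjc X = X ->
  X = map_mx (real_complex R) (map_mx (@complex.Re R) X).
Proof.
move=> cX; apply/matrixP => i j; rewrite !mxE.
have := congr1 (fun Z : 'M[C]_m => Z i j) cX; rewrite mxE.
by case: (X i j) => a b [] /= /eqP; rewrite eqNr => /eqP ->.
Qed.

Lemma eigen_mx_dim_even s mu : odd k -> ~~ odd (eigen_mx_dim s mu).
Proof.
move=> ok.
have ce : map_mx conjc (e k.*2) = e k.*2.
  by rewrite conj_cliff_last -[(-1) ^+ k.+1]signr_odd /= ok scale1r.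
have cM : map_mx conjc (eigen_mx s mu) = eigen_mx s mu.
  by rewrite /eigen_mx map_mxB conj_spin_alpha_pm rotor_conj ce.
have comm : eigen_mx s mu *m e k.*2 = e k.*2 *m eigen_mx s mu.
  by rewrite /eigen_mx mulmxBl mulmxBr spin_alpha_pm_last rotor_comm.
have rM := real_mx cM; have rE := real_mx ce.
rewrite /eigen_mx_dim oddB; last exact: rank_leq_row.
(* Oddness of k excludes k = 0, where 2 ^ k would be odd. *)
have -> : odd (2 ^ k) = false by rewrite oddX /= orbF; case: (k) ok.
(* The rank does not change when the entries are read as real numbers, and over the reals the
   determinant argument is available. *)
rewrite addFb rM mxrank_map.
apply: (@rank_even_of_complex_structure _ _ _ (map_mx (@complex.Re R) (e k.*2))).
  apply: (map_mx_inj (f := real_complex R)).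
  by rewrite map_mxM -rE cliff_sqr map_mxN map_mx1.
apply: (map_mx_inj (f := real_complex R)).
by rewrite !map_mxM -rE -rM comm.
Qed.

Local Notation K := eigen_mx_dim.

(** This is the d(y) of the overview, for y >= 0. *)
Definition dim_diff (y : nat) : int :=
  (K SpinPlus (y%:R * pi))%:Z - (K SpinPlus (- (y%:R * pi)))%:Z
  - ((K SpinMinus (y%:R * pi))%:Z - (K SpinMinus (- (y%:R * pi)))%:Z).

Lemma eigen_mx_dim_shiftN s mu : K s (mu - n%:R * pi) = K (spin_flip s) mu.
Proof. by rewrite -[mu in RHS](subrK (n%:R * pi)) eigen_mx_dim_shift; case: s. Qed.

Lemma dim_diffD y : dim_diff (n + y)%N = - dim_diff y.
Proof.
have e1 : (n + y)%:R * pi = y%:R * pi + n%:R * pi :> R by rewrite natrD mulrDl addrC.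
rewrite /dim_diff e1; move: (y%:R * pi) => a; rewrite (opprD a).
rewrite (eigen_mx_dim_shift SpinPlus a) (eigen_mx_dim_shift SpinMinus a).
rewrite (eigen_mx_dim_shiftN SpinPlus (- a)) (eigen_mx_dim_shiftN SpinMinus (- a)) /=.
by rewrite [RHS]opprB.
Qed.

Lemma dim_diff0 : dim_diff 0 = 0.
Proof. by rewrite /dim_diff mul0r oppr0 !subrr. Qed.

(** Oddness and antiperiodicity are combined, d(n - y) = - d(- y) = d(y), because the argument is a
    natural number. *)
Lemma dim_diff_rev y : (y <= n)%N -> dim_diff (n - y)%N = dim_diff y.
Proof.
move=> yn.
have e1 : (n - y)%:R * pi = - (y%:R * pi) + n%:R * pi :> R by rewrite natrB// mulrBl addrC.
rewrite /dim_diff e1; move: (y%:R * pi) => a; rewrite (opprD (- a)) opprK.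
rewrite (eigen_mx_dim_shift SpinPlus (- a)) (eigen_mx_dim_shift SpinMinus (- a)).
rewrite (eigen_mx_dim_shiftN SpinPlus a) (eigen_mx_dim_shiftN SpinMinus a) /=.
move: (K _ a) (K _ (- a)) (K _ a) (K _ (- a)) => p q r s.
by rewrite !opprB addrACA [RHS]addrACA [s%:Z + _]addrC; congr (_ + _); rewrite addrC.
Qed.

Lemma dim_diff_even y : exists z : int, dim_diff y = 2 * z.
Proof.
have [ok|ek] := boolP (odd k); last first.
  by exists 0; rewrite /dim_diff !(@eigen_mx_dimN _ (y%:R * pi) ek) !subrr.
have H s mu : exists z : int, (K s mu)%:Z = 2 * z.
  exists (K s mu)./2%:Z.
  by rewrite -{1}(odd_double_half (K s mu)) (negbTE (eigen_mx_dim_even s mu ok)) add0n -mul2n PoszM.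
have [a ea] := H SpinPlus (y%:R * pi); have [b eb] := H SpinPlus (- (y%:R * pi)).
have [c ec] := H SpinMinus (y%:R * pi); have [d ed] := H SpinMinus (- (y%:R * pi)).
by exists (a - b - (c - d)); rewrite !mulrBr -ea -eb -ec -ed.
Qed.

(** The last term d(n) = - d(0) vanishes, and y |-> n - y pairs the 2 k remaining terms. The sum is
    twice that over 1 <= y <= k, whose terms are even. *)
Lemma sum_dim_diff : exists z : int, \sum_(1 <= y < n.+1) dim_diff y = 4 * z.
Proof.
(* The reflection is proved by induction outwards from the centre: the l terms ending at d(k) match
   the l terms starting at d(k + 1). *)
have S l : (l <= k)%N -> \sum_(k - l <= i < k) dim_diff i.+1 =
    \sum_(k <= i < k + l) dim_diff i.+1.
  elim: l => [|l IH] lk; first by rewrite subn0 addn0 !big_geq.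
  rewrite addnS big_nat_recr ?leq_addr//= big_ltn; last by lia.
  have -> : (k - l.+1).+1 = (k - l)%N by lia.
  rewrite IH; last exact: ltnW.
  have -> : (k - l = n - (k + l).+1)%N by lia.
  by rewrite dim_diff_rev 1?addrC//; lia.
have E (l : nat) : exists z : int, \sum_(0 <= i < l) dim_diff i.+1 = 2 * z.
  elim: l => [|l [z hz]]; first by exists 0; rewrite big_geq.
  have [w hw] := dim_diff_even l.+1.
  by exists (z + w); rewrite big_nat_recr//= hz hw mulrDr.
have [z hz] := E k; exists z.
have dn : dim_diff n = 0 by rewrite -[n]addn0 dim_diffD dim_diff0 oppr0.
rewrite big_add1 /= big_nat_recr//= dn addr0 (@big_cat_nat _ _ _ k)//=; last by lia.
have := S k (leqnn k); rewrite subnn addnn => <-.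
by rewrite hz; ring.
Qed.

End KernelDimension.

(** * Spinors and the fibre operator *)

Section ComplexDerivatives.
Variables (R : realType) (n : nat).
Local Notation C := R[i].
Implicit Types (f g : 'cV[R]_n -> C) (x u v : 'cV[R]_n).

Definition csmooth f := smooth (fun x => complex.Re (f x)) /\ smooth (fun x => complex.Im (f x)).

Definition cderive v f : 'cV[R]_n -> C := fun x =>
  'D_v (fun y => complex.Re (f y)) x +i* 'D_v (fun y => complex.Im (f y)) x.

Lemma eq_complexP (a b : C) : complex.Re a = complex.Re b -> complex.Im a = complex.Im b -> a = b.
Proof. by case: a => ? ?; case: b => ? ? /= -> ->. Qed.

Lemma ReD (a b : C) : complex.Re (a + b) = complex.Re a + complex.Re b.
Proof. by case: a; case: b. Qed.
Lemma ImD (a b : C) : complex.Im (a + b) = complex.Im a + complex.Im b.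
Proof. by case: a; case: b. Qed.
Lemma ReM (a b : C) : complex.Re (a * b) =
  complex.Re a * complex.Re b + - complex.Im a * complex.Im b.
Proof. by case: a => ? ?; case: b => ? ? /=; rewrite mulNr. Qed.
Lemma ImM (a b : C) : complex.Im (a * b) =
  complex.Re a * complex.Im b + complex.Im a * complex.Re b.
Proof. by case: a => ? ?; case: b => ? ? /=. Qed.

Lemma csmooth_derive f v : csmooth f -> csmooth (cderive v f).
Proof. by move=> [sr si]; split; exact: smooth_derive. Qed.

Lemma csmooth_cst (c : C) : csmooth (fun=> c).
Proof. by split; exact: smooth_cst. Qed.

Lemma cderive_cst (c : C) v x : cderive v (fun=> c) x = 0.
Proof. by apply: eq_complexP => /=; exact: derive_cst. Qed.

Lemma csmoothD f g : csmooth f -> csmooth g -> csmooth (fun x => f x + g x).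
Proof.
move=> [fr fi] [gr gi]; split.
  by under eq_fun do rewrite ReD; exact: smoothD.
by under eq_fun do rewrite ImD; exact: smoothD.
Qed.

Lemma cderiveD f g v x : csmooth f -> csmooth g ->
  cderive v (fun x => f x + g x) x = cderive v f x + cderive v g x.
Proof.
move=> [fr fi] [gr gi]; apply: eq_complexP; rewrite ?ReD ?ImD /=.
  by under eq_fun do rewrite ReD; exact: (@smooth_deriveD R n _ _ x v fr gr).
by under eq_fun do rewrite ImD; exact: (@smooth_deriveD R n _ _ x v fi gi).
Qed.

Lemma csmoothZ (c : C) f : csmooth f -> csmooth (fun x => c * f x).
Proof.
move=> [fr fi]; split.
  by under eq_fun do rewrite ReM; apply: smoothD; exact: smoothZ.
by under eq_fun do rewrite ImM; apply: smoothD; exact: smoothZ.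
Qed.

Lemma cderiveZ (c : C) f v x : csmooth f ->
  cderive v (fun x => c * f x) x = c * cderive v f x.
Proof.
move=> [fr fi]; apply: eq_complexP; rewrite ?ReM ?ImM /=.
  under eq_fun do rewrite ReM.
  rewrite (@smooth_deriveD R n _ _ x v (smoothZ _ fr) (smoothZ _ fi)).
  by rewrite (@smooth_deriveZ R n _ _ x v fr) (@smooth_deriveZ R n _ _ x v fi).
under eq_fun do rewrite ImM.
rewrite (@smooth_deriveD R n _ _ x v (smoothZ _ fi) (smoothZ _ fr)).
by rewrite (@smooth_deriveZ R n _ _ x v fr) (@smooth_deriveZ R n _ _ x v fi).
Qed.

Lemma csmooth_sum (I : Type) (r : seq I) (F : I -> 'cV[R]_n -> C) :
  (forall i, csmooth (F i)) -> csmooth (fun x => \sum_(i <- r) F i x).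
Proof.
move=> sF; elim: r => [|i r IH].
  under eq_fun do rewrite big_nil.
  exact: (csmooth_cst 0).
under eq_fun do rewrite big_cons.
exact: csmoothD.
Qed.

Lemma cderive_sum (I : Type) (r : seq I) (F : I -> 'cV[R]_n -> C) v x :
  (forall i, csmooth (F i)) ->
  cderive v (fun x => \sum_(i <- r) F i x) x = \sum_(i <- r) cderive v (F i) x.
Proof.
move=> sF; elim: r => [|i r IH].
  by under eq_fun do rewrite big_nil; rewrite big_nil cderive_cst.
under eq_fun do rewrite big_cons.
by rewrite big_cons cderiveD ?IH//; exact: csmooth_sum.
Qed.

Lemma cderive_dirD f u v x : csmooth f -> cderive (u + v) f x = cderive u f x + cderive v f x.
Proof.
move=> [fr fi]; apply: eq_complexP; rewrite ?ReD ?ImD /=.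
  exact: (@smooth_derive_dirD R n _ x u v fr).
exact: (@smooth_derive_dirD R n _ x u v fi).
Qed.

Lemma cderive_dirZ f (a : R) v x : csmooth f -> cderive (a *: v) f x = a%:C * cderive v f x.
Proof.
move=> [fr fi]; apply: eq_complexP; rewrite ?ReM ?ImM /= ?oppr0 ?mul0r addr0.
  exact: (@smooth_derive_dirZ R n _ x v a fr).
exact: (@smooth_derive_dirZ R n _ x v a fi).
Qed.

Lemma cderive_swap f u v x : csmooth f -> cderive u (cderive v f) x = cderive v (cderive u f) x.
Proof.
move=> [fr fi]; apply: eq_complexP => /=.
  exact: (@smooth_derive_swap R n _ x u v fr).
exact: (@smooth_derive_swap R n _ x u v fi).
Qed.

Lemma cderive_affine f (A : 'M[R]_n) (b x v : 'cV[R]_n) :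
  cderive v (fun y => f (A *m y + b)) x = cderive (A *m v) f (A *m x + b).
Proof.
apply: eq_complexP => /=.
  exact: (@derive_affine R n (fun y => complex.Re (f y))).
exact: (@derive_affine R n (fun y => complex.Im (f y))).
Qed.

End ComplexDerivatives.

(** * First-order operators with constant coefficients on spinors *)

Section SpinorDerivatives.
Variables (R : realType) (k : nat).
Local Notation C := R[i].
Local Notation n := (k.*2.+1).
Local Notation N := (2 ^ k)%N.
Implicit Types (phi psi : spinor_fun R k) (x u v : 'cV[R]_n) (S : 'M[C]_N).

Definition smooth_spinor phi := forall i, csmooth (fun x => phi x i 0).

Lemma spinor_derivE v phi x i : spinor_deriv v phi x i 0 = cderive v (fun y => phi y i 0) x.
Proof. by rewrite mxE. Qed.

Lemma smooth_spinor_deriv v phi : smooth_spinor phi -> smooth_spinor (spinor_deriv v phi).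
Proof.
by move=> sp i; under eq_fun do rewrite spinor_derivE; exact: csmooth_derive.
Qed.

Lemma smooth_spinorD phi psi : smooth_spinor phi -> smooth_spinor psi ->
  smooth_spinor (fun x => phi x + psi x).
Proof. by move=> sp sq i; under eq_fun do rewrite mxE; exact: csmoothD. Qed.

Lemma spinor_derivD v phi psi x : smooth_spinor phi -> smooth_spinor psi ->
  spinor_deriv v (fun x => phi x + psi x) x = spinor_deriv v phi x + spinor_deriv v psi x.
Proof.
move=> sp sq; apply/colP => i; rewrite [RHS]mxE !spinor_derivE.
by under eq_fun do rewrite mxE; exact: cderiveD.
Qed.

Lemma smooth_spinor_mulmx S phi : smooth_spinor phi -> smooth_spinor (fun x => S *m phi x).
Proof.
by move=> sp i; under eq_fun do rewrite mxE; apply: csmooth_sum => j; exact: csmoothZ.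
Qed.

Lemma spinor_deriv_mulmx v S phi x : smooth_spinor phi ->
  spinor_deriv v (fun x => S *m phi x) x = S *m spinor_deriv v phi x.
Proof.
move=> sp; apply/colP => i; rewrite spinor_derivE.
under eq_fun do rewrite mxE.
rewrite cderive_sum => [|j]; last exact: csmoothZ.
by rewrite [RHS]mxE; apply: eq_bigr => j _; rewrite cderiveZ// spinor_derivE.
Qed.

Lemma smooth_spinorZ (c : C) phi : smooth_spinor phi -> smooth_spinor (fun x => c *: phi x).
Proof.
have -> : (fun x => c *: phi x) = (fun x => c%:M *m phi x).
  by apply/funext => x; rewrite mul_scalar_mx.
exact: smooth_spinor_mulmx.
Qed.

Lemma spinor_derivZ v (c : C) phi x : smooth_spinor phi ->
  spinor_deriv v (fun x => c *: phi x) x = c *: spinor_deriv v phi x.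
Proof.
have -> : (fun x => c *: phi x) = (fun x => c%:M *m phi x).
  by apply/funext => y; rewrite mul_scalar_mx.
by move=> sp; rewrite spinor_deriv_mulmx// mul_scalar_mx.
Qed.

Lemma smooth_spinor0 : smooth_spinor (fun=> 0).
Proof. by move=> i; exact: csmooth_cst. Qed.

Lemma spinor_deriv0 v x : spinor_deriv v (fun=> 0) x = 0.
Proof. by apply/colP => i; rewrite spinor_derivE !mxE cderive_cst. Qed.

Lemma smooth_spinor_sum (I : Type) (r : seq I) (F : I -> spinor_fun R k) :
  (forall i, smooth_spinor (F i)) -> smooth_spinor (fun x => \sum_(i <- r) F i x).
Proof.
move=> sF; elim: r => [|i r IH]; under eq_fun do rewrite ?big_nil ?big_cons.
  exact: smooth_spinor0.
exact: smooth_spinorD.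
Qed.

Lemma spinor_deriv_sum (I : Type) (r : seq I) (F : I -> spinor_fun R k) v x :
  (forall i, smooth_spinor (F i)) ->
  spinor_deriv v (fun x => \sum_(i <- r) F i x) x = \sum_(i <- r) spinor_deriv v (F i) x.
Proof.
move=> sF; elim: r => [|i r IH]; under eq_fun do rewrite ?big_nil ?big_cons.
  by rewrite big_nil spinor_deriv0.
by rewrite big_cons spinor_derivD ?IH//; exact: smooth_spinor_sum.
Qed.

Lemma spinor_deriv_dirD u v phi x : smooth_spinor phi ->
  spinor_deriv (u + v) phi x = spinor_deriv u phi x + spinor_deriv v phi x.
Proof. by move=> sp; apply/colP => i; rewrite [RHS]mxE !spinor_derivE cderive_dirD. Qed.

Lemma spinor_deriv_dirZ (a : R) v phi x : smooth_spinor phi ->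
  spinor_deriv (a *: v) phi x = a%:C *: spinor_deriv v phi x.
Proof. by move=> sp; apply/colP => i; rewrite [RHS]mxE !spinor_derivE cderive_dirZ. Qed.

Lemma spinor_deriv_swap u v phi x : smooth_spinor phi ->
  spinor_deriv u (spinor_deriv v phi) x = spinor_deriv v (spinor_deriv u phi) x.
Proof.
move=> sp; apply/colP => i.
have H w : (fun y => spinor_deriv w phi y i 0) = cderive w (fun y => phi y i 0).
  by apply/funext => y; rewrite spinor_derivE.
apply: (etrans (spinor_derivE _ _ _ _)); apply: (etrans (congr1 (fun g => cderive u g x) (H v))).
apply: (etrans (cderive_swap u v x (sp i))); apply/esym.
apply: (etrans (spinor_derivE _ _ _ _)); exact: (congr1 (fun g => cderive v g x) (H u)).
Qed.

Lemma spinor_deriv_affine v phi (A : 'M[R]_n) (b x : 'cV[R]_n) :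
  spinor_deriv v (fun y => phi (A *m y + b)) x = spinor_deriv (A *m v) phi (A *m x + b).
Proof.
by apply/colP => i; rewrite !spinor_derivE (@cderive_affine R n (fun y => phi y i 0)).
Qed.

Variable E : 'I_n -> 'cV[R]_n.

(** The Dirac operator and the operator B are both of this form, so that compositions are computed
    once for all. *)
Definition diffop (Q : 'I_n -> 'M[C]_N) phi : spinor_fun R k :=
  fun x => \sum_l Q l *m spinor_deriv (E l) phi x.

Lemma smooth_diffop Q phi : smooth_spinor phi -> smooth_spinor (diffop Q phi).
Proof.
move=> sp; apply: smooth_spinor_sum => l; apply: smooth_spinor_mulmx.
exact: smooth_spinor_deriv.
Qed.

Lemma diffop_comp P Q phi x : smooth_spinor phi -> diffop P (diffop Q phi) x =
  \sum_l \sum_l' P l *m Q l' *m spinor_deriv (E l) (spinor_deriv (E l') phi) x.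
Proof.
move=> sp; apply: eq_bigr => l _.
have sd l' : smooth_spinor (spinor_deriv (E l') phi) by exact: smooth_spinor_deriv.
rewrite spinor_deriv_sum => [|l']; last exact: smooth_spinor_mulmx.
rewrite mulmx_sumr; apply: eq_bigr => l' _.
by rewrite spinor_deriv_mulmx// mulmxA.
Qed.

(** Coefficients antisymmetric in l and l' cancel against the symmetry of the second derivatives.
    The identities for D B + B D and for B^2 thereby become identities between anticommutators of
    Clifford elements. *)
Lemma antisym_second_order (X : 'I_n -> 'I_n -> 'M[C]_N) phi x : smooth_spinor phi ->
  (forall l l', X l l' + X l' l = 0) ->
  \sum_l \sum_l' X l l' *m spinor_deriv (E l) (spinor_deriv (E l') phi) x = 0.
Proof.
move=> sp X0; set S := LHS.
have SN : S = - S.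
  rewrite {1}/S exchange_big /S -sumrN; apply: eq_bigr => l _.
  rewrite -sumrN; apply: eq_bigr => l' _.
  rewrite spinor_deriv_swap// -mulNmx; congr (_ *m _).
  by apply/eqP; rewrite -addr_eq0 X0.
have : S *+ 2 = 0 by rewrite mulr2n {2}SN subrr.
rewrite -scaler_nat => /eqP; rewrite scaler_eq0 pnatr_eq0 /= => /eqP //.
Qed.

Lemma diffop_lin Q (I : Type) (r : seq I) (c : I -> C) (F : I -> spinor_fun R k) x :
  (forall i, smooth_spinor (F i)) ->
  diffop Q (fun x => \sum_(i <- r) c i *: F i x) x = \sum_(i <- r) c i *: diffop Q (F i) x.
Proof.
move=> sF; rewrite /diffop.
under eq_bigr => l _.
  rewrite spinor_deriv_sum => [|i]; last exact: smooth_spinorZ.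
  rewrite mulmx_sumr.
  under eq_bigr => i _ do rewrite spinor_derivZ// -scalemxAr.
  over.
by rewrite exchange_big; apply: eq_bigr => i _; rewrite scaler_sumr.
Qed.

End SpinorDerivatives.

(** * The operator B: invariance, anticommutation with D, square and kernel *)

Section FiberDirac.
Variables (R : realType) (k : nat) (M : chd R k).
Local Notation C := R[i].
Local Notation n := (k.*2.+1).
Local Notation N := (2 ^ k)%N.
Local Notation al := (spin_alpha_pm R k).
Local Notation A := (chd_A M).
Local Notation a j := ((chd_a M)`_j).
Local Notation e := (cliff R k).
Local Notation ev j := ((chd_e M)`_j).
Local Notation E := (tnth (chd_e M)).
Local Notation b := (n%:R^-1 *: a k.*2).
Implicit Types (phi : spinor_fun R k) (x : 'cV[R]_n).

Lemma unitmx_of_ker0 (F : fieldType) m (X : 'M[F]_m) :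
  (forall x : 'cV[F]_m, X *m x = 0 -> x = 0) -> X \in unitmx.
Proof.
move=> X0; rewrite -unitmx_tr -row_free_unit -kermx_eq0; apply/eqP/row_matrixP => i.
have : row i (kermx X^T) *m X^T = 0 by rewrite -row_mul mulmx_ker row0.
move=> /(congr1 trmx); rewrite trmx_mul trmxK trmx0 => /X0 /(congr1 trmx).
by rewrite trmxK trmx0 row0.
Qed.

Lemma chd_A_unit : A \in unitmx.
Proof.
apply: unitmx_of_ker0 => x Ax; apply/eqP; apply: contraT => x0.
have := @chd_dot_pos R k M x x0.
by rewrite -(chd_dot_inv M) -!mulmxA Ax !mulmx0 mxE ltxx.
Qed.

(** Induction over the generated subgroup. Invertibility is carried along because [invmx] returns
    its argument on a singular matrix, so the clause for inverses would otherwise say nothing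
    useful. *)
Lemma spin_hom_equivariant phi s :
  (forall j x, (j < k.*2)%N -> phi (x + a j) = phi x) ->
  (forall x, phi (A *m x + b) = al s *m phi x) ->
  forall f S, spin_hom M s f S ->
    [/\ f.1 \in unitmx, S \in unitmx & forall x, phi (aff_app f x) = S *m phi x].
Proof.
move=> pa pg f S; elim=> [|j jk||g h T U _ [g1 T1 gT] _ [h1 U1 hU]|g T _ [g1 T1 gT]].
- by split; rewrite ?unitmx1// => x; rewrite /aff_app /= mul1mx addr0 mul1mx.
- by split; rewrite ?unitmx1// => x; rewrite /aff_app /= !mul1mx pa.
- by split; [exact: chd_A_unit|exact: spin_alpha_pm_unit|exact: pg].
- split; rewrite ?unitmx_mul ?g1 ?T1// => x.
  by rewrite -mulmxA -hU -gT /aff_app /= mulmxDr mulmxA addrA.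
split; rewrite /= ?unitmx_inv// => x.
have := gT (aff_app (aff_inv g) x); rewrite [X in phi X = _](_ : _ = x).
  by move=> ->; rewrite mulKmx.
by rewrite /aff_app /= mulmxDr mulmxN !mulKVmx// subrK.
Qed.

Lemma is_spinorP s phi : is_spinor M s phi <->
  [/\ smooth_spinor phi, forall j x, (j < k.*2)%N -> phi (x + a j) = phi x &
      forall x, phi (A *m x + b) = al s *m phi x].
Proof.
split=> [[sr si h]|[sp pa pg]].
  split=> [i|j x jk|x]; first by split.
    have := h _ _ (spin_hom_a M s jk) (x + a j); rewrite mul1mx => <-.
    by rewrite /aff_app /= invmx1 !mul1mx addrK.
  have := h _ _ (spin_hom_g M s) (A *m x + b) => <-.
  by rewrite /aff_app /= mulmxDr mulKmx ?chd_A_unit// addrK.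
split=> [i|i|f S h x]; [by have [] := sp i|by have [] := sp i|].
have [f1 S1 H] := spin_hom_equivariant pa pg h.
rewrite -H; congr (phi _).
by rewrite /aff_app /= mulmxDr mulmxN !mulKVmx// subrK.
Qed.

(** In B the derivative along the l-th basis vector comes with the other vector of its rotation
    plane. The last index is its own partner and has sign 0, so that B becomes a sum over all l, as
    [diffop] expects. *)
Definition partner (l : nat) : nat :=
  if (l < k.*2)%N then (if odd l then l.-1 else l.+1) else l.
Definition partner_sign (l : nat) : C :=
  if (l < k.*2)%N then (if odd l then 1 else -1) else 0.

Lemma partner_lt l : (l < k.*2)%N -> (partner l < k.*2)%N.
Proof.
move=> lk; rewrite /partner lk; case: (boolP (odd l)) => ol; first by lia.
rewrite ltn_neqAle lk andbT; apply: contraNneq ol => h.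
by have := odd_double k; rewrite -h /= => /negbFE.
Qed.

Lemma partner_le l : (l <= k.*2)%N -> (partner l <= k.*2)%N.
Proof.
case: (boolP (l < k.*2)%N) => [/partner_lt/ltnW//|lk].
by rewrite /partner (negbTE lk).
Qed.

Lemma partnerK : involutive partner.
Proof.
move=> l; rewrite {2}/partner; case: (boolP (l < k.*2)%N) => lk; last by rewrite /partner (negbTE lk).
have := partner_lt lk; rewrite {1}/partner lk; case: (boolP (odd l)) => ol pk; rewrite /partner pk.
  by case: l ol {lk pk} => //= l; case: (odd l).
by rewrite /= ol.
Qed.

Lemma partner_signN l : partner_sign (partner l) = - partner_sign l.
Proof.
rewrite /partner_sign; case: (boolP (l < k.*2)%N) => lk; last first.
  by rewrite /partner (negbTE lk) (negbTE lk) oppr0.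
rewrite (partner_lt lk) /partner lk; case: (boolP (odd l)) => ol.
  by case: l ol {lk} => //= l; case: (odd l).
by rewrite /= ol opprK.
Qed.

Definition fiber_coef (l : 'I_n) : 'M[C]_N := partner_sign l *: e (partner l).
Definition fiber_dirac : spinor_fun R k -> spinor_fun R k := diffop E fiber_coef.

Lemma diracE phi : Defs.dirac M phi = diffop E (fun l => e l) phi.
Proof. by []. Qed.

Lemma cliff_acomm i j : (i <= k.*2)%N -> (j <= k.*2)%N ->
  e i *m e j + e j *m e i = ((i == j)%:R * -2)%:M.
Proof.
move=> ik jk; case: (eqVneq i j) => [<-|ij].
  rewrite cliff_sqr mul1r -opprD; apply/matrixP => p q; rewrite !mxE.
  by rewrite -mulr2n mulNrn mulrnAC.
by rewrite cliff_anticomm// addNr mul0r raddf0.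
Qed.

Lemma ord_le (l : 'I_n) : (l <= k.*2)%N.
Proof. by rewrite -ltnS. Qed.

(** The symmetrized coefficient of d_l d_l' is a sum of two anticommutators. They vanish unless l
    and l' are partners, and then they cancel because partners have opposite signs. *)
Lemma fiber_dirac_anticomm phi x : smooth_spinor phi ->
  fiber_dirac (Defs.dirac M phi) x = - Defs.dirac M (fiber_dirac phi) x.
Proof.
move=> sp; apply/eqP; rewrite -addr_eq0 !diracE /fiber_dirac.
rewrite !diffop_comp// -big_split /=; apply/eqP.
under eq_bigr => l _ do (rewrite -big_split /=; under eq_bigr => l' _ do rewrite -mulmxDl).
apply: (antisym_second_order E x sp (X := fun l l' : 'I_n =>
  fiber_coef l *m e l' + e l *m fiber_coef l')) => l l'.
rewrite /fiber_coef -!scalemxAl -!scalemxAr [X in _ + X]addrC addrACA -!scalerDr.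
rewrite !cliff_acomm ?partner_le ?ord_le//.
case: (eqVneq (nat_of_ord l) (partner l')) => [ll|ll].
  rewrite ll partnerK eqxx partner_signN scaleNr addNr //.
have -> : (partner l == l') = false.
  by apply: contraNF ll => /eqP <-; rewrite partnerK.
by rewrite mul0r raddf0 !scaler0 addr0.
Qed.

(** The squared signs are 1 on the fibre directions and 0 on the last one, so the right side is
    minus the sum of the second derivatives along the fibre. *)
Lemma fiber_dirac_sqr phi x : smooth_spinor phi ->
  fiber_dirac (fiber_dirac phi) x
  = - \sum_(l < n) (partner_sign l * partner_sign l) *: spinor_deriv (E l) (spinor_deriv (E l) phi) x.
Proof.
move=> sp; apply/eqP; rewrite -addr_eq0 /fiber_dirac diffop_comp//.
rewrite -big_split /=; apply/eqP.
under eq_bigr => l _.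
  rewrite [X in _ + X](_ : _ = \sum_l' ((l == l')%:R * (partner_sign l * partner_sign l))%:M
      *m spinor_deriv (E l) (spinor_deriv (E l') phi) x); last first.
    rewrite (bigD1 l)//= eqxx mul1r mul_scalar_mx big1 ?addr0// => l' /negbTE.
    by rewrite eq_sym => ->; rewrite mul0r raddf0 mul0mx.
  rewrite -big_split /=.
  under eq_bigr => l' _ do rewrite -mulmxDl.
  over.
apply: (antisym_second_order E x sp (X := fun l l' : 'I_n =>
  fiber_coef l *m fiber_coef l' + ((l == l')%:R * (partner_sign l * partner_sign l))%:M)) => l l'.
rewrite addrACA /fiber_coef -!scalemxAl -!scalemxAr !scalerA (mulrC (partner_sign l')) -scalerDr.
rewrite cliff_acomm ?partner_le ?ord_le// (can_eq partnerK) (eq_sym l').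
have -> : (nat_of_ord l == nat_of_ord l') = (l == l') by [].
case: (eqVneq l l') => [<-|_]; last by rewrite !mul0r !raddf0 /= ?scaler0 !addr0.
rewrite mul1r -[(-2)%:M]scalemx1 scalerA -[(_ * _)%:M]scalemx1 mul1r -!scalerDl.
rewrite [X in X *: _](_ : _ = 0) ?scale0r//.
by rewrite -[(_ + _) *: _]/((_ + _) * _); ring.
Qed.

Lemma sum_ord_pair (V : nmodType) (F : nat -> V) m :
  \sum_(l < m.*2) F l = \sum_(j < m) (F j.*2 + F j.*2.+1).
Proof.
elim: m => [|m IH]; first by rewrite !big_ord0.
by rewrite doubleS !big_ord_recr /= IH addrA.
Qed.

Lemma fiber_diracE phi x : fiber_dirac phi x = \sum_(j < k)
  (e j.*2 *m spinor_deriv (ev j.*2.+1) phi x - e j.*2.+1 *m spinor_deriv (ev j.*2) phi x).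
Proof.
rewrite /fiber_dirac /diffop.
have -> : \sum_(l < n) fiber_coef l *m spinor_deriv (E l) phi x =
    \sum_(l < n) (partner_sign l *: e (partner l)) *m spinor_deriv (ev l) phi x.
  by apply: eq_bigr => l _; rewrite (tnth_nth 0).
rewrite big_ord_recr /= {2}/partner_sign ltnn scale0r mul0mx addr0.
rewrite (sum_ord_pair (fun l => (partner_sign l *: e (partner l)) *m spinor_deriv (ev l) phi x)).
apply: eq_bigr => j _; rewrite /partner_sign /partner.
have -> : (j.*2 < k.*2)%N by rewrite ltn_double.
have -> : (j.*2.+1 < k.*2)%N by have := ltn_ord j; lia.
by rewrite /= odd_double /= scaleN1r scale1r mulNmx addrC.
Qed.

(** Conjugation by alpha and the linear map A rotate the pairs (e_(2j-1), e_(2j)) and (d_(2j-1),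
    d_(2j)) by the same angle, and e_(2j-1) d_(2j) - e_(2j) d_(2j-1), being a determinant, is
    unchanged by simultaneous rotations. *)
Lemma fiber_dirac_spinor s phi : is_spinor M s phi -> is_spinor M s (fiber_dirac phi).
Proof.
move=> /is_spinorP[sp pa pg]; apply/is_spinorP; split; first exact: smooth_diffop.
  move=> j x jk; apply: eq_bigr => l _; congr (_ *m _).
  have H : (fun y => phi (1%:M *m y + a j)) = phi.
    by apply/funext => y; rewrite mul1mx pa.
  have := spinor_deriv_affine (E l) phi 1%:M (a j) x.
  by rewrite !mul1mx => <-; rewrite H.
move=> x.
have H : (fun y => phi (A *m y + b)) = (fun y => al s *m phi y) by apply/funext.
have dg v : spinor_deriv (A *m v) phi (A *m x + b) = al s *m spinor_deriv v phi x.
  by rewrite -spinor_deriv_affine H spinor_deriv_mulmx.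
rewrite !fiber_diracE mulmx_sumr; apply: eq_bigr => j _.
have jk := ltn_ord j.
have r1 X Y v : al s *m X = Y *m al s ->
    al s *m (X *m spinor_deriv v phi x) = Y *m spinor_deriv (A *m v) phi (A *m x + b).
  by move=> h; rewrite mulmxA h -mulmxA dg.
rewrite mulmxBr (r1 _ _ _ (@spin_alpha_pm_vec1 R k s j jk)) (r1 _ _ _ (@spin_alpha_pm_vec2 R k s j jk)).
rewrite (chd_A_rot1 M jk) (chd_A_rot2 M jk) -/(chd_angle R k j).
move: (A *m x + b) => y.
rewrite !(spinor_deriv_dirD _ _ _ sp) !(spinor_deriv_dirZ _ _ _ sp).
move: (spinor_deriv (ev j.*2) phi y) (spinor_deriv (ev j.*2.+1) phi y) => d1 d2.
set c := cos _; set t := sin _.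
have ct : c%:C * c%:C + t%:C * t%:C = 1.
  by rewrite -!rmorphM -rmorphD -!expr2 cos2Dsin2.
have tN : (- t)%:C = - t%:C :> C by rewrite rmorphN.
rewrite {}tN; move: (c%:C) (t%:C) ct => p q ct.
move: (e j.*2) (e j.*2.+1) => X Y.
rewrite !mulmxDl !mulmxDr -!scalemxAl -!scalemxAr.
move: (X *m d1) (X *m d2) (Y *m d1) (Y *m d2) => u1 u2 u3 u4.
rewrite -[u2 in LHS]scale1r -[u3 in LHS]scale1r -ct.
by apply/colP => i; rewrite !mxE; ring.
Qed.

Lemma chd_e_coef : exists c : 'I_k.*2 -> 'I_(size (take k.*2 (chd_a M))) -> R,
  forall i : 'I_k.*2, ev i = \sum_j c i j *: a j.
Proof.
exists (fun i j => coord (in_tuple (take k.*2 (chd_a M))) j (ev i)) => i.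
apply: (etrans (@coord_span _ _ _ (in_tuple (take k.*2 (chd_a M))) _ (chd_e_span M (ltn_ord i)))).
apply: eq_bigr => j _.
congr (_ *: _); rewrite nth_take//.
by apply: leq_trans (ltn_ord j) _; rewrite size_take; case: ifP => // /negbT; rewrite -leqNgt.
Qed.

(** The real and imaginary parts of every component are harmonic along the fibre and invariant under
    the fibre lattice, so [harmonic_grad0] applies to each of them. *)
Lemma fiber_dirac_ker phi s : is_spinor M s phi ->
  (forall x, fiber_dirac (fiber_dirac phi) x = 0) ->
  forall j x, (j < k.*2)%N -> spinor_deriv (ev j) phi x = 0.
Proof.
move=> /is_spinorP[sp pa _] D0 j x jk.
have [c hc] := chd_e_coef.
have lap y : \sum_(l < k.*2) spinor_deriv (ev l) (spinor_deriv (ev l) phi) y = 0.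
  have := D0 y; rewrite fiber_dirac_sqr// => /eqP; rewrite oppr_eq0 big_ord_recr /=.
  rewrite {3 4}/partner_sign ltnn mul0r scale0r addr0 => /eqP h; rewrite -[RHS]h.
  apply: eq_bigr => l _; rewrite /partner_sign ltn_ord (tnth_nth 0).
  by case: ifP => _; rewrite ?mulrNN mulr1 scale1r.
have sza : size (take k.*2 (chd_a M)) = k.*2 by rewrite size_take size_tuple ltnSn.
apply/colP => i; rewrite spinor_derivE [RHS]mxE.
have [sr si] := sp i.
have lapc y : \sum_(l < k.*2) cderive (ev l) (cderive (ev l) (fun y => phi y i 0)) y = 0.
  have := congr1 (fun w : 'cV[C]_N => w i 0) (lap y); rewrite summxE [RHS]mxE => h; rewrite -[RHS]h.
  apply: eq_bigr => l _; rewrite spinor_derivE; congr (cderive _ _ _).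
  by apply/funext => z; rewrite spinor_derivE.
have Re_sum (m : nat) (F : 'I_m -> C) : complex.Re (\sum_l F l) = \sum_l complex.Re (F l).
  by elim/big_rec2: _ => // l u v _ <-; exact: ReD.
have Im_sum (m : nat) (F : 'I_m -> C) : complex.Im (\sum_l F l) = \sum_l complex.Im (F l).
  by elim/big_rec2: _ => // l u v _ <-; exact: ImD.
apply: eq_complexP => /=.
  apply: (@harmonic_grad0 R n k.*2 _ (fun l => ev l) (fun l => a l) c hc _ sr _ _ (Ordinal jk) x).
    by move=> l y; rewrite pa//; apply: leq_trans (ltn_ord l) _; rewrite sza.
  by move=> y; have := congr1 (@complex.Re R) (lapc y); rewrite Re_sum.
apply: (@harmonic_grad0 R n k.*2 _ (fun l => ev l) (fun l => a l) c hc _ si _ _ (Ordinal jk) x).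
  by move=> l y; rewrite pa//; apply: leq_trans (ltn_ord l) _; rewrite sza.
by move=> y; have := congr1 (@complex.Im R) (lapc y); rewrite Im_sum.
Qed.

End FiberDirac.

(** * Eigenspinors that depend on x_n only *)

Section PlaneWaves.
Variables (R : realType) (k : nat) (M : chd R k).
Local Notation C := R[i].
Local Notation n := (k.*2.+1).
Local Notation N := (2 ^ k)%N.
Local Notation al := (spin_alpha_pm R k).
Local Notation A := (chd_A M).
Local Notation a j := ((chd_a M)`_j).
Local Notation e := (cliff R k).
Local Notation ev j := ((chd_e M)`_j).
Local Notation E := (tnth (chd_e M)).
Local Notation b := (n%:R^-1 *: a k.*2).
Local Notation en := (cliff R k k.*2).
Implicit Types (phi : spinor_fun R k) (x : 'cV[R]_n) (f u : 'cV[R]_n -> R).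

Lemma chd_e_decomp x : x = \sum_(i < n) coord (chd_e M) i x *: ev i.
Proof. exact: (coord_basis (chd_e_basis M) (memvf x)). Qed.

Lemma const_of_grad0 f : smooth f -> (forall j x, (j < n)%N -> 'D_(ev j) f x = 0) ->
  forall x, f x = f 0.
Proof.
move=> sf f0 x; apply/eqP; rewrite -subr_eq0; apply/eqP.
have [c _] := @dir_MVT R n f 0 x (fun y => @smooth_derivable R n f y x sf).
rewrite addr0 => ->.
apply: (etrans (congr1 (derive f _) (chd_e_decomp x))).
by rewrite (smooth_derive_dir_sum _ _ _ _ sf) big1// => i _; rewrite f0 ?mulr0.
Qed.

(** The energy (d_n u)^2 + mu^2 u^2 has zero gradient and vanishes at the origin, hence everywhere;
    it is a sum of squares with mu^2 > 0. *)
Lemma oscillator_unique u (mu : R) : mu != 0 -> smooth u ->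
  (forall j x, (j < k.*2)%N -> 'D_(ev j) u x = 0) ->
  (forall x, 'D_(ev k.*2) ('D_(ev k.*2) u) x = - (mu * mu) * u x) ->
  u 0 = 0 -> 'D_(ev k.*2) u 0 = 0 -> forall x, u x = 0.
Proof.
move=> mu0 su uj un u0 du0 x.
pose v := ev k.*2; pose du := 'D_v u.
have sdu : smooth du by exact: smooth_derive.
pose q x := du x * du x + mu * mu * (u x * u x).
have sq : smooth q by apply: smoothD; [exact: smoothM|apply: smoothZ; exact: smoothM].
have dq w y : 'D_w q y = 2 * (du y * 'D_w du y) + mu * mu * (2 * (u y * 'D_w u y)).
  have s1 := smoothM sdu sdu; have s2 := smoothM su su.
  rewrite (@smooth_deriveD R n _ _ y w s1 (smoothZ (mu * mu) s2)).
  rewrite (@smooth_deriveZ R n _ (mu * mu) y w s2).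
  rewrite (@smooth_deriveM R n _ _ y w sdu sdu) (@smooth_deriveM R n _ _ y w su su).
  by rewrite -!mulr2n !mulr_natl.
have alg (p r m : R) : 2 * (p * (- (m * m) * r)) + m * m * (2 * (r * p)) = 0 by ring.
have q0 y : q y = 0.
  rewrite (const_of_grad0 sq) => [|j z].
    by rewrite /q /du du0 u0 !mulr0 addr0.
  rewrite ltnS leq_eqVlt => /orP[/eqP ->|jk].
    rewrite dq un; exact: alg.
  rewrite dq uj// (_ : 'D_(ev j) du z = 0) ?mulr0 ?addr0//.
  apply: (etrans (@smooth_derive_swap R n u z (ev j) v su)).
  have uj0 : derive u ^~ (ev j) = (fun=> 0) by apply/funext => t; exact: uj.
  by apply: (etrans (congr1 (fun g => derive g z v) uj0)); exact: derive_cst.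
have := q0 x; rewrite /q => /eqP; rewrite paddr_eq0 -?expr2 ?sqr_ge0//; last first.
  by rewrite mulr_ge0// sqr_ge0.
by rewrite !mulf_eq0 ?sqrf_eq0 (negbTE mu0) /= ?orbb => /andP[_ /eqP].
Qed.

(** Differentiating the first-order equation once more and using e_n^2 = -1 decouples the
    components: each real and imaginary part solves the oscillator equation with zero initial
    data. *)
Lemma spinor_unique phi (mu : R) : mu != 0 -> smooth_spinor phi ->
  (forall j x, (j < k.*2)%N -> spinor_deriv (ev j) phi x = 0) ->
  (forall x, spinor_deriv (ev k.*2) phi x = (- mu)%:C *: (en *m phi x)) ->
  phi 0 = 0 -> forall x, phi x = 0.
Proof.
move=> mu0 sp pj pn p0 x; apply/colP => i; rewrite [RHS]mxE.
have [sr si] := sp i.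
have d1 j y : (j < k.*2)%N -> cderive (ev j) (fun y => phi y i 0) y = 0.
  by move=> jk; rewrite -spinor_derivE pj// mxE.
have dd y : cderive (ev k.*2) (cderive (ev k.*2) (fun y => phi y i 0)) y
    = (- (mu * mu))%:C * phi y i 0.
  have h1 : spinor_deriv (ev k.*2) phi = (fun y => (- mu)%:C *: (en *m phi y)) by apply/funext.
  have h2 : cderive (ev k.*2) (fun y => phi y i 0) = (fun y => spinor_deriv (ev k.*2) phi y i 0).
    by apply/funext => z; rewrite spinor_derivE.
  have h3 : spinor_deriv (ev k.*2) (spinor_deriv (ev k.*2) phi) y = (- (mu * mu))%:C *: phi y.
    rewrite h1 spinor_derivZ; last exact: smooth_spinor_mulmx.
    rewrite spinor_deriv_mulmx// pn -scalemxAr mulmxA cliff_sqr mulNmx mul1mx scalerA.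
    by rewrite scalerN -scaleNr -rmorphM -rmorphN mulrNN.
  rewrite h2; have := congr1 (fun w : 'cV[C]_N => w i 0) h3.
  by rewrite spinor_derivE [RHS]mxE.
have d0 : cderive (ev k.*2) (fun y => phi y i 0) 0 = 0.
  by rewrite -spinor_derivE pn p0 mulmx0 scaler0 mxE.
have mulreal (r : R) (z : C) : complex.Re (r%:C * z) = r * complex.Re z /\
    complex.Im (r%:C * z) = r * complex.Im z.
  by case: z => zr zi; split; rewrite /= mul0r ?subr0 ?addr0.
apply: eq_complexP.
  apply: (oscillator_unique mu0 sr) => [j y jk|y||].
  - by have := congr1 (@complex.Re R) (d1 j y jk).
  - by have := congr1 (@complex.Re R) (dd y); rewrite (mulreal _ _).1.
  - by rewrite p0 mxE.
  - by have := congr1 (@complex.Re R) d0.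
apply: (oscillator_unique mu0 si) => [j y jk|y||].
- by have := congr1 (@complex.Im R) (d1 j y jk).
- by have := congr1 (@complex.Im R) (dd y); rewrite (mulreal _ _).2.
- by rewrite p0 mxE.
- by have := congr1 (@complex.Im R) d0.
Qed.

(** The linear form - mu x_n, with x_n the last coordinate in the basis [chd_e M], is stored as a
    row so that the results on cos and sin of a linear form apply. *)
Definition phase_row (mu : R) : 'rV[R]_n :=
  \row_j (- mu * coord (chd_e M) ord_max (delta_mx j 0)).
Definition phase (mu : R) x : R := (phase_row mu *m x) 0 0.

Lemma phaseE mu x : phase mu x = - mu * coord (chd_e M) ord_max x.
Proof.
have {2}-> : x = \sum_j x j 0 *: delta_mx j 0.
  rewrite {1}[x]matrix_sum_delta; apply: eq_bigr => j _.
  by rewrite big_ord_recl big_ord0 addr0.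
rewrite linear_sum mulr_sumr /phase mxE; apply: eq_bigr => j _.
by rewrite mxE linearZ /= -mulrA; congr (_ * _); rewrite mulrC.
Qed.

Lemma phaseD mu x y : phase mu (x + y) = phase mu x + phase mu y.
Proof. by rewrite /phase mulmxDr mxE. Qed.

Lemma phaseZ mu (c : R) x : phase mu (c *: x) = c * phase mu x.
Proof. by rewrite /phase -scalemxAr mxE. Qed.

Lemma phase_sum mu (I : Type) (r : seq I) (F : I -> 'cV[R]_n) :
  phase mu (\sum_(i <- r) F i) = \sum_(i <- r) phase mu (F i).
Proof. by rewrite /phase mulmx_sumr summxE. Qed.

Lemma phase_ev mu j : (j < k.*2)%N -> phase mu (ev j) = 0.
Proof.
move=> jk; rewrite phaseE.
have jn : (j < n)%N by exact: ltn_trans (ltnSn _).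
have := coord_free (Ordinal jn) ord_max (basis_free (chd_e_basis M)) => /= ->.
by rewrite -(inj_eq val_inj) /= ltn_eqF// mulr0.
Qed.

Lemma phase_en mu : phase mu (ev k.*2) = - mu.
Proof.
rewrite phaseE.
have := coord_free ord_max ord_max (basis_free (chd_e_basis M)) => /= ->.
by rewrite eqxx mulr1.
Qed.

Lemma phase_A mu x : phase mu (A *m x) = phase mu x.
Proof.
rewrite {1}(chd_e_decomp x) {2}(chd_e_decomp x) mulmx_sumr !phase_sum.
apply: eq_bigr => i _; rewrite -scalemxAr !phaseZ; congr (_ * _).
have := ltn_ord i; rewrite ltnS leq_eqVlt => /orP[/eqP ->|ik].
  by rewrite chd_e_last chd_A_fix.
rewrite (phase_ev _ ik) -(odd_double_half i).
have ik2 : (i./2 < k)%N by lia.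
have p1 : phase mu (ev (i./2).*2) = 0 by apply: phase_ev; rewrite ltn_double.
have p2 : phase mu (ev (i./2).*2.+1) = 0 by apply: phase_ev; lia.
case: (odd i); rewrite ?add1n ?add0n.
  by rewrite (chd_A_rot2 M ik2) phaseD !phaseZ p1 p2 !mulr0 addr0.
by rewrite (chd_A_rot1 M ik2) phaseD !phaseZ p1 p2 !mulr0 addr0.
Qed.

(* A permutes a_1, ..., a_(n-1), -(a_1 + ... + a_(n-1)) cyclically, so an
   A-invariant linear form takes on all the a_j the same value c = -(n-1) c. *)
Lemma phase_a mu j : (j < k.*2)%N -> phase mu (a j) = 0.
Proof.
move=> jk.
have const l : (l < k.*2)%N -> phase mu (a l) = phase mu (a 0).
  elim: l => // l IH lk; rewrite -(chd_A_shift M lk) phase_A IH//.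
  exact: ltnW.
have k0 : (0 < k.*2)%N by exact: leq_ltn_trans jk.
have : phase mu (A *m a k.*2.-1) = phase mu (a 0).
  by rewrite phase_A const// prednK.
rewrite (@chd_A_last _ _ M); last by rewrite prednK.
rewrite -scaleN1r phaseZ phase_sum big_nat (eq_bigr (fun=> phase mu (a 0))); last first.
  by move=> l /andP[_ lk]; exact: const.
rewrite -big_nat sumr_const_nat subn0 mulN1r => h.
have : phase mu (a 0) *+ n = 0 by rewrite mulrS -{1}h addNr.
by move/eqP; rewrite mulrn_eq0 (const _ jk) => /eqP.
Qed.

(** This is exp(- mu x_n e_n) w. *)
Definition plane_wave (mu : R) (w : 'cV[C]_N) : spinor_fun R k :=
  fun x => rotor en (phase mu x) *m w.

Lemma plane_waveE mu w x : plane_wave mu w x =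
  (cos (phase mu x))%:C *: w + (sin (phase mu x))%:C *: (en *m w).
Proof. by rewrite /plane_wave /rotor mulmxDl mul_scalar_mx -scalemxAl. Qed.

Lemma plane_wave_comp mu w i x : plane_wave mu w x i 0 =
  (cos (phase mu x) * complex.Re (w i 0) + sin (phase mu x) * complex.Re ((en *m w) i 0)) +i*
  (cos (phase mu x) * complex.Im (w i 0) + sin (phase mu x) * complex.Im ((en *m w) i 0)).
Proof.
rewrite plane_waveE mxE [X in X + _]mxE [X in _ + X]mxE.
case: (w i 0) => wr wi; case: ((en *m w) i 0) => ur ui.
by apply: eq_complexP; rewrite /= !mul0r ?subr0 ?addr0.
Qed.

Lemma smooth_plane_wave mu w : smooth_spinor (plane_wave mu w).
Proof.
have [sc ss] := smooth_trig_linear (phase_row mu).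
by move=> i; split; under eq_fun do rewrite plane_wave_comp /=; apply: smoothD; apply: smoothM => //; exact: smooth_cst.
Qed.

Lemma plane_wave_deriv mu w v x : spinor_deriv v (plane_wave mu w) x =
  (phase mu v)%:C *: (en *m plane_wave mu w x).
Proof.
have [sc ss] := smooth_trig_linear (phase_row mu).
have D (p q : R) : 'D_v (fun y => cos (phase mu y) * p + sin (phase mu y) * q) x =
    phase mu v * (cos (phase mu x) * q - sin (phase mu x) * p).
  have s1 := smoothM sc (@smooth_cst R n p); have s2 := smoothM ss (@smooth_cst R n q).
  rewrite (@smooth_deriveD R n _ _ x v s1 s2).
  rewrite (@smooth_deriveM R n _ _ x v sc (@smooth_cst R n p)) (@smooth_deriveM R n _ _ x v ss (@smooth_cst R n q)).
  rewrite !derive_cst !mulr0 !add0r derive_cos_linear derive_sin_linear -/(phase mu v) -/(phase mu x).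
  by rewrite mulNr mulrN [_ * (_ * cos _)]mulrCA addrC mulrBr [cos _ * q]mulrC; congr (_ - _); rewrite mulrCA [p * _]mulrC.
apply/colP => i; rewrite spinor_derivE.
have -> : (en *m plane_wave mu w x) = (cos (phase mu x))%:C *: (en *m w) - (sin (phase mu x))%:C *: w.
  by rewrite plane_waveE mulmxDr -!scalemxAr mulmxA cliff_sqr mulNmx mul1mx scalerN.
rewrite /cderive.
have -> : (fun y => complex.Re (plane_wave mu w y i 0)) = (fun y => cos (phase mu y) * complex.Re (w i 0) + sin (phase mu y) * complex.Re ((en *m w) i 0)).
  by apply/funext => y; rewrite plane_wave_comp.
have -> : (fun y => complex.Im (plane_wave mu w y i 0)) = (fun y => cos (phase mu y) * complex.Im (w i 0) + sin (phase mu y) * complex.Im ((en *m w) i 0)).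
  by apply/funext => y; rewrite plane_wave_comp.
rewrite !D ![in RHS]mxE.
have <- : (en *m w) i 0 = \sum_j en i j * w j 0 by rewrite mxE.
case: (w i 0) => wr wi; case: ((en *m w) i 0) => ur ui.
by apply: eq_complexP; rewrite /= !mul0r ?subr0 ?addr0.
Qed.

Lemma plane_wave0 mu w : plane_wave mu w 0 = w.
Proof. by rewrite /plane_wave /phase mulmx0 mxE rotor0 mul1mx. Qed.

Lemma plane_wave_eigen s mu w : eigen_mx k s mu *m w = 0 -> eigenspinors M s mu (plane_wave mu w).
Proof.
move=> Mw; split.
  apply/is_spinorP; split; first exact: smooth_plane_wave.
    by move=> j x jk; rewrite /plane_wave phaseD (phase_a mu jk) addr0.
  move=> x; rewrite /plane_wave phaseD phase_A phaseZ -chd_e_last phase_en.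
  rewrite -(rotorD _ _ (cliff_sqr R k k.*2)) -mulmxA.
  have hw : rotor en (n%:R^-1 * - mu) *m w = al s *m w.
    apply/eqP; rewrite -subr_eq0 -mulmxBl; move/eqP: Mw; rewrite /eigen_mx.
    by rewrite mulrN mulrC.
  rewrite hw mulmxA [RHS]mulmxA; congr (_ *m _).
  by apply: rotor_comm; rewrite spin_alpha_pm_last.
move=> x; rewrite /Defs.dirac.
rewrite big_ord_recr /= big1 ?add0r; last first.
  move=> l _; rewrite (tnth_nth 0) /= plane_wave_deriv phase_ev; last exact: ltn_ord.
  by rewrite scale0r mulmx0.
rewrite (tnth_nth 0) /= plane_wave_deriv phase_en -scalemxAr mulmxA cliff_sqr mulNmx mul1mx.
by rewrite scalerN rmorphN scaleNr opprK.
Qed.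

Lemma fiber_dirac_plane_wave mu w x : fiber_dirac M (plane_wave mu w) x = 0.
Proof.
rewrite fiber_diracE big1// => j _; rewrite !plane_wave_deriv !phase_ev ?ltn_double//.
  by rewrite !scale0r !mulmx0 subrr.
by have := ltn_ord j; lia.
Qed.

(* An eigenspinor killed by the square of the fibre operator only depends on x_n. *)
Lemma eigen_fiber_ker s mu phi : mu != 0 -> eigenspinors M s mu phi ->
  (forall x, fiber_dirac M (fiber_dirac M phi) x = 0) ->
  (forall x, phi x = plane_wave mu (phi 0) x) /\ eigen_mx k s mu *m phi 0 = 0.
Proof.
move=> mu0 [Sp Dp] D0; have dj := fiber_dirac_ker Sp D0.
have /is_spinorP[sp _ pg] := Sp.
have dn x : spinor_deriv (ev k.*2) phi x = (- mu)%:C *: (en *m phi x).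
  have := Dp x; rewrite /Defs.dirac big_ord_recr /= big1 ?add0r; last first.
    by move=> l _; rewrite (tnth_nth 0) /= dj ?mulmx0.
  rewrite (tnth_nth 0) /= => /(congr1 (mulmx en)).
  rewrite mulmxA cliff_sqr mulNmx mul1mx -scalemxAr => h.
  by rewrite -[LHS]opprK h rmorphN scaleNr.
have E1 x : phi x = plane_wave mu (phi 0) x.
  pose psi x := phi x + (-1) *: plane_wave mu (phi 0) x.
  have sw := smooth_plane_wave mu (phi 0).
  have sw' := smooth_spinorZ (-1) sw.
  suff : psi x = 0 by rewrite /psi scaleN1r => /eqP; rewrite subr_eq0 => /eqP.
  have dpsi v y : spinor_deriv v psi y = spinor_deriv v phi y - spinor_deriv v (plane_wave mu (phi 0)) y.
    by rewrite (spinor_derivD _ _ sp sw') (spinor_derivZ _ _ _ sw) scaleN1r.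
  apply: (spinor_unique mu0).
  - exact: smooth_spinorD.
  - by move=> j y jk; rewrite dpsi dj// plane_wave_deriv phase_ev// scale0r subrr.
  - move=> y; rewrite dpsi dn plane_wave_deriv phase_en -scalerBr -mulmxBr.
    by rewrite /psi scaleN1r.
  - by rewrite /psi plane_wave0 scaleN1r subrr.
split=> //.
have := pg 0; rewrite E1 mulmx0 add0r /plane_wave phaseZ -chd_e_last phase_en => h.
by rewrite /eigen_mx mulmxBl -h mulrN mulrC subrr.
Qed.

End PlaneWaves.

(** * Comparison of the eigenspaces for mu and - mu *)

Section EigenspaceDimensions.
Variables (R : realType) (k : nat) (M : chd R k) (s : spin_sign).
Local Notation C := R[i].
Local Notation N := (2 ^ k)%N.
Local Notation En := (eigenspinors M s).
Implicit Types (phi : spinor_fun R k) (mu : R).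

(** This is [has_dim] with its basis made explicit, since matrices of B have to be written in given
    bases. *)
Definition spans (E : set (spinor_fun R k)) m (b : 'I_m -> spinor_fun R k) :=
  (forall c : 'I_m -> C, E (fun x => \sum_i c i *: b i x)) /\
  (forall phi, E phi -> exists! c : {ffun 'I_m -> C}, phi = fun x => \sum_i c i *: b i x).

Definition combination m (b : 'I_m -> spinor_fun R k) (c : 'rV[C]_m) : spinor_fun R k :=
  fun x => \sum_i c 0 i *: b i x.

Lemma combination_in E m (b : 'I_m -> spinor_fun R k) c : spans E b -> E (combination b c).
Proof. by move=> [h _]; exact: h. Qed.

Lemma combination_delta m (b : 'I_m -> spinor_fun R k) i : combination b (delta_mx 0 i) = b i.
Proof.
apply/funext => x; rewrite /combination (bigD1 i)//= mxE !eqxx scale1r big1 ?addr0// => j /negbTE ji.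
by rewrite mxE ji andbF scale0r.
Qed.

Lemma combination0 m (b : 'I_m -> spinor_fun R k) : combination b 0 = fun=> 0.
Proof. by apply/funext => x; apply: big1 => i _; rewrite mxE scale0r. Qed.

Lemma combination_surj E m (b : 'I_m -> spinor_fun R k) phi : spans E b -> E phi ->
  exists c, phi = combination b c.
Proof.
move=> [_ h] /h[c [-> _]]; exists (\row_i c i).
by apply/funext => x; apply: eq_bigr => i _; rewrite mxE.
Qed.

Lemma combination_inj0 E m (b : 'I_m -> spinor_fun R k) c : spans E b ->
  combination b c = (fun=> 0) -> c = 0.
Proof.
move=> sb c0; have E0 : E (fun=> 0) by rewrite -(combination0 b); exact: combination_in.
have [d [_ du]] := sb.2 _ E0.
have e1 : d = [ffun=> 0].
  by apply: du; apply/funext => x; rewrite big1// => i _; rewrite ffunE scale0r.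
have e2 : d = [ffun i => c 0 i].
  by apply: du; rewrite -c0; apply/funext => x; apply: eq_bigr => i _; rewrite ffunE.
apply/rowP => i; rewrite mxE.
by have := congr1 (fun f : {ffun 'I_m -> C} => f i) (etrans (esym e2) e1); rewrite !ffunE.
Qed.

Lemma eigenspinor_smooth mu phi : En mu phi -> smooth_spinor phi.
Proof. by case=> /is_spinorP[]. Qed.

Lemma fiber_diracZ (c : C) phi x : smooth_spinor phi ->
  fiber_dirac M (fun y => c *: phi y) x = c *: fiber_dirac M phi x.
Proof.
move=> sp; rewrite /fiber_dirac /diffop scaler_sumr; apply: eq_bigr => l _.
by rewrite spinor_derivZ// -scalemxAr.
Qed.

Lemma eigenspinor_fiber_dirac mu phi : En mu phi -> En (- mu) (fiber_dirac M phi).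
Proof.
move=> [Sp Dp]; split; first exact: fiber_dirac_spinor.
have sp : smooth_spinor phi by have /is_spinorP[] := Sp.
move=> x; have h := fiber_dirac_anticomm M x sp.
rewrite -[LHS]opprK -h.
have Dp' : Defs.dirac M phi = (fun y => mu%:C *: phi y) by apply/funext.
by rewrite Dp' fiber_diracZ// rmorphN scaleNr.
Qed.

Lemma spans_in E m (b : 'I_m -> spinor_fun R k) i : spans E b -> E (b i).
Proof. by move=> sb; rewrite -(combination_delta b); exact: combination_in. Qed.

Lemma fiber_dirac_matrix mu m m' (b : 'I_m -> spinor_fun R k) (b' : 'I_m' -> spinor_fun R k) :
  spans (En mu) b -> spans (En (- mu)) b' ->
  exists X : 'M[C]_(m, m'), forall c, fiber_dirac M (combination b c) = combination b' (c *m X).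
Proof.
move=> sb sb'.
have /choice[r hr] i : exists c, fiber_dirac M (b i) = combination b' c.
  apply: (combination_surj sb'); apply: eigenspinor_fiber_dirac; exact: spans_in.
exists (\matrix_(i, j) r i 0 j) => c; apply/funext => x.
rewrite /fiber_dirac diffop_lin; last first.
  by move=> i; apply: eigenspinor_smooth; exact: (spans_in i sb).
under eq_bigr => i _ do rewrite -/(fiber_dirac M (b i)) hr /combination scaler_sumr.
rewrite exchange_big; apply: eq_bigr => j _.
rewrite mxE scaler_suml; apply: eq_bigr => i _.
by rewrite scalerA mxE.
Qed.

(** If B^2 kills an eigenspinor, it is a plane wave, and B already kills it. So X Y and X have the
    same kernel, and rank X = rank (X Y) <= rank Y. The kernel of X consists of the plane waves in
    the eigenspace, which evaluation at the origin identifies with the kernel of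
    [eigen_mx k s mu]. *)
Lemma fiber_dirac_rank mu m m' (b : 'I_m -> spinor_fun R k) (b' : 'I_m' -> spinor_fun R k)
    (X : 'M[C]_(m, m')) (Y : 'M[C]_(m', m)) :
  mu != 0 -> spans (En mu) b -> spans (En (- mu)) b' ->
  (forall c, fiber_dirac M (combination b c) = combination b' (c *m X)) ->
  (forall c, fiber_dirac M (combination b' c) = combination b (c *m Y)) ->
  (\rank X <= \rank Y)%N /\ (m - \rank X)%N = eigen_mx_dim k s mu.
Proof.
move=> mu0 sb sb' hX hY.
have key c : c *m X *m Y = 0 ->
    [/\ c *m X = 0, forall x, combination b c x = plane_wave M mu (combination b c 0) x &
     eigen_mx k s mu *m combination b c 0 = 0].
  move=> cXY; have Ec := combination_in c sb.
  have D0 x : fiber_dirac M (fiber_dirac M (combination b c)) x = 0.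
    by rewrite hX hY cXY combination0.
  have [h1 h2] := eigen_fiber_ker mu0 Ec D0.
  split=> //; apply: (combination_inj0 sb'); rewrite -hX.
  have -> : combination b c = plane_wave M mu (combination b c 0) by apply/funext.
  by apply/funext => x; exact: fiber_dirac_plane_wave.
split.
  apply: leq_trans (mxrankM_maxr X Y).
  rewrite -(leq_add2r (\rank (kermx (X *m Y)))) [X in (_ <= X)%N]addnC.
  rewrite mxrank_ker subnK ?rank_leq_row//.
  have : (\rank (kermx (X *m Y)) <= m - \rank X)%N.
    rewrite -mxrank_ker; apply: mxrankS; apply/row_subP => i; apply/sub_kermxP.
    have : row i (kermx (X *m Y)) *m X *m Y = 0 by rewrite -mulmxA -row_mul mulmx_ker row0.
    by case/key.
  rewrite mxrank_ker => h; rewrite -[X in (_ <= X)%N](subnKC (rank_leq_row X)).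
  by rewrite leq_add2l.
(* Evaluation at the origin, transposed because coefficients are row vectors. *)
pose B0 : 'M[C]_(m, N) := \matrix_(i, j) b i 0 j 0.
have B0E (c : 'rV[C]_m) : c *m B0 = (combination b c 0)^T.
  apply/rowP => j; rewrite mxE [RHS]mxE summxE; apply: eq_bigr => i _.
  by rewrite !mxE.
pose Mt := (eigen_mx k s mu)^T.
have e1 : (kermx X *m B0 == kermx Mt)%MS.
  apply/andP; split.
    apply/row_subP => i; rewrite row_mul; apply/sub_kermxP.
    set c := row i _.
    have /key[_ _ h] : c *m X *m Y = 0 by rewrite /c -row_mul mulmx_ker row0 mul0mx.
    by rewrite B0E /Mt -trmx_mul h trmx0.
  apply/row_subP => i; set w := row i _.
  have wM : eigen_mx k s mu *m w^T = 0.
    apply: trmx_inj; rewrite trmx_mul trmxK trmx0 -/Mt /w -row_mul mulmx_ker row0 //.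
  have [c hc] := combination_surj sb (@plane_wave_eigen R k M s mu _ wM).
  have cX : c *m X = 0.
    apply: (combination_inj0 sb'); rewrite -hX -hc.
    by apply/funext => x; exact: fiber_dirac_plane_wave.
  have -> : w = c *m B0 by rewrite B0E -hc plane_wave0 trmxK.
  by apply: submxMr; apply/sub_kermxP.
(* A plane wave is determined by its value at the origin, so evaluation is injective on the kernel
   of X and preserves its dimension. *)
have e2 : (kermx X :&: kermx B0)%MS = 0.
  apply/eqP; rewrite -submx0; apply/row_subP => i; set c := row i _.
  have cs : (c <= kermx X :&: kermx B0)%MS by exact: row_sub.
  have cX : c *m X = 0 by apply/sub_kermxP; exact: submx_trans cs (capmxSl _ _).
  have cB : c *m B0 = 0 by apply/sub_kermxP; exact: submx_trans cs (capmxSr _ _).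
  have /key[_ h _] : c *m X *m Y = 0 by rewrite cX mul0mx.
  have c0 : combination b c 0 = 0 by apply: trmx_inj; rewrite -B0E cB trmx0.
  rewrite (_ : c = 0) ?sub0mx//; apply: (combination_inj0 sb).
  by apply/funext => x; rewrite h c0 /plane_wave mulmx0.
have := mxrank_mul_ker (kermx X) B0; rewrite e2 mxrank0 addn0 mxrank_ker => <-.
by rewrite (eqmxP e1) mxrank_ker mxrank_tr.
Qed.

Lemma eigenspace_dim_symm mu m m' : mu != 0 ->
  has_dim (En mu) m -> has_dim (En (- mu)) m' ->
  (m + eigen_mx_dim k s (- mu) = m' + eigen_mx_dim k s mu)%N.
Proof.
move=> mu0 [b sb] [b' sb'].
have sbN : spans (En (- - mu)) b by rewrite opprK.
have [X hX] := fiber_dirac_matrix (sb : spans _ b) (sb' : spans _ b').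
have [Y hY] := fiber_dirac_matrix (sb' : spans _ b') sbN.
have [XY mX] := fiber_dirac_rank mu0 sb sb' hX hY.
have mu0' : - mu != 0 by rewrite oppr_eq0.
have [YX mY] := fiber_dirac_rank mu0' sb' sbN hY hX.
have := rank_leq_row X; have := rank_leq_row Y.
by rewrite -mX -mY; move: XY YX; lia.
Qed.

(** This comparison makes the sums weighted by kernel dimensions converge wherever those weighted by
    multiplicities do. *)
Lemma eigen_mx_dim_le mu m m' : mu != 0 ->
  has_dim (En mu) m -> has_dim (En (- mu)) m' -> (eigen_mx_dim k s mu <= m)%N.
Proof.
move=> mu0 [b sb] [b' sb'].
have sbN : spans (En (- - mu)) b by rewrite opprK.
have [X hX] := fiber_dirac_matrix (sb : spans _ b) (sb' : spans _ b').
have [Y hY] := fiber_dirac_matrix (sb' : spans _ b') sbN.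
have [_ <-] := fiber_dirac_rank mu0 sb sb' hX hY.
exact: leq_subr.
Qed.

End EigenspaceDimensions.

(** * Real analytic functions *)

Section RealAnalytic.
Variable R : realType.
Implicit Types (f g : R -> R) (p t x : R) (c : nat -> R).

Definition real_analytic_at f p := exists c, \forall t \near p,
  series (fun i => c i * (t - p) ^+ i) @ \oo --> f t.

Definition real_meromorphic_at f p := exists m : nat, exists2 g,
  real_analytic_at g p & \forall t \near p, t != p -> (t - p) ^+ m * f t = g t.

(** Convergence at x0 = r / 2 bounds the terms c_i x0^i by a constant B. For |x| < x0 / 2 the terms
    are then dominated by a geometric series of ratio at most 1/2, whose tail is at most twice its
    leading term. *)
Lemma power_series_remainder c (h : R -> R) (r : R) (m : nat) : 0 < r ->
  (forall x, `|x| < r -> series (fun i => c i * x ^+ i) @ \oo --> h x) ->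
  (forall i, (i < m)%N -> c i = 0) ->
  exists B d : R, [/\ 0 < d, 0 <= B & forall x, `|x| < d -> `|h x - c m * x ^+ m| <= B * `|x| ^+ m.+1].
Proof.
move=> r0 hc c0.
pose x0 := r / 2; have x00 : 0 < x0 by rewrite divr_gt0.
have x0r : `|x0| < r by rewrite gtr0_norm// ltr_pdivrMr// ltr_pMr// ltr1n.
have [B [B0 hB]] : exists B : R, 0 <= B /\ forall i, `|c i * x0 ^+ i| <= B.
  have /cvg_series_cvg_0 : cvgn (series (fun i => c i * x0 ^+ i)) by apply/cvg_ex; exists (h x0); exact: hc.
  move=> /cvgP/cvg_seq_bounded hb.
  have [B hB] := (@ex_bound _ _ _ _ _ (@globally_properfilter nat setT 0%N I)).1 hb.
  exists `|B|; split=> // i; apply: le_trans (ler_norm B); exact: hB.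
exists (2 * B / x0 ^+ m.+1), (x0 / 2); split; [by rewrite divr_gt0|by rewrite divr_ge0 ?mulr_ge0// exprn_ge0// ltW|].
move=> x xd; pose q := `|x| / x0.
have q0 : 0 <= q by rewrite divr_ge0// ltW.
have q2 : q <= 2^-1 by rewrite /q ler_pdivrMr// mulrC ltW.
have xr : `|x| < r by apply: (lt_trans xd); rewrite ltr_pdivrMr//; apply: (lt_trans (y := r)); rewrite /x0 ?ltr_pdivrMr// ?ltr_pMr ?ltr1n.
have cq i : `|c i * x ^+ i| <= B * q ^+ i.
  have -> : c i * x ^+ i = c i * x0 ^+ i * (x / x0) ^+ i.
    by rewrite -mulrA -exprMn [x0 * _]mulrC divfK ?gt_eqF.
  rewrite normrM [X in _ * X]normrX (normrM x) normfV (gtr0_norm x00) ler_wpM2r//.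
  by rewrite exprn_ge0.
have geo (a b : nat) : \sum_(a <= i < b) q ^+ i <= 2 * q ^+ a.
  have [ab|ba] := leqP a b; last by rewrite big_geq ?(ltnW ba)// mulr_ge0// exprn_ge0.
  rewrite -(subnKC ab); move: (b - a)%N => {ab}l; elim: l a => [|l IH] a.
    by rewrite addn0 big_geq// mulr_ge0// exprn_ge0.
  rewrite big_ltn; last by rewrite addnS ltnS leq_addr.
  rewrite addnS -addSn; apply: (le_trans (lerD (lexx _) (IH a.+1))).
  rewrite exprS mulrA -[X in X + _]mul1r -mulrDl ler_wpM2r ?exprn_ge0//.
  by rewrite -lerBrDl (_ : 2 - 1 = 2 * 2^-1 :> R) ?ler_pM2l// divff// addrK.
have bound (n : nat) : (m < n)%N -> `|series (fun i => c i * x ^+ i) n - c m * x ^+ m| <= 2 * B * q ^+ m.+1.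
  move=> mn; rewrite /series /= (@big_cat_nat _ _ _ m.+1)//= big_nat_recr//=.
  rewrite [X in X + _ + _]big_nat big1 ?add0r; last by move=> i /andP[_ im]; rewrite c0// mul0r.
  rewrite addrAC subrr add0r; apply: le_trans (ler_norm_sum _ _ _) _.
  apply: (@le_trans _ _ (\sum_(m.+1 <= i < n) B * q ^+ i)); first exact: ler_sum.
  by rewrite -mulr_sumr -mulrA mulrCA ler_wpM2l.
have -> : 2 * B / x0 ^+ m.+1 * `|x| ^+ m.+1 = 2 * B * q ^+ m.+1.
  by rewrite /q (expr_div_n `|x| x0) [RHS]mulrA mulrAC.
have l : `|series (fun i => c i * x ^+ i) n - c m * x ^+ m| @[n --> \oo] --> `|h x - c m * x ^+ m|.
  by apply: cvg_norm; apply: cvgB; [exact: hc|exact: cvg_cst].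
apply: (cvgr_to_le l); near=> n; apply: bound.
by near: n; exact: nbhs_infty_gt.
Unshelve. all: by end_near. Qed.

Lemma real_analytic_shift f p : real_analytic_at f p -> exists c, exists2 r : R, 0 < r &
  forall x, `|x| < r -> series (fun i => c i * x ^+ i) @ \oo --> f (x + p).
Proof.
move=> [c /nbhs_ballP[r /= r0 hr]]; exists c, r => // x xr.
have := hr (x + p); rewrite /ball /= opprD addrCA subrr addr0 normrN => /(_ xr).
by rewrite addrK.
Qed.

Lemma real_analytic_continuous f p : real_analytic_at f p -> {for p, continuous f}.
Proof.
move=> /real_analytic_shift[c [r r0 hc]].
have [//|B [d [d0 B0 hB]]] := @power_series_remainder c (fun x => f (x + p)) r 0 r0 hc.
have fp : f p = c 0.
  have := hB 0; rewrite normr0 => /(_ d0); rewrite add0r expr1 mulr0 expr0 mulr1.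
  by rewrite normr_le0 subr_eq0 => /eqP.
apply/cvgrPdist_le => e e0; have eB : 0 < e / (B + 1) by rewrite divr_gt0// ltr_wpDl.
near=> t.
have td : `|t - p| < d.
  rewrite distrC; near: t; apply: (@cvgr_dist_lt _ _ _ _ _ id p) => //; exact: cvg_id.
have := hB _ td; rewrite subrK expr0 mulr1 expr1 -fp distrC => h; apply: le_trans h _.
apply: (@le_trans _ _ ((B + 1) * `|t - p|)); first by rewrite ler_wpM2r// lerDl.
rewrite mulrC -ler_pdivlMr ?ltr_wpDl// distrC ltW//.
Unshelve. all: by end_near. Qed.

(** All the coefficients vanish, by strong induction: if those before c_m do, a zero s close to p
    gives |c_m| <= B |s - p|. *)
Lemma real_analytic_zero f p : real_analytic_at f p ->
  (forall e, 0 < e -> exists t, 0 < `|t - p| < e /\ f t = 0) ->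
  exists2 d : R, 0 < d & forall t, `|t - p| < d -> f t = 0.
Proof.
move=> /real_analytic_shift[c [r r0 hc]] acc; exists r => // t tr.
have c0 m : c m = 0.
  elim/ltn_ind: m => m IH.
  have [B [d [d0 B0 hB]]] := @power_series_remainder c (fun x => f (x + p)) r m r0 hc IH.
  apply/eqP; rewrite -normr_le0; apply/ler_addgt0Pr => e e0; rewrite add0r.
  have B1 : 0 < B + 1 by rewrite ltr_wpDl.
  have eB : 0 < Num.min d (e / (B + 1)) by rewrite lt_min d0 divr_gt0.
  have [s [/andP[s0 sd] fs]] := acc _ eB.
  move: sd; rewrite lt_min => /andP[sd se].
  have := hB _ sd; rewrite subrK fs sub0r normrN normrM normrX exprS mulrA ler_pM2r ?exprn_gt0//.
  move=> h; apply: (le_trans h); apply: (@le_trans _ _ ((B + 1) * `|s - p|)).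
    by rewrite ler_wpM2r// lerDl.
  by rewrite mulrC -ler_pdivlMr// ltW.
have := hc _ tr; rewrite subrK => l.
have E : series (fun i => c i * (t - p) ^+ i) = fun=> 0.
  by apply/funext => n; rewrite /series /= big1// => i _; rewrite c0 mul0r.
rewrite E in l; exact: (cvg_unique _ l (cvg_cst _)).
Qed.

Lemma real_meromorphic_zero f p : real_meromorphic_at f p ->
  (forall e, 0 < e -> exists t, 0 < `|t - p| < e /\ f t = 0) ->
  exists2 d : R, 0 < d & forall t, 0 < `|t - p| < d -> f t = 0.
Proof.
move=> [m [g ag /nbhs_ballP[r /= r0 hr]]] acc.
have near t : 0 < `|t - p| < r -> (t - p) ^+ m * f t = g t.
  move=> /andP[t0 tr]; apply: hr; first by rewrite /ball /= distrC.
  by rewrite -subr_eq0 -normr_gt0.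
have [|d d0 hd] := real_analytic_zero ag.
  move=> e e0; have [|t [/andP[t0 te] ft]] := acc (Num.min e r); first by rewrite lt_min e0.
  move: te; rewrite lt_min => /andP[te tr]; exists t; rewrite t0 te; split=> //.
  by rewrite -near ?t0// ft mulr0.
exists (Num.min d r) => [|t /andP[t0]]; first by rewrite lt_min d0.
rewrite lt_min => /andP[td tr].
have := near t; rewrite t0 tr hd// => /(_ isT)/eqP; rewrite mulf_eq0 expf_eq0.
by rewrite -[t - p == 0]normr_eq0 (gt_eqF t0) andbF /= => /eqP.
Qed.

(** Let m be the infimum of the p > 0 such that f vanishes on a punctured neighbourhood of every t
    >= p. If m were positive, zeros would accumulate at m from above, so f would vanish on a
    punctured neighbourhood of m as well, and p could be taken below m. Hence m = 0. Working with
    punctured neighbourhoods allows for arbitrary values at the poles. *)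
Lemma real_meromorphic_identity f (T : R) :
  (forall p, 0 < p -> real_meromorphic_at f p) -> (forall t, T < t -> f t = 0) ->
  forall e, 0 < e -> exists t, 0 < t < e /\ f t = 0.
Proof.
move=> mf fT e e0.
pose P p := exists2 d : R, 0 < d & forall t, 0 < `|t - p| < d -> f t = 0.
pose Z := [set p : R | 0 < p /\ forall t, p <= t -> P t].
have Z0 : Z (`|T| + 1).
  split=> [|t tT]; first by rewrite ltr_wpDl.
  have tT' : 0 < t - T.
    by rewrite subr_gt0; apply: lt_le_trans tT; rewrite ltr_pwDr// ler_norm.
  exists (t - T) => // u /andP[_ ut]; apply: fT.
  by move: ut; rewrite ltr_distl subKr => /andP[].
have Zlb : lbound Z 0 by move=> z [/ltW].
have Zinf : has_inf Z by split; [exists (`|T| + 1)|exists 0].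
pose m := inf Z.
have m0 : 0 <= m by apply: lb_le_inf => //; exists (`|T| + 1).
have above q : m < q -> P q.
  move=> mq; have qm0 : 0 < q - m by rewrite subr_gt0.
  have [z [z0 zP] zq] := inf_adherent qm0 Zinf.
  by apply: zP; move: zq; rewrite -/m addrC subrK => /ltW.
have pick q d : 0 < d -> P q -> exists t, q < t < q + d /\ f t = 0.
  move=> d0 [d' d'0 h]; pose x := Num.min d d' / 2.
  have x0 : 0 < x by rewrite divr_gt0// lt_min d0.
  have xm : x < Num.min d d' by rewrite ltr_pdivrMr// ltr_pMr ?ltr1n// lt_min d0.
  exists (q + x); rewrite ltrDl x0 ltrD2l; move: xm; rewrite lt_min => /andP[xd xd'].
  by split=> //; apply: h; rewrite addrAC subrr add0r gtr0_norm// x0.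
have [m_eq|m_gt] : m = 0 \/ 0 < m by move: m0; rewrite le_eqVlt => /orP[/eqP<-|]; [left|right].
  have Pe : P (e / 2) by apply: above; rewrite m_eq divr_gt0.
  have [|t [/andP[t1 t2] ft]] := pick (e / 2) (e / 2) _ Pe; first by rewrite divr_gt0.
  exists t; split=> //; rewrite (lt_trans _ t1) ?divr_gt0//=.
  by move: t2; rewrite -splitr.
have [d d0 hd] : P m.
  apply: real_meromorphic_zero; first exact: mf.
  move=> d d0; have Pq : P (m + d / 2) by apply: above; rewrite ltrDl divr_gt0.
  have [|t [/andP[t1 t2] ft]] := pick _ (d / 2) _ Pq; first by rewrite divr_gt0.
  exists t; split=> //; have mt : m < t by apply: lt_trans t1; rewrite ltrDl divr_gt0.
  rewrite gtr0_norm ?subr_gt0// mt ltrBlDl (lt_le_trans t2)// -addrA -splitr//.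
(* A point below m that is within reach of the punctured neighbourhood of m and still positive. *)
pose q := Num.max (m - d / 2) (m / 2).
have qm : q < m by rewrite gt_max gtrBl divr_gt0//= ltr_pdivrMr// ltr_pMr// ltr1n.
suff : Z q by move=> /(ge_inf Zinf.2); rewrite leNgt qm.
split=> [|t qt]; first by rewrite lt_max [0 < m / 2]divr_gt0 ?orbT.
case: (ltgtP t m) => [tm|mt|->]; [|exact: above|by exists d].
have dt : d / 2 < d by rewrite ltr_pdivrMr// ltr_pMr// ltr1n.
have mt : m - d < t by apply: lt_le_trans qt; rewrite lt_max ltrD2l ltrN2 dt.
exists (Num.min (m - t) (t - (m - d))) => [|u /andP[_]]; first by rewrite lt_min !subr_gt0 tm.
rewrite lt_min !ltr_distl => /andP[/andP[_ h1] /andP[h2 _]].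
have um : u < m by move: h1; rewrite addrC subrK.
apply: hd; rewrite ltr0_norm ?subr_lt0// opprB subr_gt0 um /= ltrBlDl -ltrBlDr.
by rewrite -[m - d](subKr t).
Qed.

End RealAnalytic.

Section RealAnalyticClosure.
Variable R : realType.
Implicit Types (f g : R -> R) (p t x : R).

Lemma real_analyticB f g p : real_analytic_at f p -> real_analytic_at g p ->
  real_analytic_at (fun t => f t - g t) p.
Proof.
move=> [c hc] [d hd]; exists (fun i => c i - d i).
apply: filterS2 hc hd => t hc hd.
have -> : series (fun i => (c i - d i) * (t - p) ^+ i) =
    (fun n => series (fun i => c i * (t - p) ^+ i) n - series (fun i => d i * (t - p) ^+ i) n).
  by apply/funext => n; rewrite /series /= -sumrB; apply: eq_bigr => i _; rewrite mulrBl.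
exact: cvgB.
Qed.

Lemma real_analyticD f g p : real_analytic_at f p -> real_analytic_at g p ->
  real_analytic_at (fun t => f t + g t) p.
Proof.
move=> [c hc] [d hd]; exists (fun i => c i + d i).
apply: filterS2 hc hd => t hc hd.
have -> : series (fun i => (c i + d i) * (t - p) ^+ i) =
    (fun n => series (fun i => c i * (t - p) ^+ i) n + series (fun i => d i * (t - p) ^+ i) n).
  by apply/funext => n; rewrite /series /= -big_split; apply: eq_bigr => i _; rewrite mulrDl.
exact: cvgD.
Qed.

Lemma real_analyticZ f p (a : R) : real_analytic_at f p -> real_analytic_at (fun t => a * f t) p.
Proof.
move=> [c hc]; exists (fun i => a * c i).
apply: filterS hc => t hc.
have -> : series (fun i => a * c i * (t - p) ^+ i) = (fun n => a * series (fun i => c i * (t - p) ^+ i) n).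
  by apply/funext => n; rewrite /series /= mulr_sumr; apply: eq_bigr => i _; rewrite mulrA.
exact: (cvgM (cvg_cst a) hc).
Qed.

Lemma real_analytic0 p : real_analytic_at (fun=> 0) p.
Proof.
exists (fun=> 0); near=> t.
have -> : series (fun i => 0 * (t - p) ^+ i) = (fun=> 0).
  by apply/funext => n; rewrite /series /= big1// => i _; rewrite mul0r.
exact: cvg_cst.
Unshelve. all: by end_near. Qed.

Lemma real_analytic_sum (I : Type) (r : seq I) (F : I -> R -> R) p :
  (forall i, real_analytic_at (F i) p) -> real_analytic_at (fun t => \sum_(i <- r) F i t) p.
Proof.
move=> aF; elim: r => [|i r IH].
  by under eq_fun do rewrite big_nil; exact: real_analytic0.
by under eq_fun do rewrite big_cons; exact: real_analyticD.
Qed.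

(** This brings two functions with poles of different orders at p to a common denominator. *)
Lemma real_analytic_shiftX f p m : real_analytic_at f p ->
  real_analytic_at (fun t => (t - p) ^+ m * f t) p.
Proof.
move=> af; elim: m => [|m [c hc]].
  by under eq_fun do rewrite expr0 mul1r.
exists (fun i => if i is i'.+1 then c i' else 0); apply: filterS hc => t hc.
rewrite -cvg_shiftS exprS -mulrA.
have -> : (fun n => series (fun i => (if i is i'.+1 then c i' else 0) * (t - p) ^+ i) n.+1)
    = (fun n => (t - p) * series (fun i => c i * (t - p) ^+ i) n).
  apply/funext => n; rewrite /series /= big_nat_recl// mul0r add0r mulr_sumr.
  by apply: eq_bigr => i _; rewrite exprS mulrCA.
exact: (cvgM (cvg_cst (t - p)) hc).
Qed.

Lemma real_meromorphicB f g p : real_meromorphic_at f p -> real_meromorphic_at g p ->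
  real_meromorphic_at (fun t => f t - g t) p.
Proof.
move=> [m [F aF hF]] [l [G aG hG]]; exists (l + m)%N.
exists (fun t => (t - p) ^+ l * F t - (t - p) ^+ m * G t).
  by apply: real_analyticB; exact: real_analytic_shiftX.
apply: filterS2 hF hG => t hF hG tp; rewrite -hF// -hG// mulrBr !mulrA -!exprD.
by rewrite addnC.
Qed.

Lemma real_analytic_meromorphic f p : real_analytic_at f p -> real_meromorphic_at f p.
Proof.
by move=> af; exists 0%N, f => //; near=> t => _; rewrite expr0 mul1r.
Unshelve. all: by end_near. Qed.

(** * Restriction of complex analytic and meromorphic functions to the real axis *)

Local Notation C := R[i].

Lemma abs_Re_le (z : C) : `|complex.Re z|%:C <= `|z|.
Proof. by rewrite normc_def lecR -sqrtr_sqr ler_wsqrtr// lerDl sqr_ge0. Qed.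

Lemma abs_Im_le (z : C) : `|complex.Im z|%:C <= `|z|.
Proof. by rewrite normc_def lecR -sqrtr_sqr ler_wsqrtr// lerDr sqr_ge0. Qed.

Lemma abs_real_complex (x : R) : `|x%:C : C| = `|x|%:C.
Proof. by rewrite normc_def /= expr0n addr0 sqrtr_sqr. Qed.

Lemma cvg_Re (u : nat -> C) (l : C) : u @ \oo --> (l : C^o) ->
  complex.Re (u n) @[n --> \oo] --> complex.Re l.
Proof.
move=> /(@cvgrPdist_lt C C^o nat \oo _ u l).1 h; apply/cvgrPdist_lt => e e0.
have e0' : 0 < (e%:C : C) by rewrite ltcR.
apply: filterS (h _ e0') => n hn; rewrite -ltcR; apply: le_lt_trans hn.
by apply: le_trans (abs_Re_le _); case: (l) (u n) => a b [a' b'].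
Qed.

Lemma cvg_Im (u : nat -> C) (l : C) : u @ \oo --> (l : C^o) ->
  complex.Im (u n) @[n --> \oo] --> complex.Im l.
Proof.
move=> /(@cvgrPdist_lt C C^o nat \oo _ u l).1 h; apply/cvgrPdist_lt => e e0.
have e0' : 0 < (e%:C : C) by rewrite ltcR.
apply: filterS (h _ e0') => n hn; rewrite -ltcR; apply: le_lt_trans hn.
by apply: le_trans (abs_Im_le _); case: (l) (u n) => a b [a' b'].
Qed.

Lemma near_real (p : R) (P : C -> Prop) :
  (\forall z \near (p%:C : C^o), P z) -> \forall t \near p, P t%:C.
Proof.
move=> /nbhs_ballP[e /= e0 he].
have := e0; rewrite ltcE /= => /andP[/eqP im0 re0].
apply/nbhs_ballP; exists (complex.Re e) => //= t; rewrite /ball /= => pt.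
apply: he; rewrite /ball /= -rmorphB abs_real_complex.
by case: (e) im0 pt => a b /= -> pt; rewrite ltcR.
Qed.

Lemma Re_series (u : nat -> C) n : complex.Re (series u n) = series (fun i => complex.Re (u i)) n.
Proof. by rewrite /series /=; elim/big_rec2: _ => // i y1 y2 _ <-; exact: ReD. Qed.

Lemma Im_series (u : nat -> C) n : complex.Im (series u n) = series (fun i => complex.Im (u i)) n.
Proof. by rewrite /series /=; elim/big_rec2: _ => // i y1 y2 _ <-; exact: ImD. Qed.

Lemma Re_mulr (z : C) (x : R) : complex.Re (z * x%:C) = complex.Re z * x.
Proof. by case: z => a b; rewrite /= mulr0 subr0. Qed.

Lemma Im_mulr (z : C) (x : R) : complex.Im (z * x%:C) = complex.Im z * x.
Proof. by case: z => a b; rewrite /= mulr0 add0r. Qed.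

Lemma analytic_Re (F : C -> C) p : analytic_at F p%:C ->
  real_analytic_at (fun t => complex.Re (F t%:C)) p.
Proof.
move=> [c /near_real hc]; exists (fun i => complex.Re (c i)).
apply: filterS hc => t /cvg_Re.
have -> // : (fun n => complex.Re (series (fun i => c i * (t%:C - p%:C) ^+ i) n))
  = series (fun i => complex.Re (c i) * (t - p) ^+ i).
apply/funext => n; rewrite Re_series; apply: eq_bigr => i _.
by rewrite -rmorphB -rmorphXn Re_mulr.
Qed.

Lemma analytic_Im (F : C -> C) p : analytic_at F p%:C ->
  real_analytic_at (fun t => complex.Im (F t%:C)) p.
Proof.
move=> [c /near_real hc]; exists (fun i => complex.Im (c i)).
apply: filterS hc => t /cvg_Im.
have -> // : (fun n => complex.Im (series (fun i => c i * (t%:C - p%:C) ^+ i) n))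
  = series (fun i => complex.Im (c i) * (t - p) ^+ i).
apply/funext => n; rewrite Im_series; apply: eq_bigr => i _.
by rewrite -rmorphB -rmorphXn Im_mulr.
Qed.

Lemma meromorphic_Re (F : C -> C) p : meromorphic_at F p%:C ->
  real_meromorphic_at (fun t => complex.Re (F t%:C)) p.
Proof.
move=> [m [G aG /near_real h]]; exists m, (fun t => complex.Re (G t%:C)); first exact: analytic_Re.
apply: filterS h => t h tp; rewrite -h ?(inj_eq (@complexI R))//.
by rewrite -rmorphB -rmorphXn mulrC [RHS](congr1 (@complex.Re R) (mulrC _ _)) Re_mulr.
Qed.

Lemma meromorphic_Im (F : C -> C) p : meromorphic_at F p%:C ->
  real_meromorphic_at (fun t => complex.Im (F t%:C)) p.
Proof.
move=> [m [G aG /near_real h]]; exists m, (fun t => complex.Im (G t%:C)); first exact: analytic_Im.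
apply: filterS h => t h tp; rewrite -h ?(inj_eq (@complexI R))//.
by rewrite -rmorphB -rmorphXn mulrC [RHS](congr1 (@complex.Im R) (mulrC _ _)) Im_mulr.
Qed.

End RealAnalyticClosure.

(** * Alternating sums of exponentials *)

Section SeriesEstimates.
Variable R : realType.

Lemma cvg_series_le (u B : nat -> R) : (forall q, `|u q| <= B q) ->
  cvgn (series B) -> cvgn (series u).
Proof.
move=> uB cB; apply: normed_cvg.
have B0 q : 0 <= B q by apply: le_trans (uB q).
exact: (@series_le_cvg _ (fun q => `|u q|) B (fun q => normr_ge0 _) B0 uB cB).
Qed.

(* Tannery's theorem *)
Lemma double_series (c : nat -> nat -> R) (B S : nat -> R) :
  (forall q N, \sum_(0 <= i < N) `|c q i| <= B q) -> cvgn (series B) ->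
  (forall q, series (c q) @ \oo --> S q) ->
  series (fun i => limn (series (fun q => c q i))) @ \oo --> limn (series S).
Proof.
move=> cB cvB cS.
have B0 q : 0 <= B q by have := cB q 0%N; rewrite big_geq.
have sB q N : `|series (c q) N| <= B q by apply: le_trans (ler_norm_sum _ _ _) (cB q N).
have SB q : `|S q| <= B q.
  apply: (cvgr_to_le (cvg_norm (cS q))); near=> N; exact: sB.
have c1B q i : `|c q i| <= B q.
  have h : `|c q i| <= \sum_(0 <= j < i.+1) `|c q j|.
    by rewrite big_nat_recr//= lerDr; exact: sumr_ge0.
  exact: le_trans h (cB q i.+1).
have cvS := cvg_series_le SB cvB.
have cvc i := cvg_series_le (c1B^~ i) cvB.
have lc N : \sum_(0 <= q < Q) series (c q) N @[Q --> \oo] -->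
    series (fun i => limn (series (fun q => c q i))) N.
  have -> : (fun Q => \sum_(0 <= q < Q) series (c q) N)
     = (fun Q => \sum_(0 <= i < N) series (fun q => c q i) Q).
    by apply/funext => Q; rewrite /series /= exchange_big.
  rewrite /series /=; elim: N => [|N IH].
    under eq_fun do rewrite big_geq//.
    rewrite big_geq//; exact: cvg_cst.
  under eq_fun do rewrite big_nat_recr//=.
  rewrite big_nat_recr//=; apply: cvgD; first exact: IH.
  exact: cvc.
apply/cvgrPdist_le => e e0.
have e4 : 0 < e / 4 by rewrite divr_gt0.
pose Bs := limn (series B).
have ndB : nondecreasing_seq (series B) by apply: nondecreasing_series => q _ _; exact: B0.
have BsQ Q : series B Q <= Bs by exact: nondecreasing_cvgn_le.
have [Q0 hQ0] : exists Q0, Bs - series B Q0 < e / 4.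
  have /cvgrPdist_lt/(_ _ e4)[Q0 _ h] := cvB.
  exists Q0; apply: le_lt_trans (ler_norm _) _; exact: (h Q0 (leqnn Q0)).
have l0 : \sum_(0 <= q < Q0) `|S q - series (c q) N| @[N --> \oo] --> (0 : R).
  elim: Q0 {hQ0} => [|Q IH].
    under eq_fun do rewrite big_geq//.
    exact: cvg_cst.
  under eq_fun do rewrite big_nat_recr//=.
  have h1 : `|S Q - series (c Q) N| @[N --> \oo] --> `|S Q - S Q|.
    by apply: cvg_norm; apply: cvgB; [exact: cvg_cst|exact: cS].
  by rewrite subrr normr0 in h1; have := cvgD IH h1; rewrite (addr0 (0 : R)); exact.
have /cvgr0Pnorm_lt/(_ _ e4) hn := l0.
near=> N.
have hN : \sum_(0 <= q < Q0) `|S q - series (c q) N| < e / 4.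
  apply: le_lt_trans (ler_norm _) _; near: N; exact: hn.
have lD : `|series S Q - \sum_(0 <= q < Q) series (c q) N| @[Q --> \oo] -->
    `|limn (series S) - series (fun i => limn (series (fun q => c q i))) N|.
  by apply: cvg_norm; apply: cvgB; [exact: cvS|exact: lc].
apply: (cvgr_to_le lD); near=> Q.
have QQ : (Q0 <= Q)%N by near: Q; exact: nbhs_infty_ge.
rewrite /series /= -sumrB (@big_cat_nat _ _ _ Q0)//=.
apply: le_trans (ler_normD _ _) _.
apply: (@le_trans _ _ (e / 4 + 2 * (e / 4))); last by lra.
apply: lerD; first by apply: le_trans (ler_norm_sum _ _ _) (ltW hN).
apply: le_trans (ler_norm_sum _ _ _) _.
apply: (@le_trans _ _ (\sum_(Q0 <= q < Q) 2 * B q)).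
  apply: ler_sum => q _; apply: le_trans (ler_normB _ _) _.
  by rewrite mulr_natl mulr2n; apply: lerD; [exact: SB|exact: sB].
rewrite -mulr_sumr ler_wpM2l//.
apply: le_trans (ltW hQ0).
have := BsQ Q; rewrite /series /= (@big_cat_nat _ _ _ Q0 0 Q)//= => h.
by rewrite lerBrDl.
Unshelve. all: by end_near. Qed.

Lemma exp_partial_le (x : R) N : 0 <= x -> \sum_(0 <= i < N) x ^+ i / i`!%:R <= expR x.
Proof.
move=> x0; have nd : nondecreasing_seq (series (exp_coeff x)).
  by apply: nondecreasing_series => q _ _; exact: exp_coeff_ge0.
have := nondecreasing_cvgn_le nd (is_cvg_series_exp_coeff x) N.
by rewrite /series /= /exp_coeff /expR.
Qed.

Lemma exp_diff_le (p A B : R) : 0 <= p -> A <= B ->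
  `|expR (- p * A) - expR (- p * B)| <= expR (- p * A) * (p * (B - A)).
Proof.
move=> p0 AB; rewrite ger0_norm; last by rewrite subr_ge0 ler_expR !mulNr lerN2 ler_wpM2l.
have -> : - p * B = - p * A + - (p * (B - A)) by ring.
rewrite expRD -{1}[expR _]mulr1 -mulrBr ler_wpM2l ?expR_ge0// lerBlDr -lerBlDl.
exact: expR_ge1Dx.
Qed.

Lemma pow_diff_le (A B L : R) i : `|A| <= L -> `|B| <= L ->
  `|B ^+ i - A ^+ i| <= `|B - A| * (i%:R * L ^+ i.-1).
Proof.
move=> AL BL; rewrite subrXX normrM ler_wpM2l//; apply: le_trans (ler_norm_sum _ _ _) _.
apply: (@le_trans _ _ (\sum_(j < i) L ^+ i.-1)); last by rewrite sumr_const card_ord mulr_natl.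
have L0 : 0 <= L by exact: le_trans (normr_ge0 _) AL.
apply: ler_sum => j _; rewrite normrM !normrX.
have ij : (i.-1 = (i.-1 - j) + j)%N by rewrite subnK//; have := ltn_ord j; lia.
rewrite [X in _ <= _ ^+ X]ij exprD.
by apply: ler_pM; rewrite ?exprn_ge0// lerXn2r// nnegrE.
Qed.

End SeriesEstimates.

(** * Alternating sums of exp(- t u_j): analyticity for t > 0 and limit at 0+ *)

Section AlternatingExponentialSums.
Variables (R : realType) (u : nat -> R) (H M : R).
Hypothesis u_incr : forall j, u j <= u j.+1.
Hypothesis u_gap : forall j, u j.+1 - u j <= H.
Hypothesis u_abs : forall j, `|u j| <= u j + M.

Let f t j : R := expR (- t * u j).
Let g t q : R := f t q.*2 - f t q.*2.+1.

(** The alternating series of the exp(- t u_j), grouped in consecutive pairs: for t > 0 the grouped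
    terms are nonnegative and their partial sums stay below the first exponential. *)
Definition alt_sum t : R := limn (series (g t)).

Lemma exp_term_decr t j : 0 < t -> f t j.+1 <= f t j.
Proof. by move=> t0; rewrite ler_expR !mulNr lerN2 ler_pM2l. Qed.

Lemma exp_gap_ge0 t q : 0 < t -> 0 <= g t q.
Proof. by move=> t0; rewrite subr_ge0 exp_term_decr. Qed.

Lemma series_exp_gap_le t N : 0 < t -> series (g t) N <= f t 0 - f t N.*2.
Proof.
move=> t0; rewrite /series /=; elim: N => [|N IH]; first by rewrite big_geq// subrr.
rewrite big_nat_recr//= doubleS; apply: le_trans (lerD IH (lexx _)) _.
rewrite /g addrA subrK lerD2l lerN2; exact: exp_term_decr.
Qed.

Lemma is_cvg_alt_sum t : 0 < t -> cvgn (series (g t)).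
Proof.
move=> t0; apply: nondecreasing_is_cvgn.
  by apply: nondecreasing_series => q _ _; exact: exp_gap_ge0.
exists (f t 0) => _ [N _ <-]; apply: le_trans (series_exp_gap_le N t0) _.
by rewrite gerBl expR_ge0.
Qed.

(** The i-th Taylor coefficient at p of the q-th pair, as a function of t. *)
Let co p q i : R :=
  (expR (- p * u q.*2) * (- u q.*2) ^+ i - expR (- p * u q.*2.+1) * (- u q.*2.+1) ^+ i) / i`!%:R.

Lemma gap_coef_series p s q : series (fun i => co p q i * s ^+ i) @ \oo --> g (p + s) q.
Proof.
have E A : series (fun i => expR (- p * A) * (- A) ^+ i / i`!%:R * s ^+ i) @ \oo --> expR (- (p + s) * A).
  have -> : series (fun i => expR (- p * A) * (- A) ^+ i / i`!%:R * s ^+ i)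
     = (fun n => expR (- p * A) * series (exp_coeff (- s * A)) n).
    apply/funext => n; rewrite /series /= mulr_sumr; apply: eq_bigr => i _.
    rewrite /exp_coeff /= -!mulrA; congr (_ * _); rewrite mulNr -mulrN exprMn.
    by rewrite [X in _ * X]mulrC mulrA [_ * s ^+ i]mulrC.
  have -> : expR (- (p + s) * A) = expR (- p * A) * expR (- s * A).
    by rewrite -expRD; congr expR; ring.
  apply: cvgM; first exact: cvg_cst.
  exact: is_cvg_series_exp_coeff.
have -> : series (fun i => co p q i * s ^+ i) =
  (fun n => series (fun i => expR (- p * u q.*2) * (- u q.*2) ^+ i / i`!%:R * s ^+ i) n
     - series (fun i => expR (- p * u q.*2.+1) * (- u q.*2.+1) ^+ i / i`!%:R * s ^+ i) n).
  apply/funext => n; rewrite /series /= -sumrB; apply: eq_bigr => i _.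
  by rewrite /co !mulrBl.
exact: cvgB.
Qed.

(** A summable majorant, uniform on the interval of radius rho = p / 2, as [double_series] requires.
    The absolute Taylor series of the exponential costs a factor of order exp(rho u), which leaves
    exp(- rho u) out of exp(- p u). The differences within a pair provide the factor eta = B - A,
    and exp(- rho A) eta is bounded by a multiple of the pair [g rho q], a term of a convergent
    series. *)
Lemma gap_coef_bound (p rho s : R) q N : 0 < rho -> p = 2 * rho -> `|s| <= rho ->
  \sum_(0 <= i < N) `|co p q i * s ^+ i| <=
  (p + rho) * expR (rho * (M + H)) * (expR (rho * H) / rho) * g rho q.
Proof.
move=> r0 pr sr.
pose A := u q.*2; pose B := u q.*2.+1; pose eta := B - A; pose L := `|A| + eta.
have p0 : 0 <= p by rewrite pr mulr_ge0// ltW.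
have AB : A <= B by exact: u_incr.
have eta0 : 0 <= eta by rewrite subr_ge0.
have L0 : 0 <= L by rewrite addr_ge0.
have AL : `|- A| <= L by rewrite normrN lerDl.
have BL : `|- B| <= L.
  rewrite normrN -(subrK A B) addrC; apply: le_trans (ler_normD _ _) _.
  by rewrite lerD2l ger0_norm.
(* The difference of exponentials is at most p eta exp(- p A), and the difference of i-th powers at
   most eta i L^(i-1); both contain eta. *)
have bi i : `|co p q i * s ^+ i| <=
    expR (- p * A) * eta * ((p * L ^+ i + i%:R * L ^+ i.-1) / i`!%:R * rho ^+ i).
  rewrite normrM normrX mulrA; apply: ler_pM => //; rewrite ?exprn_ge0//; last by rewrite lerXn2r// nnegrE ltW.
  rewrite /co normrM normfV normr_nat mulrA ler_wpM2r ?invr_ge0//.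
  have -> : expR (- p * A) * (- A) ^+ i - expR (- p * B) * (- B) ^+ i =
     (expR (- p * A) - expR (- p * B)) * (- A) ^+ i - expR (- p * B) * ((- B) ^+ i - (- A) ^+ i) by ring.
  apply: le_trans (ler_normB _ _) _; rewrite [X in _ <= X]mulrDr; apply: lerD.
    rewrite normrM normrX.
    have -> : expR (- p * A) * eta * (p * L ^+ i) = expR (- p * A) * (p * (B - A)) * L ^+ i by rewrite /eta; ring.
    by apply: ler_pM; rewrite ?exprn_ge0// ?exp_diff_le// lerXn2r// nnegrE.
  rewrite normrM (ger0_norm (expR_ge0 _)) -mulrA; apply: ler_pM; rewrite ?expR_ge0//.
    by rewrite ler_expR !mulNr lerN2 ler_wpM2l.
  apply: le_trans (pow_diff_le i AL BL) _.
  by rewrite opprK addrC -normrN opprB ger0_norm.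
apply: le_trans (ler_sum _ (fun i _ => bi i)) _.
rewrite -mulr_sumr.
have S1 : \sum_(0 <= i < N) (p * L ^+ i + i%:R * L ^+ i.-1) / i`!%:R * rho ^+ i
    <= (p + rho) * expR (rho * L).
  have Er : 0 <= rho * L by rewrite mulr_ge0// ltW.
  have -> : \sum_(0 <= i < N) (p * L ^+ i + i%:R * L ^+ i.-1) / i`!%:R * rho ^+ i =
     p * \sum_(0 <= i < N) (rho * L) ^+ i / i`!%:R + \sum_(0 <= i < N) i%:R * L ^+ i.-1 / i`!%:R * rho ^+ i.
    rewrite mulr_sumr -big_split; apply: eq_bigr => i _ /=.
    by rewrite exprMn; move: (i`!%:R^-1) (L ^+ i) (L ^+ i.-1) (rho ^+ i) => a b c d; ring.
  rewrite mulrDl; apply: lerD; first by rewrite ler_wpM2l// exp_partial_le.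
  case: N => [|N]; first by rewrite big_geq// mulr_ge0 ?expR_ge0// ltW.
  rewrite big_nat_recl// !mul0r add0r.
  have -> : \sum_(0 <= i < N) i.+1%:R * L ^+ i / (i.+1)`!%:R * rho ^+ i.+1 =
      rho * \sum_(0 <= i < N) (rho * L) ^+ i / i`!%:R.
    rewrite mulr_sumr; apply: eq_bigr => i _; rewrite factS natrM invfM exprS exprMn.
    rewrite [i.+1%:R * _ * _]mulrACA divff ?pnatr_eq0// mul1r.
    by move: (i`!%:R^-1) (L ^+ i) (rho ^+ i) => a b c; ring.
  by rewrite ler_wpM2l ?exp_partial_le// ltW.
apply: (@le_trans _ _ (expR (- p * A) * eta * ((p + rho) * expR (rho * L)))).
  by rewrite ler_wpM2l// mulr_ge0// expR_ge0.
have pr0 : 0 <= p + rho by rewrite addr_ge0// ltW.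
have LH : L <= A + (M + H).
  by rewrite addrA; apply: lerD; [exact: u_abs|exact: u_gap].
have e1 : expR (rho * L) <= expR (rho * A) * expR (rho * (M + H)).
  by rewrite -expRD -mulrDr ler_expR ler_pM2l.
have e2 : expR (- p * A) * expR (rho * A) = expR (- rho * A).
  by rewrite -expRD; congr expR; rewrite pr; ring.
(* From rho eta <= exp(rho eta) - 1, while passing from exp(- rho A) to exp(- rho B) costs at most
   exp(rho H). *)
have e3 : expR (- rho * A) * eta <= (expR (rho * H) / rho) * g rho q.
  rewrite mulrAC ler_pdivlMr//.
  have -> : g rho q = expR (- rho * B) * (expR (rho * eta) - 1).
    rewrite /g /f -/A -/B mulrBr mulr1 -expRD; congr (expR _ - _).
    by rewrite /eta; ring.
  have h1 : rho * eta <= expR (rho * eta) - 1 by rewrite lerBrDl; exact: expR_ge1Dx.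
  have h2 : expR (- rho * A) <= expR (rho * H) * expR (- rho * B).
    rewrite -expRD ler_expR -lerBlDr !mulNr opprK addrC -mulrBr ler_pM2l//.
    exact: u_gap.
  have -> : expR (- rho * A) * eta * rho = expR (- rho * A) * (rho * eta) by ring.
  rewrite [X in _ <= X]mulrA.
  by apply: ler_pM; rewrite ?expR_ge0// mulr_ge0// ltW.
apply: (@le_trans _ _ ((p + rho) * expR (rho * (M + H)) * (expR (- rho * A) * eta))).
  rewrite -e2.
  have -> : expR (- p * A) * eta * ((p + rho) * expR (rho * L)) =
     ((p + rho) * (expR (- p * A) * eta)) * expR (rho * L) by ring.
  have -> : (p + rho) * expR (rho * (M + H)) * (expR (- p * A) * expR (rho * A) * eta) =
     ((p + rho) * (expR (- p * A) * eta)) * (expR (rho * A) * expR (rho * (M + H))) by ring.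
  by rewrite ler_wpM2l// mulr_ge0// mulr_ge0// expR_ge0.
by rewrite -[X in _ <= X]mulrA ler_wpM2l// mulr_ge0// expR_ge0.
Qed.

(** The pairs are expanded at p and the two summations are interchanged; the coefficients of the sum
    are the sums over q of the Taylor coefficients. *)
Lemma real_analytic_alt_sum p : 0 < p -> real_analytic_at alt_sum p.
Proof.
move=> p0; pose rho := p / 2; have r0 : 0 < rho by rewrite divr_gt0.
have pr : p = 2 * rho by rewrite mulrC divfK.
pose K := (p + rho) * expR (rho * (M + H)) * (expR (rho * H) / rho).
have cK : cvgn (series (fun q => K * g rho q)).
  have -> : series (fun q => K * g rho q) = (fun n => K * series (g rho) n).
    by apply/funext => n; rewrite /series /= mulr_sumr.
  exact: (cvgP _ (cvgM (cvg_cst K) (is_cvg_alt_sum r0))).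
have cB s q N : `|s| <= rho -> \sum_(0 <= i < N) `|co p q i * s ^+ i| <= K * g rho q.
  by move=> sr; exact: gap_coef_bound.
have cvco i : cvgn (series (fun q => co p q i)).
  have b q : `|co p q i| <= (rho ^+ i)^-1 * (K * g rho q).
    rewrite mulrC ler_pdivlMr ?exprn_gt0//.
    have rr : `|rho| <= rho by rewrite gtr0_norm.
    have h : `|co p q i * rho ^+ i| <= \sum_(0 <= j < i.+1) `|co p q j * rho ^+ j|.
      by rewrite big_nat_recr//= lerDr; exact: sumr_ge0.
    apply: le_trans (le_trans h (cB rho q i.+1 rr)).
    by rewrite (normrM (co p q i)) (ger0_norm (exprn_ge0 i (ltW r0))).
  apply: (cvg_series_le b).
  have -> : series (fun q => (rho ^+ i)^-1 * (K * g rho q)) = (fun n => (rho ^+ i)^-1 * series (fun q => K * g rho q) n).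
    by apply/funext => n; rewrite /series /= mulr_sumr.
  exact: (cvgP _ (cvgM (cvg_cst _) cK)).
exists (fun i => limn (series (fun q => co p q i))).
apply/nbhs_ballP; exists rho => //= t; rewrite /ball /= distrC => tr.
have := double_series (fun q N => cB (t - p) q N (ltW tr)) cK (fun q => @gap_coef_series p (t - p) q).
rewrite [p + (t - p)]addrC subrK -/(alt_sum t).
have -> // : (fun i => limn (series (fun q => co p q i * (t - p) ^+ i))) =
   (fun i => limn (series (fun q => co p q i)) * (t - p) ^+ i).
apply/funext => i; apply/cvg_lim => //.
have -> : series (fun q => co p q i * (t - p) ^+ i) = (fun n => series (fun q => co p q i) n * (t - p) ^+ i).
  by apply/funext => n; rewrite /series /= mulr_suml.
by apply: cvgM; [exact: cvco|exact: cvg_cst].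
Qed.

Hypothesis u_mid : forall j, u j + u j.+2 <= 2 * u j.+1.
Hypothesis u_unbounded : forall B : R, exists j, B < u j.

(** Concavity of u gives f_(j+1) <= x y, where x and y are the square roots of f_j and f_(j+2), and
    2 x y <= x^2 + y^2. *)
Lemma exp_term_convex t j : 0 < t -> 2 * f t j.+1 <= f t j + f t j.+2.
Proof.
move=> t0; pose x := expR (- t * u j / 2); pose y := expR (- t * u j.+2 / 2).
have -> : f t j = x ^+ 2 by rewrite /f expr2 -expRD -splitr.
have -> : f t j.+2 = y ^+ 2 by rewrite /f expr2 -expRD -splitr.
have xy : f t j.+1 <= x * y.
  rewrite -expRD ler_expR -mulrDl -mulrDr !mulNr lerN2 ler_pdivrMr// -mulrA ler_pM2l//.
  by rewrite [u j.+1 * _]mulrC; exact: u_mid.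
apply: (@le_trans _ _ (2 * (x * y))); first by rewrite ler_pM2l.
by rewrite -subr_ge0 (_ : _ - _ = (x - y) ^+ 2) ?sqr_ge0//; ring.
Qed.

(** Convexity places the pair f_(2q) - f_(2q+1) above half of f_(2q) - f_(2q+2) and, for q > 0,
    below half of f_(2q-1) - f_(2q+1). Both bounds telescope, and the lower one loses a remainder
    that tends to 0 because u is unbounded. *)
Lemma alt_sum_bounds t : 0 < t ->
  f t 0 / 2 <= alt_sum t <= f t 0 - f t 1 / 2.
Proof.
move=> t0; have nd : nondecreasing_seq (series (g t)).
  by apply: nondecreasing_series => q _ _; exact: exp_gap_ge0.
have lo N : f t 0 / 2 - f t N.*2 / 2 <= series (g t) N.
  rewrite /series /=; elim: N => [|N IH]; first by rewrite big_geq// subrr.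
  rewrite big_nat_recr//= doubleS /g; have := exp_term_convex N.*2 t0; move: IH.
  by move: (\sum_(_ <= _ < _) _) (f t _) (f t _) (f t _) (f t _) => a b c d e; lra.
have hi N : series (g t) N.+1 <= f t 0 - f t 1 / 2 - f t N.*2.+1 / 2.
  rewrite /series /=; elim: N => [|N IH]; first by rewrite big_nat1 /g; lra.
  rewrite big_nat_recr//=; move: IH; rewrite doubleS /g; have := exp_term_convex N.*2.+1 t0.
  by move: (\sum_(_ <= _ < _) _) (f t _) (f t _) (f t _) (f t _) => a b c d e; lra.
apply/andP; split.
  apply/ler_addgt0Pr => e e0.
  have [j hj] := u_unbounded (- ln e / t).
  have fe : f t j < e.
    rewrite /f -[X in _ < X]lnK ?posrE// ltr_expR mulNr ltrNl.
    by move: hj; rewrite ltr_pdivrMr// mulrC.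
  have f2 : f t j.*2 <= f t j.
    rewrite -addnn; elim: (X in f t (X + j)%N) => [|l IH]; first by rewrite add0n.
    by rewrite addSn; apply: le_trans (exp_term_decr _ t0) IH.
  have h1 := lo j; have h2 := nondecreasing_cvgn_le nd (is_cvg_alt_sum t0) j.
  have f0 : 0 <= f t j.*2 by exact: expR_ge0.
  move: h1 h2 f2 fe f0; rewrite -/(alt_sum t).
  by move: (series _ _) (alt_sum t) (f t 0) (f t j) (f t j.*2) => a b c d x; lra.
apply: limr_le; first exact: is_cvg_alt_sum.
near=> N; have N0 : (0 < N)%N by near: N; exact: nbhs_infty_gt.
rewrite -(prednK N0); apply: le_trans (hi _) _.
by rewrite gerBl divr_ge0// expR_ge0.
Unshelve. all: by end_near. Qed.

Lemma alt_sum_half e : 0 < e -> exists2 d, 0 < d & forall t, 0 < t < d -> `|alt_sum t - 2^-1| <= e.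
Proof.
move=> e0.
have lf j : f t j @[t --> (0 : R)] --> (1 : R).
  have : {for 0, continuous (fun t : R => expR (- t * u j))}.
    apply: continuous_comp; last exact: continuous_expR.
    apply: continuousM; last exact: cvg_cst.
    exact: continuousN.
  by rewrite /prop_for /continuous_at oppr0 mul0r expR0.
have e2 : 0 < e / 2 by rewrite divr_gt0.
have /cvgrPdist_lt/(_ _ e2)/nbhs_ballP[d0 /= d00 h0] := lf 0%N.
have /cvgrPdist_lt/(_ _ e2)/nbhs_ballP[d1 /= d10 h1] := lf 1%N.
exists (Num.min d0 d1) => [|t /andP[t0]]; first by rewrite lt_min d00.
rewrite lt_min => /andP[td0 td1].
have ht d : t < d -> ball (0 : R) d t by rewrite /ball /= sub0r normrN gtr0_norm.
have := h0 t (ht _ td0); have := h1 t (ht _ td1); have := alt_sum_bounds t0.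
rewrite /= !ltr_norml ler_norml.
move: (alt_sum t) (f t 0) (f t 1) => a b c /andP[? ?] /andP[? ?] /andP[? ?].
by apply/andP; split; lra.
Qed.

End AlternatingExponentialSums.

(** * The eta functions *)

Section NonnegativeSums.
Variable R : realType.
Local Open Scope ereal_scope.

Lemma esum_series (a : nat -> R) : (forall i, (0 <= a i)%R) -> cvgn (series a) ->
  \esum_(i in [set: nat]) (a i)%:E = (limn (series a))%:E.
Proof.
move=> a0 ca; rewrite -nneseries_esumT; last by move=> i; rewrite lee_fin.
rewrite -EFin_lim//; congr (limn _).
by apply/funext => n; rewrite /= -sumEFin.
Qed.

Lemma esum_fin_cvg (a : nat -> R) : (forall i, (0 <= a i)%R) ->
  \esum_(i in [set: nat]) (a i)%:E < +oo -> cvgn (series a).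
Proof.
move=> a0 fin; apply: nondecreasing_is_cvgn.
  by apply: nondecreasing_series => q _ _; exact: a0.
exists (fine (\esum_(i in [set: nat]) (a i)%:E)) => _ [n _ <-].
have ge0 : 0 <= \esum_(i in [set: nat]) (a i)%:E by apply: esum_ge0 => i _; rewrite lee_fin.
rewrite -lee_fin fineK; last by rewrite ge0_fin_numE.
rewrite -nneseries_esumT; last by move=> i; rewrite lee_fin.
rewrite /series /= -sumEFin; apply: nneseries_lim_ge => i _ _; by rewrite lee_fin.
Qed.

Lemma esum_fibers (T : choiceType) (lam : nat -> T) (V : set T) (a : nat -> \bar R) :
  (forall i, 0 <= a i) ->
  \esum_(i in lam @^-1` V) a i = \esum_(x in V) \esum_(i in [set i | lam i = x]) a i.
Proof.
move=> a0; rewrite esum_esum//; apply/esym.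
rewrite (@reindex_esum R _ _ (lam @^-1` V) _ (fun i => (lam i, i)))//.
split=> [i /= Vi|i j _ _ []//|[x i] [/= Vx xi]]; first by split.
by exists i; rewrite xi.
Qed.

Lemma esum_card_cst (F : set nat) (m : nat) (c : R) : (0 <= c)%R -> F #= `I_m ->
  \esum_(i in F) c%:E = (m%:R * c)%:E.
Proof.
move=> c0; rewrite card_eq_sym => /card_set_bijP[f bf].
rewrite (@reindex_esum R _ _ `I_m F f) // esum_fset; [|exact: finite_II|by move=> i _; rewrite lee_fin].
by rewrite -fsbig_ord sumEFin sumr_const card_ord mulr_natl.
Qed.

End NonnegativeSums.

(** * From the spectrum to the dimensions of the kernels *)

Section SpectralSeries.
Variables (R : realType) (k : nat) (M : chd R k) (s : spin_sign) (lam : nat -> R).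
Hypothesis spec : nonzero_spectrum M s lam.
Local Notation K := (@eigen_mx_dim R k s).

(** For x > 0 this is x^(-t). *)
Definition power_term (t x : R) : R := expR (- t * ln x).

Lemma sin_eq0_pos (x : R) : 0 < x -> sin x = 0 -> exists y : nat, x = y.+1%:R * pi.
Proof.
move=> x0 sx; have pi0 := pi_gt0 R.
pose z := Num.floor (x / pi).
have z0 : 0 <= z by rewrite floor_ge0 divr_ge0// ltW.
have [y zy] : exists y : nat, z = y by case: z z0 => // y _; exists y.
have h1 : y%:R * pi <= x by rewrite -ler_pdivlMr// -[y%:R]/(y%:~R) -zy floor_le.
have h2 : x < y%:R * pi + pi.
  rewrite -[X in _ + X]mul1r -mulrDl -ltr_pdivrMr//.
  by have := floorD1_gt (x / pi); rewrite -/z zy intrD.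
have h3 : sin (x - y%:R * pi) = 0.
  by rewrite sinB sx mul0r sin_natpi mulr0 subrr.
have h4 : x = y%:R * pi.
  apply/eqP; rewrite -subr_eq0; apply: contraT => ne.
  have : 0 < sin (x - y%:R * pi).
    by apply: sin_gt0_pi; rewrite lt_neqAle eq_sym ne subr_ge0 h1 ltrBlDl.
  by rewrite h3 ltxx.
case: y {zy h1 h2 h3} h4 => [|y] h4; last by exists y.
by move: x0; rewrite h4 mul0r ltxx.
Qed.

Lemma spectral_multiplicity : exists m : R -> nat, forall x, x != 0 ->
  [/\ [set i | lam i = x] #= `I_(m x), (K x <= m x)%N &
      (m x + K (- x) = m (- x) + K x)%N].
Proof.
have [_ h] := spec.
have /choice[m hm] (x : R) : exists m : nat, x != 0 ->
    has_dim (eigenspinors M s x) m /\ [set i | lam i = x] #= `I_m.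
  have [->|x0] := eqVneq x 0; first by exists 0%N.
  by have [m hm c] := h x x0; exists m.
exists m => x x0; have x0' : - x != 0 by rewrite oppr_eq0.
have [d1 c1] := hm _ x0; have [d2 c2] := hm _ x0'.
by split; [exact: c1|exact: eigen_mx_dim_le x0 d1 d2|exact: eigenspace_dim_symm x0 d1 d2].
Qed.

Local Open Scope ereal_scope.

(** Absolute convergence splits the series into its positive and negative eigenvalues, and each part
    becomes an unordered sum over x > 0 of m(x) x^-t or m(- x) x^-t, with m the multiplicity. By
    m(x) + K(- x) = m(- x) + K(x), the difference of the two parts is the one with K in place of
    m. *)
Lemma spectral_series t (L : R) :
  cvgn (series (fun i => power_term t `|lam i|)) ->
  series (fun i => Num.sg (lam i) * power_term t `|lam i|)%R @ \oo --> L ->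
  series (fun y => ((K (y.+1%:R * pi))%:R - (K (- (y.+1%:R * pi)))%:R) * power_term t (y.+1%:R * pi))%R @ \oo --> L.
Proof.
move=> cw cL; have [lam0 _] := spec; have [m hm] := spectral_multiplicity.
pose w i := power_term t `|lam i|.
have w0 i : (0 <= w i)%R by exact: expR_ge0.
pose V := [set x : R | (0 < x)%R].
pose wp i := (if (0 < lam i)%R then w i else 0)%R.
pose wn i := (if (0 < - lam i)%R then w i else 0)%R.
have wp0 i : (0 <= wp i)%R by rewrite /wp; case: ifP.
have wn0 i : (0 <= wn i)%R by rewrite /wn; case: ifP.
have cwp : cvgn (series wp).
  by apply: (@series_le_cvg _ _ w) => // i; rewrite /wp; case: ifP.
have cwn : cvgn (series wn).
  by apply: (@series_le_cvg _ _ w) => // i; rewrite /wn; case: ifP.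
have LE : L = (limn (series wp) - limn (series wn))%R.
  apply: (cvg_unique _ cL) => //.
  suff -> : series (fun i => Num.sg (lam i) * power_term t `|lam i|)%R =
     (fun n => series wp n - series wn n)%R by exact: cvgB.
    apply/funext => n; rewrite /series /= -sumrB; apply: eq_bigr => i _.
    rewrite /wp /wn oppr_gt0 -/(w i); have := lam0 i.
    by case: (ltgtP (lam i) 0%R) => // h _; [rewrite ltr0_sg// mulN1r sub0r|rewrite gtr0_sg// mul1r subr0].
(* The sign parameter treats the positive and the negative eigenvalues at once. *)
have fibre (sgn : R) : (sgn = 1 \/ sgn = -1)%R ->
  \esum_(i in [set: nat]) (if (0 < sgn * lam i)%R then w i else 0)%:E =
  \esum_(x in V) ((m (sgn * x))%:R * power_term t x)%:E.
  move=> hs; have s2 : (sgn * sgn = 1)%R by case: hs => ->; rewrite ?mulr1 ?mulrNN ?mulr1.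
  have sn : `|sgn|%R = 1%R by case: hs => ->; rewrite ?normrN normr1.
  transitivity (\esum_(i in (fun i => sgn * lam i)%R @^-1` V) (w i)%:E).
    rewrite [RHS]esum_mkcond; apply: eq_esum => i _.
    have -> : (i \in (fun i => sgn * lam i)%R @^-1` V) = (0 < sgn * lam i)%R by apply/idP/idP; rewrite inE.
    by case: ifP.
  rewrite (@esum_fibers _ _ (fun i => sgn * lam i)%R V); last by move=> i; rewrite lee_fin.
  apply: eq_esum => x Vx.
  have sx0 : (sgn * x != 0)%R.
    by rewrite -normr_eq0 normrM sn mul1r normr_eq0 gt_eqF.
  have [cm _ _] := hm _ sx0.
  have E : [set i | (sgn * lam i)%R = x] = [set i | lam i = (sgn * x)%R].
    apply/seteqP; split=> i /=; [move=> <-|move=> ->]; by rewrite mulrA s2 mul1r.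
  rewrite E -(esum_card_cst (expR_ge0 _) cm); apply: eq_esum => i /= li.
  rewrite /w li normrM sn mul1r ger0_norm// ltW//.
have Pp : \esum_(x in V) ((m x)%:R * power_term t x)%:E = (limn (series wp))%:E.
  rewrite -(esum_series wp0 cwp); transitivity (\esum_(x in V) ((m (1 * x))%:R * power_term t x)%:E).
    by apply: eq_esum => x _; rewrite mul1r.
  by rewrite -fibre; [apply: eq_esum => i _; rewrite mul1r|left].
have Pn : \esum_(x in V) ((m (- x))%:R * power_term t x)%:E = (limn (series wn))%:E.
  rewrite -(esum_series wn0 cwn); transitivity (\esum_(x in V) ((m (-1 * x))%:R * power_term t x)%:E).
    by apply: eq_esum => x _; rewrite mulN1r.
  by rewrite -fibre; [apply: eq_esum => i _; rewrite mulN1r|right].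
(* The kernels vanish off the zeros of the sine, so only the positive multiples of pi remain. *)
have kernel (sgn : R) : (sgn = 1 \/ sgn = -1)%R ->
    \esum_(x in V) ((K (sgn * x))%:R * power_term t x)%:E =
    \esum_(y in [set: nat]) ((K (sgn * (y.+1%:R * pi)))%:R * power_term t (y.+1%:R * pi))%:E.
  move=> hs; pose e (y : nat) : R := (y.+1%:R * pi)%R.
  have einj : set_inj [set: nat] e.
    move=> y z _ _ /(mulIf (lt0r_neq0 (pi_gt0 R)))/eqP; rewrite eqr_nat => /eqP[].
    by [].
  rewrite -(esum_image _ _ (fun x => ((K (sgn * x))%:R * power_term t x)%:E) einj).
  rewrite (esumID (e @` [set: nat])); last first.
    by move=> x _; rewrite lee_fin mulr_ge0// expR_ge0.
  rewrite [X in _ + X]esum1 ?adde0.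
    congr esum; apply/seteqP; split=> [x []//|x [y _ <-]]; split; last by exists y.
    by rewrite /V /= mulr_gt0// pi_gt0.
  move=> x [Vx nx]; have [sx|sx] := eqVneq (sin x) 0%R.
    by exfalso; apply: nx; have [y ->] := sin_eq0_pos Vx sx; exists y.
  rewrite eigen_mx_dim0 ?mul0r//.
  by case: hs => ->; rewrite ?mul1r// mulN1r sinN oppr_eq0.
pose ap y : R := ((K (y.+1%:R * pi))%:R * power_term t (y.+1%:R * pi))%R.
pose an y : R := ((K (- (y.+1%:R * pi)))%:R * power_term t (y.+1%:R * pi))%R.
have ap0 y : (0 <= ap y)%R by rewrite mulr_ge0// expR_ge0.
have an0 y : (0 <= an y)%R by rewrite mulr_ge0// expR_ge0.
have Kp : \esum_(x in V) ((K x)%:R * power_term t x)%:E = \esum_(y in [set: nat]) (ap y)%:E.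
  transitivity (\esum_(x in V) ((K (1 * x))%:R * power_term t x)%:E).
    by apply: eq_esum => x _; rewrite mul1r.
  by rewrite kernel; [apply: eq_esum => y _; rewrite mul1r|left].
have Kn : \esum_(x in V) ((K (- x))%:R * power_term t x)%:E = \esum_(y in [set: nat]) (an y)%:E.
  transitivity (\esum_(x in V) ((K (-1 * x))%:R * power_term t x)%:E).
    by apply: eq_esum => x _; rewrite mulN1r.
  by rewrite kernel; [apply: eq_esum => y _; rewrite mulN1r|right].
have fin (m' K' : R -> nat) (l : R) : (forall x, V x -> (K' x <= m' x)%N) ->
    \esum_(x in V) ((m' x)%:R * power_term t x)%:E = l%:E ->
    \esum_(x in V) ((K' x)%:R * power_term t x)%:E < +oo.
  move=> Km El; apply: (@le_lt_trans _ _ l%:E); last exact: ltry.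
  rewrite -El; apply: le_esum => x Vx; rewrite lee_fin ler_wpM2r ?expR_ge0//.
  by rewrite ler_nat Km.
have cap : cvgn (series ap).
  apply: esum_fin_cvg => //; rewrite -Kp; apply: (fin m K _ _ Pp) => x Vx.
  by have [] := hm x (lt0r_neq0 Vx).
have can : cvgn (series an).
  apply: esum_fin_cvg => //; rewrite -Kn; apply: (fin (fun x => m (- x)%R) (fun x => K (- x)%R) _ _ Pn) => x Vx.
  by have [] := hm (- x)%R; rewrite ?oppr_eq0 ?lt0r_neq0.
(* The symmetry of multiplicities is summed in additive form, since differences would not be sums of
   nonnegative terms. *)
have key : (limn (series wp) + limn (series an) = limn (series wn) + limn (series ap))%R.
  have Ea := etrans Kp (esum_series ap0 cap); have En := etrans Kn (esum_series an0 can).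
  have pos (f : R -> nat) x : V x -> 0 <= ((f x)%:R * power_term t x)%:E.
    by move=> _; rewrite lee_fin mulr_ge0// expR_ge0.
  have add (f g : R -> nat) (a b : R) :
      \esum_(x in V) ((f x)%:R * power_term t x)%:E = a%:E ->
      \esum_(x in V) ((g x)%:R * power_term t x)%:E = b%:E ->
      \esum_(x in V) ((f x + g x)%N%:R * power_term t x)%:E = (a + b)%:E.
    move=> fa gb; rewrite EFinD -fa -gb -(esumD (pos f) (pos g)).
    by apply: eq_esum => x _; rewrite natrD mulrDl.
  have e1 := add m (fun x => K (- x)%R) _ _ Pp En.
  have e2 := add (fun x => m (- x)%R) K _ _ Pn Ea.
  have e3 := etrans (esym e1) (etrans (eq_esum _) e2).
  apply: EFin_inj; apply: e3 => x Vx.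
  by have [_ _ ->] := hm x (lt0r_neq0 Vx).
have alg (a b c d : R) : (a + d = b + c -> a - b = c - d)%R.
  by move=> h; apply/eqP; rewrite subr_eq addrAC [X in _ == (X - _)%R]addrC -h addrK.
rewrite LE (alg _ _ _ _ key).
have E : series (fun y => ((K (y.+1%:R * pi))%:R - (K (- (y.+1%:R * pi)))%:R) * power_term t (y.+1%:R * pi))%R
   = (fun n => series ap n - series an n)%R.
  by apply/funext => n; rewrite /series /= -sumrB; apply: eq_bigr => y _; rewrite mulrBl.
have C : (fun n => series ap n - series an n)%R @ \oo --> (limn (series ap) - limn (series an))%R.
  exact: (cvgB cap can).
exact: (eq_ind_r (fun f : nat -> R => f @ \oo --> (limn (series ap) - limn (series an))%R) C E).
Qed.

End SpectralSeries.

Lemma series_mul (V : zmodType) (f : nat -> V) (N w : nat) :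
  series f (N * w)%N = \sum_(0 <= q < N) \sum_(q * w <= i < q.+1 * w) f i.
Proof. exact: big_nat_mul. Qed.

(** * Logarithms of arithmetic progressions and antiperiodic coefficients *)

Section ArithmeticProgressions.
Variables (R : realType) (n : nat).

(** The logarithm turns v^-t into exp(- t u). The common difference is (n + 1) pi, so n is one less
    than the dimension, and y = 0 is the progression starting at pi. *)
Definition log_progression (y j : nat) : R := ln ((y.+1 + j * n.+1)%:R * pi).
Local Notation u := log_progression.

Let v (y j : nat) : R := (y.+1 + j * n.+1)%:R * pi.

Let v_ge1 y j : 1 <= v y j.
Proof.
rewrite /v; have p2 := pi_ge2 R.
rewrite (@le_trans _ _ (1 * pi))//; first by rewrite mul1r (le_trans _ p2)// ler1n.
by rewrite ler_wpM2r ?pi_ge0// ler1n addSn.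
Qed.

Let v_gt0 y j : 0 < v y j.
Proof. exact: lt_le_trans ltr01 (v_ge1 y j). Qed.

Lemma log_progression_incr y j : u y j <= u y j.+1.
Proof.
rewrite ler_ln ?posrE ?v_gt0// ler_wpM2r ?pi_ge0// ler_nat leq_add2l leq_mul2r.
by rewrite leqnSn orbT.
Qed.

(** The ratio of consecutive terms is 1 + (n + 1) / (y + 1 + j (n + 1)), at most n + 2. *)
Lemma log_progression_gap y j : u y j.+1 - u y j <= ln n.+2%:R.
Proof.
rewrite /u -/(v y j) -/(v y j.+1) lerBlDr -lnM ?posrE ?ltr0n ?v_gt0//.
rewrite ler_ln ?posrE ?mulr_gt0 ?ltr0n ?v_gt0 ?pi_gt0//.
by rewrite /v mulrA ler_wpM2r ?pi_ge0// -natrM ler_nat; nia.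
Qed.

Lemma log_progression_abs y j : `|u y j| <= u y j + 0.
Proof. by rewrite addr0 ger0_norm// ln_ge0// v_ge1. Qed.

(** The middle one of three consecutive terms is their arithmetic mean, hence at least the geometric
    mean of its neighbours. *)
Lemma log_progression_mid y j : u y j + u y j.+2 <= 2 * u y j.+1.
Proof.
rewrite mulr_natl mulr2n -!lnM ?posrE ?v_gt0//.
rewrite ler_ln ?posrE ?mulr_gt0 ?ltr0n ?v_gt0 ?pi_gt0//.
rewrite /v mulrACA [leRHS]mulrACA ler_wpM2r ?mulr_ge0 ?pi_ge0// -!natrM ler_nat.
nia.
Qed.

Lemma log_progression_unbounded y (B : R) : exists j, B < u y j.
Proof.
exists (Num.truncn (expR B)).+1; rewrite -[B in ltLHS]expRK.
rewrite ltr_ln ?posrE ?v_gt0 ?expR_gt0//.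
apply: (lt_le_trans (truncnS_gt (expR B))).
rewrite -[leLHS]mulr1 ler_pM// ?ler0n//; last by rewrite (le_trans _ (pi_ge2 R))// ler1n.
by rewrite ler_nat (leq_trans _ (leq_addl _ _))// leq_pmulr.
Qed.

Lemma real_analytic_progression y p : 0 < p -> real_analytic_at (alt_sum (u y)) p.
Proof.
exact: (real_analytic_alt_sum (log_progression_incr y) (log_progression_gap y) (log_progression_abs y)).
Qed.

Lemma cvg_progression y : alt_sum (u y) t @[t --> 0^'+] --> (2^-1 : R).
Proof.
apply/cvgrPdist_le => e e0.
have [d d0 hd] := alt_sum_half (log_progression_incr y) (log_progression_mid y)
  (log_progression_unbounded y) e0.
near=> t; rewrite distrC; apply: hd; apply/andP; split.
  by near: t; exact: nbhs_right_gt.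
by near: t; exact: nbhs_right_lt.
Unshelve. all: by end_near. Qed.

(** The partial sums are taken at multiples of 2 (n + 1), a subsequence with the same limit. In each
    block the second half repeats the coefficients of the first with opposite sign, so that every
    residue y contributes one pair of [alt_sum] for its progression. *)
Lemma antiperiodic_series (D : nat -> R) (t L : R) : 0 < t ->
  (forall y, D (n.+1 + y)%N = - D y) ->
  series (fun y => D y.+1 * power_term t (y.+1%:R * pi)) @ \oo --> L ->
  L = \sum_(0 <= y < n.+1) D y.+1 * alt_sum (u y) t.
Proof.
move=> t0 DN cL; pose f y := D y.+1 * power_term t (y.+1%:R * pi).
have D2 q y : D (q * n.+1.*2 + y)%N = D y.
  elim: q => [|q IH]; first by rewrite mul0n.
  by rewrite mulSn -[X in (X + _ + _)%N]addnn -!addnA !DN opprK IH.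
pose g y q := expR (- t * u y q.*2) - expR (- t * u y q.*2.+1).
have block q : \sum_(q * n.+1.*2 <= i < q.+1 * n.+1.*2) f i = \sum_(0 <= y < n.+1) D y.+1 * g y q.
  rewrite -{1}[(q * n.+1.*2)%N]add0n big_addn mulSn addnK -addnn.
  rewrite (@big_cat_nat _ _ _ n.+1) ?leq_addr//=.
  rewrite -[X in _ + \sum_(X <= _ < _) _]add0n big_addn addnK -big_split /=.
  apply: eq_bigr => y _; rewrite /f /g.
  have -> : (y + q * (n.+1 + n.+1)).+1 = (q * n.+1.*2 + y.+1)%N by rewrite addnn; lia.
  have -> : (y + n.+1 + q * (n.+1 + n.+1)).+1 = (q * n.+1.*2 + (n.+1 + y.+1))%N.
    by rewrite addnn; lia.
  rewrite !D2 DN mulNr -mulrBr /power_term /log_progression.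
  have -> : (q * n.+1.*2 + y.+1 = y.+1 + q.*2 * n.+1)%N by lia.
  have -> : (q * n.+1.*2 + (n.+1 + y.+1) = y.+1 + q.*2.+1 * n.+1)%N by lia.
  by [].
have blocks N : series f (N * n.+1.*2)%N = \sum_(0 <= y < n.+1) D y.+1 * series (g y) N.
  apply: etrans (series_mul f N n.+1.*2) _.
  apply: etrans (eq_bigr _ (fun q _ => block q)) _.
  by rewrite exchange_big; apply: eq_bigr => y _; rewrite -mulr_sumr.
have sub : (fun N => N * n.+1.*2)%N @ \oo --> \oo.
  apply/cvgnyPge => A; near=> N.
  have : (A <= N)%N by near: N; exact: nbhs_infty_ge.
  by nia.
have c1 := cvg_comp _ _ sub cL.
have c2 : (fun N => \sum_(0 <= y < n.+1) D y.+1 * series (g y) N) @ \oo -->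
    \sum_(0 <= y < n.+1) D y.+1 * alt_sum (u y) t.
  apply: cvg_big => [|y _]; first exact: add_continuous.
  apply: cvgMl_tmp.
  exact: (is_cvg_alt_sum (log_progression_incr y) t0).
have e : series f \o (fun N => N * n.+1.*2)%N = (fun N => \sum_(0 <= y < n.+1) D y.+1 * series (g y) N).
  by apply/funext => N /=; rewrite blocks.
by apply: (cvg_unique _ c1); rewrite // -/f e.
Unshelve. all: by end_near. Qed.

End ArithmeticProgressions.

Lemma limit_eq0 (R : realType) (f : R -> R) (l : R) : f t @[t --> 0^'+] --> l ->
  (forall e, 0 < e -> exists t, 0 < t < e /\ f t = 0) -> l = 0.
Proof.
move=> /cvgrPdist_lt fl acc; apply/eqP; apply: contraT; rewrite -normr_gt0 => l0.
have [e /= e0 he] := fl _ l0.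
have [t [/andP[t0 te] ft]] := acc e e0.
have := he t; rewrite /ball /= sub0r normrN gtr0_norm// ft subr0 ltxx.
by move=> /(_ te t0).
Qed.

Lemma eq_real_complexB (R : realType) (x y : R[i]) (a : R) :
  complex.Im x - complex.Im y = 0 -> complex.Re x - complex.Re y = a -> x - y = a%:C.
Proof. by case: x y => [x1 x2] [y1 y2] /= e <-; apply/eqP; rewrite eq_complex /= e !eqxx. Qed.

(** * The difference of the eta functions and its value at 0 *)

Section EtaDifference.
Variables (R : realType) (k : nat).

Lemma eta_term_real (x t : R) : eta_term x t%:C = (Num.sg x * power_term t `|x|)%:C.
Proof.
rewrite /eta_term /cexp -rmorphN -rmorphM /= -/(power_term t `|x|) cos0 sin0.
by rewrite [1 +i* 0](_ : _ = 1)// mulr1 -rmorphM.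
Qed.

Lemma eta_function_real (M : chd R k) s F : is_eta_function M s F ->
  exists c : R, forall t, c < t -> complex.Im (F t%:C) = 0 /\
    series (fun y => ((eigen_mx_dim k s (y.+1%:R * pi : R))%:R -
                      (eigen_mx_dim k s (- (y.+1%:R * pi : R)))%:R) *
                     power_term t (y.+1%:R * pi)) @ \oo --> complex.Re (F t%:C).
Proof.
move=> [_ [lam spec [c hc]]]; exists c => t ct.
have [cw cF] := hc t%:C ct; have [lam0 _] := spec.
have E : series (fun i => eta_term (lam i) t%:C) =
    (fun n => (series (fun i => Num.sg (lam i) * power_term t `|lam i|) n)%:C).
  apply/funext => n; rewrite /series /= rmorph_sum; apply: eq_bigr => i _.
  exact: eta_term_real.
have cR : series (fun i => Num.sg (lam i) * power_term t `|lam i|) @ \oo --> complex.Re (F t%:C).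
  by have := cvg_Re cF; rewrite E.
have cI : (fun _ : nat => 0 : R) @ \oo --> complex.Im (F t%:C).
  by have := cvg_Im cF; rewrite E.
split; first by apply: (cvg_unique _ cI) => //; exact: cvg_cst.
apply: (spectral_series spec) => //.
have <- : (fun i => `|lam i| `^ (- t)) = (fun i => power_term t `|lam i|) => //.
by apply/funext => i; rewrite /powR normr_eq0 (negbTE (lam0 i)).
Qed.

Local Notation n := k.*2.+1.

Lemma eta_difference_real (M : chd R k) F1 F2 :
  is_eta_function M SpinPlus F1 -> is_eta_function M SpinMinus F2 ->
  exists c : R, forall t, c < t ->
    complex.Im (F1 t%:C) - complex.Im (F2 t%:C) = 0 /\
    complex.Re (F1 t%:C) - complex.Re (F2 t%:C) =
      \sum_(0 <= y < n) (dim_diff R k y.+1)%:~R * alt_sum (log_progression R k.*2 y) t.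
Proof.
move=> /eta_function_real[c1 h1] /eta_function_real[c2 h2].
(* Beyond both thresholds and nonnegative, which ensures t > 0. *)
exists (`|c1| + `|c2|) => t ct.
have t0 : 0 < t by apply: le_lt_trans ct; rewrite addr_ge0.
have [|i1 r1] := h1 t.
  by apply: le_lt_trans ct; rewrite (le_trans (ler_norm _))// lerDl.
have [|i2 r2] := h2 t.
  by apply: le_lt_trans ct; rewrite (le_trans (ler_norm _))// lerDr.
split; first by rewrite i1 i2 subrr.
apply: (@antiperiodic_series R k.*2 (fun y => (dim_diff R k y)%:~R)) => //.
  by move=> y; rewrite dim_diffD rmorphN.
set f1 := series _ in r1; set f2 := series _ in r2; set f := series _.
have -> : f = (fun N => f1 N - f2 N); last exact: cvgB r1 r2.
apply/funext => N; rewrite /f /f1 /f2 /series /= -sumrB; apply: eq_bigr => y _.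
by rewrite -mulrBl /dim_diff !rmorphB.
Qed.

(** The identity at large t is carried to points t > 0 arbitrarily close to 0, separately for the
    real and imaginary parts. There both sides have limits: the left by analyticity of the two eta
    functions at 0, the right because each alternating sum tends to 1/2. *)
Lemma eta_invariants_difference (M : chd R k) (v1 v2 : R[i]) :
  is_eta_invariant M SpinPlus v1 -> is_eta_invariant M SpinMinus v2 ->
  v1 - v2 = (2^-1 * \sum_(1 <= y < n.+1) (dim_diff R k y)%:~R)%:C.
Proof.
move=> [F1 [e1 a1 ->]] [F2 [e2 a2 ->]].
have [c hc] := eta_difference_real e1 e2.
have z0 : 0 = 0%:C :> R[i] by rewrite rmorph0.
rewrite {}z0 in a1 a2 *.
have [[m1 _] [m2 _]] := (e1, e2).
pose G t : R := \sum_(0 <= y < n) (dim_diff R k y.+1)%:~R * alt_sum (log_progression R k.*2 y) t.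
pose gI t : R := complex.Im (F1 t%:C) - complex.Im (F2 t%:C).
pose gR t : R := complex.Re (F1 t%:C) - complex.Re (F2 t%:C).
have cI : {for 0, continuous gI}.
  exact: real_analytic_continuous (real_analyticB (analytic_Im a1) (analytic_Im a2)).
have cR : {for 0, continuous gR}.
  exact: real_analytic_continuous (real_analyticB (analytic_Re a1) (analytic_Re a2)).
have zI : forall e, 0 < e -> exists t, 0 < t < e /\ gI t = 0.
  apply: (@real_meromorphic_identity _ gI c) => [p _|t /hc[]//].
  exact: real_meromorphicB (meromorphic_Im (m1 _)) (meromorphic_Im (m2 _)).
have zR : forall e, 0 < e -> exists t, 0 < t < e /\ gR t - G t = 0.
  apply: (@real_meromorphic_identity _ (fun t => gR t - G t) c) => [p p0|t /hc[_ h]]; last first.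
    by rewrite /gR h subrr.
  apply: (real_meromorphicB (real_meromorphicB (meromorphic_Re (m1 _)) (meromorphic_Re (m2 _)))).
  apply/real_analytic_meromorphic/real_analytic_sum => y.
  exact/real_analyticZ/real_analytic_progression.
have cG : G t @[t --> 0^'+] --> (\sum_(0 <= y < n) (dim_diff R k y.+1)%:~R * 2^-1 : R).
  apply: cvg_big => [|y _]; first exact: add_continuous.
  by apply: cvgMl_tmp; exact: cvg_progression.
have vI := limit_eq0 (cvg_at_right_filter cI) zI.
have vR : gR 0 - \sum_(0 <= y < n) (dim_diff R k y.+1)%:~R * 2^-1 = 0.
  exact: limit_eq0 (cvgB (cvg_at_right_filter cR) cG) zR.
have vR' : gR 0 = \sum_(0 <= y < n) (dim_diff R k y.+1)%:~R * 2^-1 := subr0_eq vR.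
have sum_shift : \sum_(1 <= y < n.+1) (dim_diff R k y)%:~R =
    \sum_(0 <= y < n) (dim_diff R k y.+1)%:~R :> R.
  by rewrite big_add1.
have eR : gR 0 = 2^-1 * \sum_(1 <= y < n.+1) (dim_diff R k y)%:~R.
  rewrite vR' sum_shift mulr_sumr.
  by apply: eq_bigr => y _; exact: mulrC.
exact: (eq_real_complexB vI eR).
Qed.

End EtaDifference.

Theorem corollary2 (R : realType) (k : nat) (M : chd R k)
    (eta_plus eta_minus : R[i]) :
  is_eta_invariant M SpinPlus eta_plus ->
  is_eta_invariant M SpinMinus eta_minus ->
  exists m : int, eta_plus - eta_minus = (2 * m)%:~R.
Proof.
move=> e1 e2; rewrite (eta_invariants_difference e1 e2).
(* The sum over a period is 4 z, and its half is 2 z. *)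
have [z zE] := sum_dim_diff R k; exists z.
have -> : 2^-1 * \sum_(1 <= y < k.*2.+2) (dim_diff R k y)%:~R = (2 * z)%:~R :> R.
  by rewrite -rmorph_sum zE !intrM; field.
exact: rmorph_int.
Qed.
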